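(* Fix an integer $k\geq 2$ and suppose that $0<p\leq\infty$. For every $f\in H^p$, \[\|W_k f\|_{H^p} \leq \max\big(k^{1/p-1},1\big)\, \|f\|_{H^p},\] and this inequality is sharp, i.e. the constant $\max(k^{1/p-1},1)$ cannot be replaced by any smaller one. Moreover, for $f\in H^p$, equality is attained if and only if (a) $f\equiv 0$, when $0<p<1$; (b) $W_k f=f$, when $1<p<\infty$.
   Context: Let $\mathbb{D}=\{z\in\mathbb{C}: |z|<1\}$. For $0<p<\infty$, $H^p$ is the space of analytic functions $f$ in $\mathbb{D}$ with $\|f\|_{H^p}^p=\lim_{r\to1^-}\int_0^{2\pi}|f(re^{i\theta})|^p\,\frac{d\theta}{2\pi}<\infty$; $H^\infty$ is the space of bounded analytic functions in $\mathbb{D}$ with $\|f\|_{H^\infty}=\sup_{|z|<1}|f(z)|$. For $p=\infty$, $1/p=0$. For an integer $k\geq2$ put $\omega_k=\exp(2\pi i/k)$. The F. Wiener transform of $f(z)=\sum_{n\geq0}a_nz^n$ is \[W_kf(z)=\frac1k\sum_{j=0}^{k-1}f(\omega_k^jz)=\sum_{n=0}^\infty a_{kn}z^{kn}.\] *)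

(* Defs.v *)
From Stdlib Require Import Reals.
From Coquelicot Require Export Coquelicot.
Open Scope R_scope.

(** A function on the unit disc is a total function [C -> C] of which only the
    values on [unit_disc] are ever used. *)
Definition unit_disc (z : C) : Prop := Cmod z < 1.

(** Differentiability is over the field [C], i.e. complex differentiability. *)
Definition analytic_in_disc (f : C -> C) : Prop :=
  forall z : C, unit_disc z ->
    ex_derive (K := C_AbsRing) (V := C_NormedModule) f z.

(** exp(i t) *)
Definition expi (t : R) : C := (cos t, sin t).

(** [x ^ q] for [x >= 0] and [q > 0]. [Rpower] cannot be used alone because
    [Rpower 0 q = 1]. *)
Definition rpow (x q : R) : R := if Rlt_dec 0 x then Rpower x q else 0.

Definition circle_mean (q : R) (f : C -> C) (r : R) : R :=
  RInt (fun t : R => rpow (Cmod (f (RtoC r * expi t)%C)) q / (2 * PI))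
       0 (2 * PI).

(** Only [0 < p <= p_infty] is meant; [m_infty] is junk. *)
Definition in_Hp (p : Rbar) (f : C -> C) : Prop :=
  analytic_in_disc f /\
  match p with
  | Finite q => exists l : R, filterlim (circle_mean q f) (at_left 1) (locally l)
  | p_infty => exists M : R, forall z : C, unit_disc z -> Cmod (f z) <= M
  | m_infty => False
  end.

(** [iota] picks the limit; it is meaningful when [in_Hp p f] holds. *)
Definition Hp_norm (p : Rbar) (f : C -> C) : R :=
  match p with
  | Finite q =>
      rpow (iota (fun l : R =>
                    filterlim (circle_mean q f) (at_left 1) (locally l)))
           (/ q)
  | p_infty =>
      real (Lub_Rbar (fun x : R => exists z : C, unit_disc z /\ x = Cmod (f z)))
  | m_infty => 0
  end.

Definition root_of_unity (k : nat) : C := expi (2 * PI / INR k).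

(** [sum_n a n] is the sum of [a 0, ..., a n], both ends included. *)
Definition wiener (k : nat) (f : C -> C) (z : C) : C :=
  (/ RtoC (INR k) *
     sum_n (fun j : nat => f (Cpow (root_of_unity k) j * z)) (k - 1))%C.

(** [Rbar_inv p_infty = 0]. *)
Definition wiener_const (k : nat) (p : Rbar) : R :=
  Rmax (Rpower (INR k) (real (Rbar_inv p) - 1)) 1.

(* Main.v *)
(** Since [W_k f] averages the rotations [f(w^j z)], the inequality is an integrated
    pointwise one: subadditivity of [x^p] for [p <= 1], convexity for [p > 1].  That
    [W_k f] has a limiting mean follows from the monotonicity in [r] of the means of
    [|f|^p] over [|z| = r], i.e. from the subharmonicity of [|f|^p].

    Equality means that the mean over [|z| = r] of the nonnegative defect in the pointwise
    inequality tends to zero as [r] tends to 1.  The defect is bounded from below in terms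
    of [|h|^s] for an analytic [h]: [h = f(z) f(wz)] if [p < 1], [h = f - W_k f] if
    [1 < p < 2] and [h = (W_k f)^n (f - W_k f)] if [p >= 2].  Interpolation shows that the
    means of [|h|^s] tend to zero; being increasing in [r], they vanish, so [h = 0].

    For [p < 1] the constant is approached by [(1 + z)^N] as [N] grows: the rotations of
    this function concentrate at different points of the circle. *)

Require Import Defs.
From Stdlib Require Import Reals Lra Lia Psatz Classical ClassicalEpsilon.
From Coquelicot Require Import Coquelicot.

(** * Goursat's theorem for closed real 1-forms on rectangles *)

(** Analyticity means complex differentiability at each point, and everything is drawn from
    Goursat's theorem through the mean value property of real parts; neither power series nor
    boundary values occur. The subharmonicity of [|f|^q] is obtained without a branch of [f^q], from
    a second-order lower bound in [Re g] and [Re g^2], where [g = f / f(z) - 1]. The absence of zero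
    divisors, by which a vanishing product [h] is split, comes from the same source: as [q] tends to
    0, the means of [|f|^q] detect an arc of zeros.

    In the equality case the obstacle is that the defect need not be subharmonic, so a mean tending
    to zero at the boundary says nothing inside the disc. Hence a power of the modulus of an
    analytic [h] is placed below it, up to a small multiple of the sum of all [|f(w^j z)|^q], whose
    means stay bounded. The form of [h] follows the degeneracy of the defect: for [p < 1] it
    controls only the smaller of [|f(z)|] and [|f(wz)|], and for [p > 2] its lower bound carries the
    factor [|W_k f|^(p-2)], which is lost near the zeros of [W_k f]; the power of [W_k f] in [h]
    makes up for it. *)

Lemma differentiable_pt_lim_continuous_l (P : R -> R -> R) (x y lx ly : R) :
  differentiable_pt_lim P x y lx ly -> continuous (fun s => P s y) x.
Proof.
  intros H.
  apply continuity_pt_filterlim.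
  assert (H' : continuity_2d_pt P x y)
    by (apply differentiable_continuity_pt; exists lx, ly; exact H).
  intros e He. destruct (H' (mkposreal e He)) as [d Hd].
  exists d; split; [apply d|]. intros z [_ Hz]. apply Hd; [exact Hz|].
  rewrite Rminus_diag, Rabs_R0; apply d.
Qed.

Lemma differentiable_pt_lim_continuous_r (P : R -> R -> R) (x y lx ly : R) :
  differentiable_pt_lim P x y lx ly -> continuous (fun t => P x t) y.
Proof.
  intros H.
  apply continuity_pt_filterlim.
  assert (H' : continuity_2d_pt P x y)
    by (apply differentiable_continuity_pt; exists lx, ly; exact H).
  intros e He. destruct (H' (mkposreal e He)) as [d Hd].
  exists d; split; [apply d|]. intros z [_ Hz]. apply Hd; [|exact Hz].
  rewrite Rminus_diag, Rabs_R0; apply d.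
Qed.

(** The counterclockwise integral of [Q ds + P dt] along the boundary of [[a,b] x [c,d]], with
    opposite sides paired. When [P + iQ] is analytic in [s + it], it is the imaginary part of the
    contour integral. *)
Definition boundary_integral (P Q : R -> R -> R) (a b c d : R) : R :=
  RInt (fun t => P b t - P a t) c d - RInt (fun s => Q s d - Q s c) a b.

(** The shared [al] is the closedness condition: the [s]-derivative of [P] equals the [t]-derivative
    of [Q]. *)
Definition closed_form_on (P Q : R -> R -> R) (a b c d : R) : Prop :=
  forall s t, a <= s <= b -> c <= t <= d ->
    exists al be ga, differentiable_pt_lim P s t al be /\
                     differentiable_pt_lim Q s t ga al.

Lemma closed_form_on_sub P Q a b c d a' b' c' d' :
  a <= a' -> b' <= b -> c <= c' -> d' <= d ->
  closed_form_on P Q a b c d -> closed_form_on P Q a' b' c' d'.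
Proof. intros ? ? ? ? H s t ? ?; apply H; lra. Qed.

Lemma closed_form_ex_RInt_P P Q a b c d s :
  closed_form_on P Q a b c d -> a <= s <= b -> c <= d ->
  ex_RInt (fun t => P s t) c d.
Proof.
  intros H Hs Hcd. apply (ex_RInt_continuous (V := R_CompleteNormedModule)).
  rewrite Rmin_left, Rmax_right by lra. intros t Ht.
  destruct (H s t Hs Ht) as (al & be & ga & HP & _).
  exact (differentiable_pt_lim_continuous_r _ _ _ _ _ HP).
Qed.

Lemma closed_form_ex_RInt_Q P Q a b c d t :
  closed_form_on P Q a b c d -> c <= t <= d -> a <= b ->
  ex_RInt (fun s => Q s t) a b.
Proof.
  intros H Ht Hab. apply (ex_RInt_continuous (V := R_CompleteNormedModule)).
  rewrite Rmin_left, Rmax_right by lra. intros s Hs.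
  destruct (H s t Hs Ht) as (al & be & ga & _ & HQ).
  exact (differentiable_pt_lim_continuous_l _ _ _ _ _ HQ).
Qed.

Lemma RInt_minus_R (f g : R -> R) a b :
  ex_RInt f a b -> ex_RInt g a b ->
  RInt (fun x => f x - g x) a b = RInt f a b - RInt g a b.
Proof. intros; apply (RInt_minus (V := R_CompleteNormedModule)); assumption. Qed.

Lemma RInt_Chasles_R (f : R -> R) a b c :
  ex_RInt f a b -> ex_RInt f b c -> RInt f a b + RInt f b c = RInt f a c.
Proof. intros; apply (RInt_Chasles (V := R_CompleteNormedModule)); assumption. Qed.

Lemma boundary_integral_split P Q a m b c n d :
  a <= m <= b -> c <= n <= d -> closed_form_on P Q a b c d ->
  boundary_integral P Q a b c d =
    boundary_integral P Q a m c n + boundary_integral P Q m b c n +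
    boundary_integral P Q a m n d + boundary_integral P Q m b n d.
Proof.
  intros Hm Hn H. unfold boundary_integral.
  assert (HP : forall s c' d', a <= s <= b -> c <= c' <= d' -> d' <= d ->
             ex_RInt (fun t => P s t) c' d').
  { intros s c' d' ? ? ?.
    apply (closed_form_ex_RInt_P P Q a b c' d'); try lra.
    apply (closed_form_on_sub P Q a b c d); auto; lra. }
  assert (HQ : forall t a' b', c <= t <= d -> a <= a' <= b' -> b' <= b ->
             ex_RInt (fun s => Q s t) a' b').
  { intros t a' b' ? ? ?.
    apply (closed_form_ex_RInt_Q P Q a' b' c d); try lra.
    apply (closed_form_on_sub P Q a b c d); auto; lra. }
  rewrite (RInt_minus_R (P b) (P a) c d) by (apply HP; lra).
  rewrite (RInt_minus_R (P m) (P a) c n) by (apply HP; lra).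
  rewrite (RInt_minus_R (P b) (P m) c n) by (apply HP; lra).
  rewrite (RInt_minus_R (P m) (P a) n d) by (apply HP; lra).
  rewrite (RInt_minus_R (P b) (P m) n d) by (apply HP; lra).
  rewrite (RInt_minus_R (fun s => Q s d) (fun s => Q s c) a b) by (apply HQ; lra).
  rewrite (RInt_minus_R (fun s => Q s n) (fun s => Q s c) a m) by (apply HQ; lra).
  rewrite (RInt_minus_R (fun s => Q s n) (fun s => Q s c) m b) by (apply HQ; lra).
  rewrite (RInt_minus_R (fun s => Q s d) (fun s => Q s n) a m) by (apply HQ; lra).
  rewrite (RInt_minus_R (fun s => Q s d) (fun s => Q s n) m b) by (apply HQ; lra).
  rewrite <- (RInt_Chasles_R (P b) c n d) by (apply HP; lra).
  rewrite <- (RInt_Chasles_R (P a) c n d) by (apply HP; lra).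
  rewrite <- (RInt_Chasles_R (fun s => Q s d) a m b) by (apply HQ; lra).
  rewrite <- (RInt_Chasles_R (fun s => Q s c) a m b) by (apply HQ; lra).
  lra.
Qed.

(** The affine parts of [P] and [Q] contribute [al * L * H] to each of the two integrals and cancel;
    what remains of either function is at most [eps * (L + H)] on the sides. *)
Lemma boundary_integral_small P Q x y al be ga (eps : R) :
  0 < eps -> differentiable_pt_lim P x y al be -> differentiable_pt_lim Q x y ga al ->
  exists delta : posreal, forall a c L H, 0 < L < delta -> 0 < H < delta ->
    a <= x <= a + L -> c <= y <= c + H ->
    closed_form_on P Q a (a + L) c (c + H) ->
    Rabs (boundary_integral P Q a (a + L) c (c + H)) <= 2 * eps * (L + H) ^ 2.
Proof.
  intros He HP HQ.
  destruct (HP (mkposreal eps He)) as [d1 H1].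
  destruct (HQ (mkposreal eps He)) as [d2 H2]. simpl in H1, H2.
  exists (mkposreal (Rmin d1 d2) (Rmin_pos _ _ (cond_pos d1) (cond_pos d2))).
  simpl. intros a c L H HL HH Hx Hy Hcf.
  assert (Hd1 := Rmin_l d1 d2). assert (Hd2 := Rmin_r d1 d2).
  assert (E : forall s t, a <= s <= a + L -> c <= t <= c + H ->
     Rabs (P s t - P x y - (al * (s - x) + be * (t - y))) <= eps * (L + H) /\
     Rabs (Q s t - Q x y - (ga * (s - x) + al * (t - y))) <= eps * (L + H)).
  { intros s t Hs Ht.
    assert (Rabs (s - x) <= L) by (apply Rabs_le; lra).
    assert (Rabs (t - y) <= H) by (apply Rabs_le; lra).
    assert (Rmax (Rabs (s - x)) (Rabs (t - y)) <= L + H) by (apply Rmax_lub; lra).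
    split; (eapply Rle_trans; [first [apply H1 | apply H2]; lra |]);
      apply Rmult_le_compat_l; lra. }
  assert (B1 : Rabs (RInt (fun t => P (a + L) t - P a t - al * L) c (c + H)) <=
               (c + H - c) * (2 * eps * (L + H))).
  { apply abs_RInt_le_const; [lra| |].
    - apply (ex_RInt_minus (V := R_CompleteNormedModule)).
      + apply (ex_RInt_minus (V := R_CompleteNormedModule));
        apply (closed_form_ex_RInt_P P Q a (a+L) c (c+H)); auto; lra.
      + apply ex_RInt_const.
    - intros t Ht.
      destruct (E (a + L) t) as [E1 _]; try lra.
      destruct (E a t) as [E2 _]; try lra.
      apply Rabs_le_between in E1. apply Rabs_le_between in E2.
      apply Rabs_le; split; nra. }
  assert (B2 : Rabs (RInt (fun s => Q s (c + H) - Q s c - al * H) a (a + L)) <=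
               (a + L - a) * (2 * eps * (L + H))).
  { apply abs_RInt_le_const; [lra| |].
    - apply (ex_RInt_minus (V := R_CompleteNormedModule)).
      + apply (ex_RInt_minus (V := R_CompleteNormedModule));
        apply (closed_form_ex_RInt_Q P Q a (a+L) c (c+H)); auto; lra.
      + apply ex_RInt_const.
    - intros t Ht.
      destruct (E t (c + H)) as [_ E1]; try lra.
      destruct (E t c) as [_ E2]; try lra.
      apply Rabs_le_between in E1. apply Rabs_le_between in E2.
      apply Rabs_le; split; nra. }
  rewrite (RInt_minus_R (fun t => P (a + L) t - P a t) (fun _ => al * L)) in B1.
  2:{ apply (ex_RInt_minus (V := R_CompleteNormedModule));
        apply (closed_form_ex_RInt_P P Q a (a+L) c (c+H)); auto; lra. }
  2: apply ex_RInt_const.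
  rewrite (RInt_minus_R (fun s => Q s (c + H) - Q s c) (fun _ => al * H)) in B2.
  2:{ apply (ex_RInt_minus (V := R_CompleteNormedModule));
        apply (closed_form_ex_RInt_Q P Q a (a+L) c (c+H)); auto; lra. }
  2: apply ex_RInt_const.
  rewrite RInt_const in B1, B2. unfold scal in B1, B2; simpl in B1, B2.
  unfold mult in B1, B2; simpl in B1, B2.
  unfold boundary_integral.
  apply Rabs_le_between in B1. apply Rabs_le_between in B2.
  apply Rabs_le. split; nra.
Qed.

(** Bisection preserves the lower bound [K] for the boundary integral per unit area. The last
    quarter is returned untested: if the other three fail, additivity forces the bound on it. *)
Definition bad_quarter (P Q : R -> R -> R) (K L H : R) (p : R * R) : R * R :=
  let (a, c) := p in
  let test a c := Rle_dec (K * (L / 2) * (H / 2))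
    (Rabs (boundary_integral P Q a (a + L / 2) c (c + H / 2))) in
  if test a c then (a, c)
  else if test (a + L / 2) c then (a + L / 2, c)
  else if test a (c + H / 2) then (a, c + H / 2)
  else (a + L / 2, c + H / 2).

Fixpoint bad_seq (P Q : R -> R -> R) (K L H : R) (p : R * R) (n : nat) : R * R :=
  match n with
  | O => p
  | S n => bad_quarter P Q K (L / 2 ^ n) (H / 2 ^ n) (bad_seq P Q K L H p n)
  end.

Lemma bad_quarter_spec P Q K L H p :
  0 < L -> 0 < H -> closed_form_on P Q (fst p) (fst p + L) (snd p) (snd p + H) ->
  K * L * H <=
    Rabs (boundary_integral P Q (fst p) (fst p + L) (snd p) (snd p + H)) ->
  let p' := bad_quarter P Q K L H p in
  (fst p <= fst p' /\ fst p' + L / 2 <= fst p + L) /\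
  (snd p <= snd p' /\ snd p' + H / 2 <= snd p + H) /\
  K * (L / 2) * (H / 2) <=
    Rabs (boundary_integral P Q (fst p') (fst p' + L / 2) (snd p') (snd p' + H / 2)).
Proof.
  destruct p as [a c]. simpl fst; simpl snd.
  intros HL HH Hcf HK. unfold bad_quarter.
  assert (Hs := boundary_integral_split P Q a (a + L / 2) (a + L) c (c + H / 2) (c + H)
      ltac:(lra) ltac:(lra) Hcf).
  destruct Rle_dec as [h|n1]; [simpl; repeat split; lra|].
  destruct Rle_dec as [h|n2]; [simpl; repeat split; lra|].
  destruct Rle_dec as [h|n3]; [simpl; repeat split; lra|].
  simpl; repeat split; try lra.
  apply Rnot_le_lt in n1. apply Rnot_le_lt in n2. apply Rnot_le_lt in n3.
  replace (a + L) with (a + L / 2 + L / 2) in * by field.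
  replace (c + H) with (c + H / 2 + H / 2) in * by field.
  rewrite Hs in HK.
  set (g1 := boundary_integral P Q a (a + L / 2) c (c + H / 2)) in *.
  set (g2 := boundary_integral P Q (a + L / 2) _ c (c + H / 2)) in *.
  set (g3 := boundary_integral P Q a (a + L / 2) (c + H / 2) _) in *.
  set (g4 := boundary_integral P Q (a + L / 2) _ (c + H / 2) _) in *.
  assert (T1 := Rabs_triang (g1 + g2 + g3) g4).
  assert (T2 := Rabs_triang (g1 + g2) g3).
  assert (T3 := Rabs_triang g1 g2).
  clear - HK T1 T2 T3 n1 n2 n3. lra.
Qed.

Lemma nested_sup (u : nat -> R) (L : R) :
  0 <= L ->
  (forall n, u n <= u (S n)) -> (forall n, u (S n) + L / 2 ^ S n <= u n + L / 2 ^ n) ->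
  exists x, forall n, u n <= x <= u n + L / 2 ^ n.
Proof.
  intros HL Hi Hd.
  assert (Hp : forall n, 0 <= L / 2 ^ n).
  { intros n. apply Rmult_le_pos; [lra|]. apply Rlt_le, Rinv_0_lt_compat, pow_lt; lra. }
  assert (Hmono : forall n m, u n <= u (n + m)%nat).
  { intros n m; induction m; [rewrite Nat.add_0_r; lra|].
    rewrite Nat.add_succ_r. specialize (Hi (n + m)%nat). lra. }
  assert (Hdec : forall n m, u (n + m)%nat + L / 2 ^ (n + m) <= u n + L / 2 ^ n).
  { intros n m; induction m; [rewrite Nat.add_0_r; lra|].
    rewrite Nat.add_succ_r. specialize (Hd (n + m)%nat). lra. }
  assert (Hc : forall n m, u m <= u n + L / 2 ^ n).
  { intros n m. destruct (Nat.le_ge_cases n m) as [h|h].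
    - replace m with (n + (m - n))%nat by lia.
      specialize (Hdec n (m - n)%nat). specialize (Hp (n + (m - n))%nat). lra.
    - replace n with (m + (n - m))%nat by lia.
      specialize (Hmono m (n - m)%nat). specialize (Hp (m + (n - m))%nat). lra. }
  destruct (completeness (fun y => exists n, y = u n)) as [x [Hx1 Hx2]].
  - exists (u O + L / 2 ^ 0). intros y [n ->]. apply Hc.
  - exists (u O), O; reflexivity.
  - exists x. intros n. split.
    + apply Hx1; exists n; reflexivity.
    + apply Hx2. intros y [m ->]. apply Hc.
Qed.

Lemma div_pow2_lt (L e : R) : 0 < e -> exists N, L / 2 ^ N < e.
Proof.
  intros He.
  destruct (Rle_lt_dec L 0) as [HL|HL].
  { exists O. simpl. lra. }
  destruct (pow_lt_1_zero (/2)) with (y := e / L) as [N HN].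
  - rewrite Rabs_pos_eq; lra.
  - apply Rdiv_lt_0_compat; lra.
  - exists N. specialize (HN N (le_n _)).
    rewrite Rabs_pos_eq in HN by (apply pow_le; lra).
    rewrite pow_inv in HN.
    apply (Rmult_lt_compat_l L) in HN; [|lra].
    replace (L * (e / L)) with e in HN by (field; lra). exact HN.
Qed.

(* Goursat's bisection argument; no continuity of the partial derivatives is assumed. *)
Lemma boundary_integral_closed_form P Q a b c d :
  a < b -> c < d -> closed_form_on P Q a b c d -> boundary_integral P Q a b c d = 0.
Proof.
  intros Hab Hcd Hcf.
  destruct (Req_dec (boundary_integral P Q a b c d) 0) as [|Hne]; [assumption|exfalso].
  set (L := b - a). set (H := d - c).
  set (K := Rabs (boundary_integral P Q a b c d) / (L * H)).
  assert (HL : 0 < L) by (unfold L; lra). assert (HH : 0 < H) by (unfold H; lra).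
  assert (HK : 0 < K).
  { apply Rdiv_lt_0_compat; [apply Rabs_pos_lt; assumption | nra]. }
  set (p := bad_seq P Q K L H (a, c)).
  assert (Hpos : forall n, 0 < L / 2 ^ n /\ 0 < H / 2 ^ n).
  { intros n. assert (0 < 2 ^ n) by (apply pow_lt; lra).
    split; apply Rdiv_lt_0_compat; lra. }
  assert (Hhalf : forall x n, x / 2 ^ S n = x / 2 ^ n / 2).
  { intros x n. simpl. field. apply pow_nonzero; lra. }
  assert (Hinv : forall n,
     a <= fst (p n) /\ fst (p n) + L / 2 ^ n <= b /\
     c <= snd (p n) /\ snd (p n) + H / 2 ^ n <= d /\
     K * (L / 2 ^ n) * (H / 2 ^ n) <= Rabs (boundary_integral P Q (fst (p n))
        (fst (p n) + L / 2 ^ n) (snd (p n)) (snd (p n) + H / 2 ^ n)) /\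
     (fst (p n) <= fst (p (S n)) /\
     fst (p (S n)) + L / 2 ^ S n <= fst (p n) + L / 2 ^ n) /\
     (snd (p n) <= snd (p (S n)) /\
     snd (p (S n)) + H / 2 ^ S n <= snd (p n) + H / 2 ^ n)).
  { assert (Hgen : forall n, 
       a <= fst (p n) -> fst (p n) + L / 2 ^ n <= b ->
       c <= snd (p n) -> snd (p n) + H / 2 ^ n <= d ->
       K * (L / 2 ^ n) * (H / 2 ^ n) <= Rabs (boundary_integral P Q (fst (p n))
        (fst (p n) + L / 2 ^ n) (snd (p n)) (snd (p n) + H / 2 ^ n)) ->
       (fst (p n) <= fst (p (S n)) /\
       fst (p (S n)) + L / 2 ^ S n <= fst (p n) + L / 2 ^ n) /\
       (snd (p n) <= snd (p (S n)) /\
       snd (p (S n)) + H / 2 ^ S n <= snd (p n) + H / 2 ^ n) /\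
       K * (L / 2 ^ S n) * (H / 2 ^ S n) <= Rabs (boundary_integral P Q (fst (p (S n)))
        (fst (p (S n)) + L / 2 ^ S n) (snd (p (S n))) (snd (p (S n)) + H / 2 ^ S n))).
    { intros n h1 h2 h3 h4 h5. specialize (Hpos n).
      change (p (S n)) with (bad_quarter P Q K (L / 2 ^ n) (H / 2 ^ n) (p n)).
      assert (Hq := bad_quarter_spec P Q K (L / 2 ^ n) (H / 2 ^ n) (p n)
        (proj1 Hpos) (proj2 Hpos)
        (closed_form_on_sub P Q a b c d _ _ _ _ h1 h2 h3 h4 Hcf) h5).
      rewrite !Hhalf. exact Hq. }
    induction n.
    - assert (h5 : K * (L / 2 ^ 0) * (H / 2 ^ 0) <= Rabs (boundary_integral P Q (fst (p O))
        (fst (p O) + L / 2 ^ 0) (snd (p O)) (snd (p O) + H / 2 ^ 0))).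
      { simpl. replace (a + L / 1) with b by (unfold L; field).
        replace (c + H / 1) with d by (unfold H; field).
        apply Req_le. unfold K. field. lra. }
      assert (h2 : fst (p O) + L / 2 ^ 0 <= b) by (simpl; unfold L; lra).
      assert (h4 : snd (p O) + H / 2 ^ 0 <= d) by (simpl; unfold H; lra).
      assert (h1 : a <= fst (p O)) by (simpl; lra).
      assert (h3 : c <= snd (p O)) by (simpl; lra).
      destruct (Hgen O h1 h2 h3 h4 h5) as (e1 & e2 & _).
      exact (conj h1 (conj h2 (conj h3 (conj h4 (conj h5 (conj e1 e2)))))).
    - destruct IHn as (h1 & h2 & h3 & h4 & h5 & h6 & h7).
      destruct (Hgen n h1 h2 h3 h4 h5) as (_ & _ & h8).
      assert (g1 : a <= fst (p (S n))) by lra.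
      assert (g2 : fst (p (S n)) + L / 2 ^ S n <= b) by lra.
      assert (g3 : c <= snd (p (S n))) by lra.
      assert (g4 : snd (p (S n)) + H / 2 ^ S n <= d) by lra.
      destruct (Hgen (S n) g1 g2 g3 g4 h8) as (e1 & e2 & _).
      exact (conj g1 (conj g2 (conj g3 (conj g4 (conj h8 (conj e1 e2)))))). }
  destruct (nested_sup (fun n => fst (p n)) L) as [x Hx].
  { lra. } { intros n; apply Hinv. } { intros n; apply Hinv. }
  destruct (nested_sup (fun n => snd (p n)) H) as [y Hy].
  { lra. } { intros n; apply Hinv. } { intros n; apply Hinv. }
  destruct (Hcf x y) as (al & be & ga & HP & HQ).
  { destruct (Hinv O) as (? & ? & _). specialize (Hx O); simpl in *. lra. }
  { destruct (Hinv O) as (_ & _ & ? & ? & _). specialize (Hy O); simpl in *. lra. }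
  (* With this value the upper bound [2 * eps * (L + H)^2], scaled to the [n]-th rectangle, is half
     of the lower bound [K * L * H] scaled likewise. *)
  set (eps := K * L * H / (4 * (L + H) ^ 2)).
  assert (HLH : 0 < (L + H) ^ 2) by (apply pow_lt; lra).
  assert (He : 0 < eps).
  { apply Rdiv_lt_0_compat; [|lra].
    apply Rmult_lt_0_compat; [apply Rmult_lt_0_compat|]; assumption. }
  destruct (boundary_integral_small P Q x y al be ga eps He HP HQ) as [delta Hdelta].
  destruct (div_pow2_lt (L + H) delta (cond_pos delta)) as [n Hn].
  destruct (Hinv n) as (h1 & h2 & h3 & h4 & h5 & _).
  destruct (Hpos n) as [p1 p2].
  replace ((L + H) / 2 ^ n) with (L / 2 ^ n + H / 2 ^ n) in Hn by (field; apply pow_nonzero; lra).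
  specialize (Hdelta (fst (p n)) (snd (p n)) (L / 2 ^ n) (H / 2 ^ n)
     ltac:(lra) ltac:(lra) (Hx n) (Hy n)
     (closed_form_on_sub P Q a b c d _ _ _ _ h1 h2 h3 h4 Hcf)).
  assert (E : K * (L / 2 ^ n) * (H / 2 ^ n) <= 2 * eps * (L / 2 ^ n + H / 2 ^ n) ^ 2) by lra.
  assert (0 < 2 ^ n) by (apply pow_lt; lra).
  replace (2 * eps * (L / 2 ^ n + H / 2 ^ n) ^ 2) with
    (/ 2 * (K * (L / 2 ^ n) * (H / 2 ^ n))) in E by (unfold eps; field; lra).
  assert (0 < K * (L / 2 ^ n) * (H / 2 ^ n)) 
    by (apply Rmult_lt_0_compat; [apply Rmult_lt_0_compat|]; assumption).
  lra.
Qed.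

(** * Mean value property of analytic functions *)

Lemma is_derive_C_eps (f : C -> C) (z l : C) :
  is_derive (K := C_AbsRing) (V := C_NormedModule) f z l ->
  forall eps, 0 < eps -> exists delta, 0 < delta /\
    forall w, Cmod (w - z)%C < delta ->
      Cmod (f w - f z - (w - z) * l)%C <= eps * Cmod (w - z)%C.
Proof.
  intros [_ H] eps He.
  specialize (H z (fun P h => h) (mkposreal eps He)).
  destruct H as [d Hd]. exists d. split; [apply d|].
  intros w Hw. exact (Hd w Hw).
Qed.

Lemma ex_derive_C_continuous (f : C -> C) (z : C) :
  ex_derive (K := C_AbsRing) (V := C_NormedModule) f z ->
  forall eps, 0 < eps -> exists delta, 0 < delta /\
    forall w, Cmod (w - z)%C < delta -> Cmod (f w - f z)%C < eps.
Proof.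
  intros [l H] eps He.
  destruct (is_derive_C_eps f z l H 1 Rlt_0_1) as (d & Hd & Hw).
  assert (Hl := Cmod_ge_0 l).
  exists (Rmin d (eps / (2 + Cmod l))). split.
  { apply Rmin_pos; [lra|]. apply Rdiv_lt_0_compat; lra. }
  intros w Hlt. specialize (Hw w (Rlt_le_trans _ _ _ Hlt (Rmin_l _ _))).
  assert (Hlt' := Rlt_le_trans _ _ _ Hlt (Rmin_r _ _)).
  replace (f w - f z)%C with ((f w - f z - (w - z) * l) + (w - z) * l)%C by ring.
  eapply Rle_lt_trans; [apply Cmod_triangle|]. rewrite Cmod_mult.
  assert (Hpos := Cmod_ge_0 (w - z)%C).
  apply (Rmult_lt_compat_r (2 + Cmod l)) in Hlt'; [|lra].
  replace (eps / (2 + Cmod l) * (2 + Cmod l)) with eps in Hlt' by (field; lra).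
  nra.
Qed.

Lemma Cmod_le_2Rmax (z : C) : Cmod z <= 2 * Rmax (Rabs (fst z)) (Rabs (snd z)).
Proof.
  eapply Rle_trans; [apply Cmod_2Rmax|].
  apply Rmult_le_compat_r.
  - eapply Rle_trans; [apply Rabs_pos | apply Rmax_l].
  - assert (h := sqrt_sqrt 2 ltac:(lra)). assert (h' := sqrt_pos 2). nra.
Qed.

Lemma Rabs_fst_le_Cmod (z : C) : Rabs (fst z) <= Cmod z.
Proof. eapply Rle_trans; [apply Rmax_l | apply Rmax_Cmod]. Qed.

Lemma Rabs_snd_le_Cmod (z : C) : Rabs (snd z) <= Cmod z.
Proof. eapply Rle_trans; [apply Rmax_r | apply Rmax_Cmod]. Qed.

Lemma cauchy_riemann (f : C -> C) (x y : R) (l : C) :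
  is_derive (K := C_AbsRing) (V := C_NormedModule) f (x, y) l ->
  differentiable_pt_lim (fun u v => fst (f (u, v))) x y (fst l) (- snd l) /\
  differentiable_pt_lim (fun u v => snd (f (u, v))) x y (snd l) (fst l).
Proof.
  intros H.
  assert (G : forall eps : posreal, locally_2d (fun u v =>
     Cmod (f (u, v) - f (x, y) - ((u, v) - (x, y)) * l)%C <=
       eps * Rmax (Rabs (u - x)) (Rabs (v - y))) x y).
  { intros eps.
    destruct (is_derive_C_eps f (x, y) l H (eps / 2) (is_pos_div_2 eps)) as (d & Hd & Hw).
    exists (mkposreal (d / 2) (is_pos_div_2 (mkposreal d Hd))). simpl.
    intros u v Hu Hv.
    assert (B := Cmod_le_2Rmax ((u, v) - (x, y))%C). simpl in B.
    change (u + - x) with (u - x) in B. change (v + - y) with (v - y) in B.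
    eapply Rle_trans; [apply Hw|].
    - eapply Rle_lt_trans; [exact B|].
      assert (Rmax (Rabs (u - x)) (Rabs (v - y)) < d / 2) by (apply Rmax_lub_lt; lra). lra.
    - assert (He := cond_pos eps). nra. }
  split; intros eps; destruct (G eps) as [d Hd]; exists d; intros u v Hu Hv;
    (eapply Rle_trans; [|apply (Hd u v Hu Hv)]).
  - eapply Rle_trans; [|apply Rabs_fst_le_Cmod]. apply Req_le; f_equal; simpl; ring.
  - eapply Rle_trans; [|apply Rabs_snd_le_Cmod]. apply Req_le; f_equal; simpl; ring.
Qed.

Lemma differentiable_pt_lim_proj2_0 (h : R -> R) (x y l : R) :
  derivable_pt_lim h y l -> differentiable_pt_lim (fun _ v => h v) x y 0 l.
Proof.
  intros H eps. destruct (H eps (cond_pos eps)) as [d Hd]. exists d.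
  intros u v _ Hv.
  destruct (Req_dec v y) as [->|Hne].
  - replace (_ - _ - _) with 0 by ring. rewrite Rabs_R0.
    apply Rmult_le_pos; [apply Rlt_le, cond_pos|].
    eapply Rle_trans; [apply Rabs_pos | apply Rmax_l].
  - specialize (Hd (v - y) ltac:(lra) Hv).
    replace (y + (v - y)) with v in Hd by ring.
    eapply Rle_trans; [|apply Rmult_le_compat_l; [apply Rlt_le, cond_pos | apply Rmax_r]].
    replace (h v - h y - (0 * (u - x) + l * (v - y)))
      with (((h v - h y) / (v - y) - l) * (v - y)) by (field; lra).
    rewrite Rabs_mult. apply Rmult_le_compat_r; [apply Rabs_pos | lra].
Qed.

Lemma differentiable_pt_lim_affine_mult (a x y : R) :
  differentiable_pt_lim (fun u v => a + u * v) x y y x.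
Proof.
  intros eps. exists eps. intros u v Hu Hv.
  replace (a + u * v - (a + x * y) - (y * (u - x) + x * (v - y)))
    with ((u - x) * (v - y)) by ring.
  rewrite Rabs_mult. apply Rmult_le_compat; try apply Rabs_pos; [lra | apply Rmax_r].
Qed.

Lemma differentiable_pt_lim_log_polar (h : R -> R) (a s t l : R) :
  derivable_pt_lim h t l ->
  differentiable_pt_lim (fun s t => a + exp s * h t) s t (exp s * h t) (exp s * l).
Proof.
  intros H.
  replace (exp s * h t) with (h t * exp s + exp s * 0) by ring.
  replace (exp s * l) with (h t * 0 + exp s * l) at 1 by ring.
  apply (differentiable_pt_lim_comp (fun u v => a + u * v) (fun u _ => exp u) (fun _ v => h v)).
  - apply differentiable_pt_lim_affine_mult.
  - apply differentiable_pt_lim_proj1_0, derivable_pt_lim_exp.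
  - apply differentiable_pt_lim_proj2_0, H.
Qed.

Lemma expi_scal (z : C) (r t : R) :
  (z + RtoC r * expi t)%C = (fst z + r * cos t, snd z + r * sin t).
Proof. unfold Cplus, Cmult, RtoC, expi; simpl. f_equal; ring. Qed.

Lemma Cmod_expi t : Cmod (expi t) = 1.
Proof.
  unfold Cmod, expi; simpl.
  replace (cos t * (cos t * 1) + sin t * (sin t * 1)) with 1; [apply sqrt_1|].
  assert (H := sin2_cos2 t). unfold Rsqr in H. lra.
Qed.

Lemma Cmod_scal_expi (r t : R) : Cmod (RtoC r * expi t)%C = Rabs r.
Proof. now rewrite Cmod_mult, Cmod_R, Cmod_expi, Rmult_1_r. Qed.

(** [f (z + exp (s + it))] is again analytic in [s + it], and closedness for its real and imaginary
    parts is one of the Cauchy-Riemann equations. *)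
Lemma closed_form_log_polar (f : C -> C) (z : C) (a b : R) :
  (forall w, Cmod (w - z)%C <= exp b ->
     ex_derive (K := C_AbsRing) (V := C_NormedModule) f w) ->
  closed_form_on (fun s t => fst (f (z + RtoC (exp s) * expi t)%C))
                 (fun s t => snd (f (z + RtoC (exp s) * expi t)%C)) a b 0 (2 * PI).
Proof.
  intros Hf s t Hs Ht.
  destruct (Hf (z + RtoC (exp s) * expi t)%C) as [l Hl].
  { replace (z + RtoC (exp s) * expi t - z)%C with (RtoC (exp s) * expi t)%C by ring.
    rewrite Cmod_scal_expi, Rabs_pos_eq by apply Rlt_le, exp_pos.
    destruct (Req_dec s b) as [->|]; [lra|]. apply Rlt_le, exp_increasing; lra. }
  rewrite expi_scal in Hl. apply cauchy_riemann in Hl. destruct Hl as [H1 H2].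
  assert (Hx := differentiable_pt_lim_log_polar cos (fst z) s t _ (derivable_pt_lim_cos t)).
  assert (Hy := differentiable_pt_lim_log_polar sin (snd z) s t _ (derivable_pt_lim_sin t)).
  assert (D1 := differentiable_pt_lim_comp _ _ _ _ _ _ _ _ _ _ _ H1 Hx Hy).
  assert (D2 := differentiable_pt_lim_comp _ _ _ _ _ _ _ _ _ _ _ H2 Hx Hy).
  cbv beta in D1, D2.
  replace (snd l * (exp s * - sin t) + fst l * (exp s * cos t))
    with (fst l * (exp s * cos t) + - snd l * (exp s * sin t)) in D2 by ring.
  eexists; eexists; eexists. split.
  - intros eps. specialize (D1 eps). destruct D1 as [d Hd]. exists d.
    intros u v Hu Hv. rewrite !expi_scal. apply Hd; assumption.
  - intros eps. specialize (D2 eps). destruct D2 as [d Hd]. exists d.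
    intros u v Hu Hv. rewrite !expi_scal. apply Hd; assumption.
Qed.

Lemma expi_2PI : expi (2 * PI) = expi 0.
Proof. unfold expi. now rewrite cos_2PI, sin_2PI, cos_0, sin_0. Qed.

(* Goursat's theorem in the coordinates [w = z + exp (s + i t)]: the integrals over the sides
   [t = 0] and [t = 2 PI] cancel by periodicity, and [s] may tend to minus infinity. *)
Lemma mean_value_Re (f : C -> C) (z : C) (rho : R) :
  0 < rho ->
  (forall w, Cmod (w - z)%C <= rho ->
     ex_derive (K := C_AbsRing) (V := C_NormedModule) f w) ->
  ex_RInt (fun t => fst (f (z + RtoC rho * expi t)%C)) 0 (2 * PI) /\
  RInt (fun t => fst (f (z + RtoC rho * expi t)%C)) 0 (2 * PI) = 2 * PI * fst (f z).
Proof.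
  intros Hrho Hf. assert (Hpi := PI_RGT_0).
  replace rho with (exp (ln rho)) in Hf by (apply exp_ln; lra).
  assert (Hex : forall s, s <= ln rho ->
     ex_RInt (fun t => fst (f (z + RtoC (exp s) * expi t)%C)) 0 (2 * PI)).
  { intros s Hs.
    apply (closed_form_ex_RInt_P _ (fun s t => snd (f (z + RtoC (exp s) * expi t)%C))
       s (ln rho) 0 (2 * PI) s (closed_form_log_polar f z s (ln rho) Hf)); lra. }
  assert (Hconst : forall s, s < ln rho ->
     RInt (fun t => fst (f (z + RtoC (exp (ln rho)) * expi t)%C)) 0 (2 * PI) =
     RInt (fun t => fst (f (z + RtoC (exp s) * expi t)%C)) 0 (2 * PI)).
  { intros s Hs.
    assert (B := boundary_integral_closed_form _ _ s (ln rho) 0 (2 * PI) Hs ltac:(lra)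
        (closed_form_log_polar f z s (ln rho) Hf)).
    unfold boundary_integral in B.
    rewrite (RInt_minus_R (fun t => fst (f (z + RtoC (exp (ln rho)) * expi t)%C))
       (fun t => fst (f (z + RtoC (exp s) * expi t)%C))) in B by (apply Hex; lra).
    rewrite (RInt_ext _ (fun _ => 0) s (ln rho)) in B
      by (intros; rewrite expi_2PI; apply Rminus_diag_eq; reflexivity).
    rewrite RInt_const in B. unfold scal in B; simpl in B; unfold mult in B; simpl in B.
    lra. }
  rewrite <- (exp_ln rho) by lra.
  split; [apply Hex; lra|].
  apply cond_eq. intros eps He.
  destruct (ex_derive_C_continuous f z) with (eps := eps / (4 * PI)) as (d & Hd & Hw).
  { apply Hf. replace (z - z)%C with (RtoC 0) by ring.
    rewrite Cmod_0. apply Rlt_le, exp_pos. }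
  { apply Rdiv_lt_0_compat; lra. }
  set (s := Rmin (ln rho) (ln d) - 1).
  assert (Hs1 : s < ln rho) by (unfold s; assert (h := Rmin_l (ln rho) (ln d)); lra).
  assert (Hs2 : exp s < d).
  { rewrite <- (exp_ln d) by lra. apply exp_increasing.
    unfold s; assert (h := Rmin_r (ln rho) (ln d)); lra. }
  rewrite (Hconst s Hs1).
  replace (2 * PI * fst (f z)) with (RInt (fun _ => fst (f z)) 0 (2 * PI))
    by (rewrite RInt_const; unfold scal; simpl; unfold mult; simpl; ring).
  rewrite <- (RInt_minus_R (fun t => fst (f (z + RtoC (exp s) * expi t)%C)) (fun _ => fst (f z)));
    [| apply Hex; lra | apply ex_RInt_const].
  eapply Rle_lt_trans.
  - apply abs_RInt_le_const with (M := eps / (4 * PI)); [lra | |].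
    + apply (ex_RInt_minus (V := R_CompleteNormedModule)); [apply Hex; lra | apply ex_RInt_const].
    + intros t _. apply Rlt_le.
      apply Rle_lt_trans with (Cmod (f (z + RtoC (exp s) * expi t) - f z)%C).
      * apply (Rabs_fst_le_Cmod (f (z + RtoC (exp s) * expi t) - f z)%C).
      * apply Hw.
        replace (z + RtoC (exp s) * expi t - z)%C with (RtoC (exp s) * expi t)%C by ring.
        rewrite Cmod_scal_expi, Rabs_pos_eq by apply Rlt_le, exp_pos. exact Hs2.
  - replace ((2 * PI - 0) * (eps / (4 * PI))) with (eps / 2) by (field; lra). lra.
Qed.

(** * Real powers *)

Lemma rpow_Rpower x q : 0 < x -> rpow x q = Rpower x q.
Proof. intros H; unfold rpow; destruct Rlt_dec; [reflexivity | lra]. Qed.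

Lemma rpow_nonpos x q : x <= 0 -> rpow x q = 0.
Proof. intros H; unfold rpow; destruct Rlt_dec; [lra | reflexivity]. Qed.

Lemma rpow_pos x q : 0 < x -> 0 < rpow x q.
Proof. intros H; rewrite rpow_Rpower by assumption; apply exp_pos. Qed.

Lemma rpow_ge_0 x q : 0 <= rpow x q.
Proof. unfold rpow; destruct Rlt_dec; [apply Rlt_le, exp_pos | lra]. Qed.

Lemma rpow_lt x y q : 0 < q -> 0 <= x < y -> rpow x q < rpow y q.
Proof.
  intros Hq [[Hx|<-] Hxy].
  - rewrite !rpow_Rpower by lra. apply Rlt_Rpower_l; lra.
  - rewrite (rpow_nonpos 0) by lra. apply rpow_pos; lra.
Qed.

Lemma rpow_le x y q : 0 < q -> x <= y -> rpow x q <= rpow y q.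
Proof.
  intros Hq [Hxy|<-]; [|lra].
  destruct (Rle_lt_dec x 0) as [Hx|Hx].
  - rewrite (rpow_nonpos x) by lra. apply rpow_ge_0.
  - apply Rlt_le, rpow_lt; lra.
Qed.

Lemma rpow_mult x y q : 0 <= x -> 0 <= y -> rpow (x * y) q = rpow x q * rpow y q.
Proof.
  intros [Hx|<-] [Hy|<-];
    rewrite ?Rmult_0_l, ?Rmult_0_r, ?(rpow_nonpos 0), ?Rmult_0_l, ?Rmult_0_r by lra;
    try reflexivity.
  rewrite !rpow_Rpower by nra. symmetry; apply Rpower_mult_distr; assumption.
Qed.

Lemma rpow_rpow x p q : rpow (rpow x p) q = rpow x (p * q).
Proof.
  destruct (Rlt_le_dec 0 x) as [H|H].
  - rewrite (rpow_Rpower x), (rpow_Rpower x) by assumption.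
    rewrite rpow_Rpower by apply exp_pos. apply Rpower_mult.
  - rewrite (rpow_nonpos x), (rpow_nonpos x), rpow_nonpos; lra.
Qed.

Lemma rpow_1 x : 0 <= x -> rpow x 1 = x.
Proof.
  intros [H|<-]; [rewrite rpow_Rpower by lra; apply Rpower_1; lra | apply rpow_nonpos; lra].
Qed.

Lemma rpow_one q : rpow 1 q = 1.
Proof. rewrite rpow_Rpower by lra. unfold Rpower. now rewrite ln_1, Rmult_0_r, exp_0. Qed.

Lemma rpow_plus x p q : rpow x (p + q) = rpow x p * rpow x q.
Proof.
  destruct (Rlt_le_dec 0 x) as [H|H].
  - rewrite !rpow_Rpower by assumption. apply Rpower_plus.
  - rewrite !(rpow_nonpos x); lra.
Qed.

Lemma rpow_INR x n : 0 <= x -> (0 < n)%nat -> rpow x (INR n) = x ^ n.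
Proof.
  intros [H|<-] Hn.
  - rewrite rpow_Rpower by assumption. apply Rpower_pow; assumption.
  - rewrite rpow_nonpos by lra. rewrite pow_i; [reflexivity | lia].
Qed.

Lemma rpow_eq_0 x q : 0 <= x -> rpow x q = 0 -> x = 0.
Proof. intros [H|<-] E; [|reflexivity]. assert (h := rpow_pos x q H). lra. Qed.

Lemma continuity_pt_rpow q x : 0 < q -> continuity_pt (fun x => rpow x q) x.
Proof.
  intros Hq.
  destruct (Rtotal_order x 0) as [Hx|[->|Hx]].
  - intros e He. exists (- x); split; [lra|]. intros y [_ Hy].
    unfold dist in *; simpl in *; unfold Rdist in *.
    apply Rabs_def2 in Hy. rewrite !rpow_nonpos, Rminus_diag, Rabs_R0 by lra. exact He.
  - intros e He. exists (rpow e (/ q)). split; [apply rpow_pos; lra|].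
    intros y [_ Hy]. unfold dist in *; simpl in *; unfold Rdist in *.
    rewrite Rminus_0_r in Hy. rewrite (rpow_nonpos 0), Rminus_0_r by lra.
    rewrite Rabs_pos_eq by apply rpow_ge_0.
    apply Rle_lt_trans with (rpow (Rabs y) q).
    + apply rpow_le; [assumption | apply Rle_abs].
    + replace e with (rpow (rpow e (/ q)) q) at 1.
      * apply rpow_lt; [assumption|]. split; [apply Rabs_pos | exact Hy].
      * rewrite rpow_rpow. replace (/ q * q) with 1 by (field; lra). apply rpow_1; lra.
  - apply (continuity_pt_ext_loc (fun y => Rpower y q)).
    + exists (mkposreal x Hx). intros y Hy. apply Rabs_def2 in Hy. simpl in Hy.
      unfold minus, plus, opp in Hy; simpl in Hy. symmetry; apply rpow_Rpower; lra.
    + apply derivable_continuous_pt. eexists. apply derivable_pt_lim_power; assumption.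
Qed.

Lemma is_derive_Rpower_line (x d q t : R) :
  0 < x + t * d ->
  is_derive (fun t => Rpower (x + t * d) q) t (q * d * Rpower (x + t * d) (q - 1)).
Proof.
  intros H. apply is_derive_Reals.
  replace (q * d * Rpower (x + t * d) (q - 1))
    with (q * Rpower (x + t * d) (q - 1) * d) by ring.
  apply (derivable_pt_lim_comp (fun t => x + t * d) (fun y => Rpower y q)).
  - apply is_derive_Reals. auto_derive; [exact I | ring].
  - apply derivable_pt_lim_power; assumption.
Qed.

(** Taylor's formula is applied on [[0,1]] to [t -> (x + t (y - x))^q], so that one application
    serves every order of [x] and [y]. *)
Lemma Rpower_taylor_2 (q x y : R) :
  0 < x -> 0 < y ->
  exists xi, Rmin x y <= xi <= Rmax x y /\
    Rpower y q = Rpower x q + q * Rpower x (q - 1) * (y - x) +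
      q * (q - 1) / 2 * Rpower xi (q - 2) * (y - x) ^ 2.
Proof.
  intros Hx Hy.
  assert (Hpos : forall t, 0 <= t <= 1 -> 0 < x + t * (y - x)) by (intros; nra).
  assert (Hloc : forall t, 0 <= t <= 1 -> locally t (fun s => 0 < x + s * (y - x))).
  { intros t Ht.
    assert (C : continuous (fun s => x + s * (y - x)) t).
    { apply (ex_derive_continuous (V := R_NormedModule)). auto_derive; exact I. }
    apply C. apply (open_gt 0). apply Hpos; assumption. }
  assert (D1 : forall t, 0 <= t <= 1 ->
    locally t (fun s => Derive (fun t => Rpower (x + t * (y - x)) q) s =
                        q * (y - x) * Rpower (x + s * (y - x)) (q - 1))).
  { intros t Ht. generalize (Hloc t Ht). apply filter_imp. intros s Hs.
    apply is_derive_unique, is_derive_Rpower_line, Hs. }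
  assert (D2 : forall t, 0 <= t <= 1 ->
    is_derive (Derive (fun t => Rpower (x + t * (y - x)) q)) t
     (q * (y - x) * ((q - 1) * (y - x) * Rpower (x + t * (y - x)) (q - 1 - 1)))).
  { intros t Ht.
    apply (is_derive_ext_loc (fun s => q * (y - x) * Rpower (x + s * (y - x)) (q - 1))).
    - generalize (D1 t Ht). apply filter_imp. intros s Hs; symmetry; exact Hs.
    - apply is_derive_scal, is_derive_Rpower_line, Hpos, Ht. }
  destruct (Taylor_Lagrange (fun t => Rpower (x + t * (y - x)) q) 1 0 1) as (z & Hz & E).
  - lra.
  - intros t Ht k Hk. destruct k as [|[|[|k]]]; [exact I | | | lia].
    + eexists. apply is_derive_Rpower_line, Hpos, Ht.
    + eexists. simpl. apply D2, Ht.
  - exists (x + z * (y - x)). split.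
    + unfold Rmin, Rmax; destruct Rle_dec; nra.
    + assert (E1 : Derive_n (fun t => Rpower (x + t * (y - x)) q) 1 0 =
        q * (y - x) * Rpower (x + 0 * (y - x)) (q - 1)).
      { apply is_derive_unique, is_derive_Rpower_line; lra. }
      assert (E2 : Derive_n (fun t => Rpower (x + t * (y - x)) q) 2 z =
        q * (y - x) * ((q - 1) * (y - x) * Rpower (x + z * (y - x)) (q - 1 - 1))).
      { apply is_derive_unique, D2; lra. }
      unfold sum_f_R0 in E. rewrite E1, E2 in E. unfold Derive_n in E. simpl in E.
      replace (x + 1 * (y - x)) with y in E by ring.
      replace (x + 0 * (y - x)) with x in E by ring.
      replace (q - 1 - 1) with (q - 2) in E by ring.
      rewrite E. field.
Qed.

(* [x] and [x^2 - y^2] are the real parts of [g] and [g^2] for [g = x + iy], so for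
   analytic [g] with [g(z) = 0] the right-hand side has mean value 1 around [z]. *)
Lemma Cmod_one_plus_pow_ge (q : R) :
  0 < q -> exists eps lam, 0 < eps <= / 4 /\
    forall x y, x ^ 2 + y ^ 2 <= eps ^ 2 ->
      1 + q * x + lam * (x ^ 2 - y ^ 2) <= Rpower ((1 + x) ^ 2 + y ^ 2) (q / 2).
Proof.
  intros Hq. set (k := q / 2). assert (Hk : 0 < k) by (unfold k; lra).
  (* [b] is the second Taylor coefficient of [u^k] at 1, and [a] lowers it by [k^2/4] to leave room
     for moving the base point to [xi]. As [4 x^2 = 2 (x^2 - y^2) + 2 (x^2 + y^2)], the leading part
     [a (2x)^2] splits into [lam (x^2 - y^2)] with [lam = 2a] and a multiple of [s = x^2 + y^2].
     Together with the [k s] of the first-order term the latter has coefficient [k + 2a = k^2/2],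
     which is positive. *)
  set (a := k * (k - 1) / 2 - k ^ 2 / 4).
  set (b := k * (k - 1) / 2).
  assert (Hb := Rabs_pos b). assert (Ha := Rabs_pos a).
  assert (C : continuity_pt (fun u => Rpower u (k - 2)) 1).
  { apply derivable_continuous_pt. eexists. apply derivable_pt_lim_power; lra. }
  destruct (C (k ^ 2 / 4 / (Rabs b + 1))) as [d [Hd C']].
  { apply Rdiv_lt_0_compat; nra. }
  assert (C1 : forall u, Rabs (u - 1) < d ->
      Rabs (Rpower u (k - 2) - 1) <= k ^ 2 / 4 / (Rabs b + 1)).
  { intros u Hu. destruct (Req_dec u 1) as [->|Hne].
    - unfold Rpower. rewrite ln_1, Rmult_0_r, exp_0, Rminus_diag, Rabs_R0.
      apply Rlt_le, Rdiv_lt_0_compat; nra.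
    - assert (C2 := C' u). unfold dist in C2; simpl in C2; unfold Rdist in C2.
      replace (Rpower 1 (k - 2)) with 1 in C2
        by (unfold Rpower; now rewrite ln_1, Rmult_0_r, exp_0).
      apply Rlt_le, C2. split; [|exact Hu]. split; [exact I | now apply not_eq_sym]. }
  clear C C'.
  (* For [eps <= e0] the higher-order error [a (4x + s)] is at most [k^2/2], the positive
     coefficient left over. *)
  set (e0 := k ^ 2 / 2 / (5 * (Rabs a + 1))).
  assert (He0 : 0 < e0) by (apply Rdiv_lt_0_compat; nra).
  exists (Rmin (/ 4) (Rmin (d / 4) e0)), (2 * a). split.
  { split; [|apply Rmin_l]. repeat apply Rmin_pos; lra. }
  set (eps := Rmin (/ 4) (Rmin (d / 4) e0)).
  assert (E1 : eps <= / 4) by apply Rmin_l.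
  assert (E2 : eps <= d / 4) by (eapply Rle_trans; [apply Rmin_r | apply Rmin_l]).
  assert (E3 : eps <= e0) by (eapply Rle_trans; [apply Rmin_r | apply Rmin_r]).
  assert (E0 : 0 < eps) by (repeat apply Rmin_pos; lra).
  clearbody eps. intros x y Hxy.
  set (s := x ^ 2 + y ^ 2) in *.
  assert (Hs0 : 0 <= s) by (unfold s; nra).
  assert (Hx : - eps <= x <= eps) by (split; unfold s in *; nra).
  assert (Hs1 : s <= eps / 4) by nra.
  replace ((1 + x) ^ 2 + y ^ 2) with (1 + (2 * x + s)) by (unfold s; ring).
  set (t := 2 * x + s).
  assert (Ht : - (2 * eps) <= t <= 3 * eps) by (unfold t; lra).
  destruct (Rpower_taylor_2 k 1 (1 + t)) as (xi & Hxi & ->); [lra | lra |].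
  replace (Rpower 1 k) with 1 by (unfold Rpower; now rewrite ln_1, Rmult_0_r, exp_0).
  replace (Rpower 1 (k - 1)) with 1 by (unfold Rpower; now rewrite ln_1, Rmult_0_r, exp_0).
  assert (Hxi' : Rabs (xi - 1) < d).
  { apply Rabs_def1; revert Hxi; unfold Rmin, Rmax; destruct Rle_dec; intros; lra. }
  specialize (C1 xi Hxi').
  assert (Hlow : a <= b * Rpower xi (k - 2)).
  { assert (B : Rabs (b * (Rpower xi (k - 2) - 1)) <= k ^ 2 / 4).
    { rewrite Rabs_mult.
      apply Rle_trans with (Rabs b * (k ^ 2 / 4 / (Rabs b + 1))).
      - apply Rmult_le_compat_l; assumption.
      - replace (Rabs b * (k ^ 2 / 4 / (Rabs b + 1)))
          with (k ^ 2 / 4 * (Rabs b / (Rabs b + 1))) by (field; lra).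
        rewrite <- (Rmult_1_r (k ^ 2 / 4)) at 2.
        apply Rmult_le_compat_l; [nra|].
        apply (Rmult_le_reg_r (Rabs b + 1)); [lra|].
        unfold Rdiv. rewrite Rmult_assoc, Rinv_l; lra. }
    apply Rabs_le_between in B. unfold a. fold b. lra. }
  fold b. replace (1 + t - 1) with t by ring.
  assert (Hsq : a * t ^ 2 <= b * Rpower xi (k - 2) * t ^ 2)
    by (apply Rmult_le_compat_r; [nra | exact Hlow]).
  assert (Hsmall : Rabs a * (5 * eps) <= k ^ 2 / 2).
  { apply Rle_trans with ((Rabs a + 1) * (5 * e0)); [nra|].
    apply Req_le. unfold e0. field. lra. }
  assert (Hfin : 0 <= s * (k ^ 2 / 2 + a * (4 * x + s))).
  { apply Rmult_le_pos; [assumption|].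
    assert (B : Rabs (a * (4 * x + s)) <= Rabs a * (5 * eps)).
    { rewrite Rabs_mult. apply Rmult_le_compat_l; [assumption|]. apply Rabs_le; lra. }
    apply Rabs_le_between in B. lra. }
  assert (Hid : 1 + k * 1 * t + a * t ^ 2 =
     1 + q * x + 2 * a * (x ^ 2 - y ^ 2) + s * (k ^ 2 / 2 + a * (4 * x + s))).
  { replace (x ^ 2 - y ^ 2) with (2 * x ^ 2 - s) by (unfold s; ring).
    replace q with (2 * k) by (unfold k; field). unfold t, a. field. }
  lra.
Qed.

(** * Continuity and Fubini's theorem for integrals with a parameter *)

Definition continuous_C_R (u : C -> R) (z : C) : Prop :=
  forall eps, 0 < eps -> exists delta, 0 < delta /\
    forall w, Cmod (w - z)%C < delta -> Rabs (u w - u z) < eps.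

Lemma continuous_C_R_comp_2d (u : C -> R) (x y : R -> R -> R) (s t : R) :
  continuous_C_R u (x s t, y s t) ->
  continuity_2d_pt x s t -> continuity_2d_pt y s t ->
  continuity_2d_pt (fun s t => u (x s t, y s t)) s t.
Proof.
  intros Hu Hx Hy eps.
  destruct (Hu eps (cond_pos eps)) as (d & Hd & Hw).
  destruct (Hx (mkposreal (d / 2) (is_pos_div_2 (mkposreal d Hd)))) as [d1 H1].
  destruct (Hy (mkposreal (d / 2) (is_pos_div_2 (mkposreal d Hd)))) as [d2 H2].
  exists (mkposreal (Rmin d1 d2) (Rmin_pos _ _ (cond_pos d1) (cond_pos d2))).
  simpl in *. intros s' t' Hs Ht.
  assert (M1 := Rmin_l d1 d2). assert (M2 := Rmin_r d1 d2).
  apply Hw. eapply Rle_lt_trans; [apply Cmod_le_2Rmax|]. simpl.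
  specialize (H1 s' t' ltac:(lra) ltac:(lra)). specialize (H2 s' t' ltac:(lra) ltac:(lra)).
  assert (Rmax (Rabs (x s' t' + - x s t)) (Rabs (y s' t' + - y s t)) < d / 2)
    by (apply Rmax_lub_lt; assumption).
  lra.
Qed.

Lemma continuity_2d_pt_continuous_r (h : R -> R -> R) s t :
  continuity_2d_pt h s t -> continuous (h s) t.
Proof.
  intros H. apply continuity_pt_filterlim. intros e He.
  destruct (H (mkposreal e He)) as [d Hd]. exists d; split; [apply d|].
  intros y [_ Hy]. apply Hd; [|exact Hy]. rewrite Rminus_diag, Rabs_R0; apply d.
Qed.

Lemma continuity_2d_pt_continuous_l (h : R -> R -> R) s t :
  continuity_2d_pt h s t -> continuous (fun s => h s t) s.
Proof.
  intros H. apply continuity_pt_filterlim. intros e He.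
  destruct (H (mkposreal e He)) as [d Hd]. exists d; split; [apply d|].
  intros y [_ Hy]. apply Hd; [exact Hy|]. rewrite Rminus_diag, Rabs_R0; apply d.
Qed.

Lemma ex_RInt_cont (g : R -> R) a b : (forall t, continuous g t) -> ex_RInt g a b.
Proof. intros H. apply (ex_RInt_continuous (V := R_CompleteNormedModule)). intros; apply H. Qed.

Lemma continuous_RInt_param (h : R -> R -> R) (c d s : R) :
  c <= d -> (forall t, c <= t <= d -> continuity_2d_pt h s t) ->
  locally s (fun s => ex_RInt (h s) c d) ->
  continuous (fun s => RInt (h s) c d) s.
Proof.
  intros Hcd Hh [d0 Hex].
  apply continuity_pt_filterlim. intros e He.
  set (e' := e / (d - c + 1)).
  assert (He' : 0 < e') by (apply Rdiv_lt_0_compat; lra).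
  destruct (uniform_continuity_2d_1d' h c d s Hh (mkposreal e' He')) as [d1 H1].
  assert (Hd : 0 < Rmin d0 d1) by (apply Rmin_pos; apply cond_pos).
  assert (M1 := Rmin_l d0 d1). assert (M2 := Rmin_r d0 d1).
  assert (P1 := cond_pos d1). assert (P0 := cond_pos d0).
  exists (Rmin d0 d1). split; [exact Hd|].
  intros y [_ Hy]. unfold dist in *; simpl in *; unfold Rdist in *.
  assert (I1 : ex_RInt (h y) c d).
  { apply Hex. unfold ball; simpl; unfold AbsRing_ball; simpl. 
    eapply Rlt_le_trans; [exact Hy | exact M1]. }
  assert (I0 : ex_RInt (h s) c d).
  { apply Hex. apply ball_center. }
  rewrite <- RInt_minus_R by assumption.
  apply Rle_lt_trans with ((d - c) * e').
  - apply abs_RInt_le_const; [lra | |].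
    + apply (ex_RInt_minus (V := R_CompleteNormedModule)); assumption.
    + intros t Ht. apply Rlt_le. apply Rabs_def2 in Hy.
      apply H1; try lra. rewrite Rminus_diag, Rabs_R0; apply P1.
  - unfold e'. apply (Rmult_lt_reg_r (d - c + 1)); [lra|].
    replace ((d - c) * (e / (d - c + 1)) * (d - c + 1)) with ((d - c) * e) by (field; lra).
    nra.
Qed.

(** As functions of the upper limit [b], both iterated integrals vanish at [a] and have the
    derivative [RInt (h b) c d]; for the second one this is differentiation under the integral. *)
Lemma RInt_swap (h : R -> R -> R) (a b c d : R) :
  c <= d -> (forall s t, continuity_2d_pt h s t) ->
  RInt (fun s => RInt (fun t => h s t) c d) a b =
  RInt (fun t => RInt (fun s => h s t) a b) c d.
Proof.
  intros Hcd Hh.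
  assert (Cr : forall s t, continuous (h s) t)
    by (intros; apply continuity_2d_pt_continuous_r, Hh).
  assert (Cl : forall s t, continuous (fun s => h s t) s)
    by (intros; apply continuity_2d_pt_continuous_l, Hh).
  assert (CI : forall s, continuous (fun s => RInt (h s) c d) s).
  { intros s. apply continuous_RInt_param; [assumption | intros; apply Hh|].
    apply filter_forall. intros; apply ex_RInt_cont; auto. }
  assert (hsw : forall s t, continuity_2d_pt (fun x t => h t x) s t).
  { intros s t e. destruct (Hh t s e) as [dd H]. exists dd. intros; apply H; assumption. }
  assert (DG : forall x, is_derive (fun x => RInt (fun s => RInt (h s) c d) a x) x
                          (RInt (h x) c d)).
  { intros x. apply (is_derive_RInt (fun s => RInt (h s) c d) _ a x).
    - apply filter_forall. intros y.
      apply (RInt_correct (V := R_CompleteNormedModule)), ex_RInt_cont, CI.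
    - apply CI. }
  assert (D1 : forall x t, is_derive (fun x => RInt (fun s => h s t) a x) x (h x t)).
  { intros x t. apply (is_derive_RInt (fun s => h s t) _ a x).
    - apply filter_forall. intros y.
      apply (RInt_correct (V := R_CompleteNormedModule)), ex_RInt_cont. intros; apply Cl.
    - apply Cl. }
  assert (C1 : forall x t, continuous (fun t => RInt (fun s => h s t) a x) t).
  { intros x t.
    destruct (Rle_lt_dec a x) as [Hax|Hax].
    - apply (continuous_RInt_param (fun t s => h s t)); [lra | intros; apply hsw|].
      apply filter_forall. intros; apply ex_RInt_cont; intros; apply Cl.
    - apply (continuous_ext (fun t => - RInt (fun s => h s t) x a)).
      + intros y. apply (opp_RInt_swap (V := R_CompleteNormedModule)).
        apply ex_RInt_cont; intros; apply Cl.
      + apply (continuous_opp (V := R_NormedModule)).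
        apply (continuous_RInt_param (fun t s => h s t)); [lra | intros; apply hsw|].
        apply filter_forall. intros; apply ex_RInt_cont; intros; apply Cl. }
  assert (DF : forall x, is_derive (fun x => RInt (fun t => RInt (fun s => h s t) a x) c d) x
                          (RInt (h x) c d)).
  { intros x.
    replace (RInt (h x) c d) with
      (RInt (fun t => Derive (fun x => RInt (fun s => h s t) a x) x) c d).
    2:{ apply RInt_ext. intros t _. apply is_derive_unique, D1. }
    apply (is_derive_RInt_param (fun x t => RInt (fun s => h s t) a x)).
    - apply filter_forall. intros y t _. exists (h y t). apply D1.
    - intros t _. apply (continuity_2d_pt_ext h); [|apply Hh].
      intros; symmetry; apply is_derive_unique, D1.
    - apply filter_forall. intros y. apply ex_RInt_cont. intros; apply C1. }
  set (F := fun x => RInt (fun t => RInt (fun s => h s t) a x) c d -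
                     RInt (fun s => RInt (h s) c d) a x).
  assert (D : forall x, is_derive F x 0).
  { intros x. replace 0 with (RInt (h x) c d - RInt (h x) c d) by ring.
    apply (is_derive_minus (V := R_NormedModule)); [apply DF | apply DG]. }
  assert (E : F a = 0).
  { unfold F. rewrite (RInt_point a (fun s => RInt (h s) c d)).
    rewrite (RInt_ext _ (fun _ => 0)) by (intros; apply (RInt_point a (fun s => h s x))).
    rewrite RInt_const. unfold zero, scal; simpl; unfold mult; simpl. ring. }
  assert (E' : F b = F a).
  { destruct (Rtotal_order a b) as [Hab|[<-|Hab]]; [|reflexivity|].
    - symmetry; apply (eq_is_derive F a b); [intros; apply D | exact Hab].
    - apply (eq_is_derive F b a); [intros; apply D | exact Hab]. }
  rewrite E in E'. unfold F in E'.
  symmetry. apply Rminus_diag_uniq. exact E'.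
Qed.

(** * Circle integrals and the maximum principle *)

Lemma RInt_translate (g : R -> R) (phi a b : R) :
  (forall t, continuous g t) ->
  RInt (fun t => g (t + phi)) a b = RInt g (a + phi) (b + phi).
Proof.
  intros Hg.
  assert (H := RInt_comp_lin (V := R_CompleteNormedModule) g 1 phi a b
                 (ex_RInt_cont _ _ _ Hg)).
  rewrite !Rmult_1_l in H. rewrite <- H. apply RInt_ext. intros t _.
  unfold scal; simpl; unfold mult; simpl. rewrite Rmult_1_l. now rewrite Rmult_1_l.
Qed.

Lemma RInt_periodic (g : R -> R) (phi T : R) :
  (forall t, continuous g t) -> (forall t, g (t + T) = g t) ->
  RInt (fun t => g (t + phi)) 0 T = RInt g 0 T.
Proof.
  intros Hg Hp. rewrite RInt_translate by assumption. rewrite Rplus_0_l.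
  rewrite <- (RInt_Chasles_R g phi 0 (T + phi)) by (apply ex_RInt_cont; assumption).
  rewrite <- (RInt_Chasles_R g 0 T (T + phi)) by (apply ex_RInt_cont; assumption).
  assert (E : RInt g T (T + phi) = RInt g 0 phi).
  { transitivity (RInt (fun t => g (t + T)) 0 phi).
    - rewrite RInt_translate by assumption. f_equal; ring.
    - apply RInt_ext; intros; apply Hp. }
  rewrite E.
  assert (S := opp_RInt_swap (V := R_CompleteNormedModule) g 0 phi (ex_RInt_cont g 0 phi Hg)).
  unfold opp in S; simpl in S. lra.
Qed.

Lemma expi_plus s t : expi (s + t) = (expi s * expi t)%C.
Proof. unfold expi, Cmult; simpl. rewrite cos_plus, sin_plus. f_equal; ring. Qed.

Lemma expi_period t : expi (t + 2 * PI) = expi t.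
Proof. rewrite expi_plus, expi_2PI. unfold expi at 2. rewrite cos_0, sin_0.
  unfold Cmult; destruct (expi t); simpl. f_equal; ring. Qed.

Lemma polar_form (z : C) : exists phi, z = (RtoC (Cmod z) * expi phi)%C.
Proof.
  destruct (Req_dec (Cmod z) 0) as [H|H].
  - exists 0. rewrite H, Cmult_0_l. apply Cmod_eq_0, H.
  - assert (Hpos : 0 < Cmod z) by (assert (h := Cmod_ge_0 z); lra).
    destruct z as [x y]. set (m := Cmod (x, y)) in *.
    assert (Hm : x ^ 2 + y ^ 2 = m ^ 2).
    { unfold m, Cmod. simpl fst; simpl snd. rewrite pow2_sqrt; nra. }
    assert (Hx : -1 <= x / m <= 1).
    { assert (x = x / m * m) by (field; lra).
      split; apply (Rmult_le_reg_r m); try lra; nra. }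
    assert (Hs : sqrt (1 - Rsqr (x / m)) = Rabs (y / m)).
    { rewrite <- sqrt_Rsqr_abs. f_equal. unfold Rsqr.
      replace 1 with ((x ^ 2 + y ^ 2) / m ^ 2) by (rewrite Hm; field; lra). field; lra. }
    assert (Hc := cos_acos _ Hx). assert (Hsi := sin_acos _ Hx). rewrite Hs in Hsi.
    destruct (Rle_lt_dec 0 y) as [Hy|Hy].
    + exists (acos (x / m)).
      rewrite Rabs_pos_eq in Hsi by (apply Rmult_le_pos; [lra | apply Rlt_le, Rinv_0_lt_compat; lra]).
      unfold expi, RtoC, Cmult; simpl. rewrite Hc, Hsi. f_equal; field; lra.
    + exists (- acos (x / m)).
      rewrite Rabs_left in Hsi.
      2:{ assert (0 < - (y / m)); [|lra]. replace (- (y / m)) with (- y / m) by (field; lra).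
          apply Rdiv_lt_0_compat; lra. }
      unfold expi, RtoC, Cmult; simpl. rewrite cos_neg, sin_neg, Hc, Hsi. f_equal; field; lra.
Qed.

Definition circle_integral (u : C -> R) (r : R) : R :=
  RInt (fun t => u (RtoC r * expi t)%C) 0 (2 * PI).

Lemma continuity_2d_pt_comp_l (f : R -> R) (s t : R) :
  continuity_pt f s -> continuity_2d_pt (fun s _ => f s) s t.
Proof.
  intros H. apply (continuity_1d_2d_pt_comp f (fun s _ => s)); [exact H|].
  apply continuity_2d_pt_id1.
Qed.

Lemma continuity_2d_pt_comp_r (f : R -> R) (s t : R) :
  continuity_pt f t -> continuity_2d_pt (fun _ t => f t) s t.
Proof.
  intros H. apply (continuity_1d_2d_pt_comp f (fun _ t => t)); [exact H|].
  apply continuity_2d_pt_id2.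
Qed.

Ltac cont2d :=
  repeat first
    [ apply continuity_2d_pt_minus | apply continuity_2d_pt_plus
    | apply continuity_2d_pt_mult
    | apply continuity_2d_pt_id1 | apply continuity_2d_pt_id2
    | apply continuity_2d_pt_const
    | apply continuity_2d_pt_comp_l; first [apply continuity_cos | apply continuity_sin]
    | apply continuity_2d_pt_comp_r; first [apply continuity_cos | apply continuity_sin] ].

Lemma continuity_2d_circle (u : C -> R) (z : C) (r t : R) :
  continuous_C_R u (z + RtoC r * expi t)%C ->
  continuity_2d_pt (fun r t => u (z + RtoC r * expi t)%C) r t.
Proof.
  intros H. apply (continuity_2d_pt_ext (fun r t => u (fst z + r * cos t, snd z + r * sin t))).
  { intros. now rewrite expi_scal. }
  apply continuous_C_R_comp_2d; [now rewrite <- expi_scal | cont2d | cont2d].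
Qed.

Lemma continuity_2d_circle0 (u : C -> R) (r t : R) :
  continuous_C_R u (RtoC r * expi t)%C ->
  continuity_2d_pt (fun r t => u (RtoC r * expi t)%C) r t.
Proof.
  intros H. apply (continuity_2d_pt_ext (fun r t => u (RtoC 0 + RtoC r * expi t)%C)).
  { intros. now rewrite Cplus_0_l. }
  apply continuity_2d_circle. now rewrite Cplus_0_l.
Qed.

Lemma continuous_circle (u : C -> R) (z : C) (r t : R) :
  continuous_C_R u (z + RtoC r * expi t)%C ->
  continuous (fun t => u (z + RtoC r * expi t)%C) t.
Proof.
  intros H.
  apply (continuity_2d_pt_continuous_r (fun r t => u (z + RtoC r * expi t)%C)).
  apply continuity_2d_circle, H.
Qed.

Lemma continuous_circle0 (u : C -> R) (r t : R) :
  continuous_C_R u (RtoC r * expi t)%C ->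
  continuous (fun t => u (RtoC r * expi t)%C) t.
Proof.
  intros H.
  apply (continuity_2d_pt_continuous_r (fun r t => u (RtoC r * expi t)%C)).
  apply continuity_2d_circle0, H.
Qed.

Lemma unit_disc_scal_expi r t : Rabs r < 1 -> unit_disc (RtoC r * expi t)%C.
Proof. intros H. unfold unit_disc. now rewrite Cmod_scal_expi. Qed.

Lemma circle_integral_rotate (u : C -> R) (z : C) :
  (forall z, unit_disc z -> continuous_C_R u z) -> unit_disc z ->
  RInt (fun t => u (z * expi t)%C) 0 (2 * PI) = circle_integral u (Cmod z).
Proof.
  intros Hu Hz. unfold circle_integral. destruct (polar_form z) as [phi Hphi].
  rewrite <- (RInt_periodic (fun t => u (RtoC (Cmod z) * expi t)%C) phi).
  - apply RInt_ext. intros t _. rewrite Hphi at 1.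
    rewrite expi_plus. f_equal. ring.
  - intros t. apply continuous_circle0, Hu, unit_disc_scal_expi.
    rewrite Rabs_pos_eq by apply Cmod_ge_0. exact Hz.
  - intros t. now rewrite expi_period.
Qed.

Lemma continuous_circle_integral (u : C -> R) (r : R) :
  (forall z, unit_disc z -> continuous_C_R u z) -> Rabs r < 1 ->
  continuous (circle_integral u) r.
Proof.
  intros Hu Hr. assert (Hpi := PI_RGT_0).
  apply (continuous_RInt_param (fun r t => u (RtoC r * expi t)%C)); [lra | |].
  - intros t _. apply continuity_2d_circle0, Hu, unit_disc_scal_expi, Hr.
  - assert (C := continuous_Rabs r). 
    assert (L : locally r (fun s => Rabs s < 1)).
    { apply (C (fun y => y < 1)), (open_lt 1), Hr. }
    generalize L. apply filter_imp. intros s Hs. apply ex_RInt_cont.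
    intros t. apply continuous_circle0, Hu, unit_disc_scal_expi, Hs.
Qed.

Lemma RInt_const_R (c a b : R) : RInt (fun _ => c) a b = (b - a) * c.
Proof. rewrite RInt_const. reflexivity. Qed.

Lemma RInt_trig_0 (a b : R) : RInt (fun t => a + b * cos t) 0 (2 * PI) = 2 * PI * a.
Proof.
  apply is_RInt_unique.
  replace (2 * PI * a) with (minus (a * (2 * PI) + b * sin (2 * PI)) (a * 0 + b * sin 0))
    by (rewrite sin_2PI, sin_0; unfold minus, plus, opp; simpl; ring).
  apply (is_RInt_derive (V := R_CompleteNormedModule) (fun t => a * t + b * sin t)).
  - intros t _. auto_derive; [exact I | ring].
  - intros t _. apply (ex_derive_continuous (V := R_NormedModule)). auto_derive; exact I.
Qed.

(* Averaging over rotations makes [u] radial, so the maximum principle becomes a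
   statement about the maximum of one continuous function of the radius; the term
   [eta * r ^ 2] makes the submean inequality strict. *)
Lemma circle_integral_monotone_of_submean (u : C -> R) (r R' : R) :
  (forall z, unit_disc z -> continuous_C_R u z) ->
  (forall r, 0 <= r < 1 -> exists delta, 0 < delta /\
     forall rho t, 0 < rho < delta -> r + rho < 1 -> 0 <= t <= 2 * PI ->
       2 * PI * u (RtoC r * expi t)%C <=
       RInt (fun s => u (RtoC r * expi t + RtoC rho * expi s)%C) 0 (2 * PI)) ->
  0 <= r <= R' -> R' < 1 -> circle_integral u r <= circle_integral u R'.
Proof.
  intros Hu Hsub Hr HR. assert (Hpi := PI_RGT_0).
  apply le_epsilon. intros eta Heta.
  destruct (continuity_ab_maj (fun r => circle_integral u r + eta * r ^ 2) 0 R')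
    as (x & Hmax & Hx); [lra | |].
  { intros c Hc. apply continuity_pt_plus.
    - apply continuity_pt_filterlim, continuous_circle_integral; [assumption|].
      rewrite Rabs_pos_eq; lra.
    - reg. }
  assert (Hle : circle_integral u r <= circle_integral u x + eta * x ^ 2).
  { specialize (Hmax r ltac:(lra)). nra. }
  destruct (Req_dec x R') as [->|Hne].
  { assert (R' ^ 2 <= 1) by nra. nra. }
  exfalso.
  destruct (Hsub x ltac:(lra)) as (delta & Hd & Hs).
  set (rho := Rmin (delta / 2) (R' - x)).
  assert (H1 : rho <= delta / 2) by apply Rmin_l.
  assert (H2 : rho <= R' - x) by apply Rmin_r.
  assert (H0 : 0 < rho) by (apply Rmin_pos; lra).
  clearbody rho.
  set (h := fun s t => u ((RtoC x + RtoC rho * expi s) * expi t)%C).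
  assert (Hdisc : forall s, Cmod (RtoC x + RtoC rho * expi s)%C <= R').
  { intros s. eapply Rle_trans; [apply Cmod_triangle|].
    rewrite Cmod_scal_expi, Cmod_R, !Rabs_pos_eq; lra. }
  assert (Hin : forall s t, unit_disc ((RtoC x + RtoC rho * expi s) * expi t)%C).
  { intros s t. unfold unit_disc. rewrite Cmod_mult, Cmod_expi, Rmult_1_r.
    specialize (Hdisc s). lra. }
  assert (Hh : forall s t, continuity_2d_pt h s t).
  { intros s t.
    assert (E : forall s t, ((RtoC x + RtoC rho * expi s) * expi t)%C =
      ((x + rho * cos s) * cos t - rho * sin s * sin t,
       (x + rho * cos s) * sin t + rho * sin s * cos t)).
    { intros. unfold RtoC, expi, Cplus, Cmult; simpl. f_equal; ring. }
    apply (continuity_2d_pt_ext (fun s t => u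
      ((x + rho * cos s) * cos t - rho * sin s * sin t,
       (x + rho * cos s) * sin t + rho * sin s * cos t))).
    { intros. unfold h. now rewrite E. }
    apply continuous_C_R_comp_2d; [rewrite <- E; apply Hu, Hin | cont2d | cont2d]. }
  (* The submean inequality is integrated over all centres on the circle of radius [x]. By
     periodicity each small circle may be turned together with its centre, so for fixed [s] the
     point of [h s t] runs over a full circle about 0. *)
  assert (B1 : 2 * PI * circle_integral u x <=
     RInt (fun t => RInt (fun s => h s t) 0 (2 * PI)) 0 (2 * PI)).
  { unfold circle_integral.
    assert (Cx : forall t, continuous (fun t => u (RtoC x * expi t)%C) t).
    { intros t. apply continuous_circle0, Hu, unit_disc_scal_expi.
      rewrite Rabs_pos_eq; lra. }
    rewrite <- (RInt_scal (V := R_CompleteNormedModule)) by (apply ex_RInt_cont, Cx).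
    apply RInt_le; [lra | | |].
    - apply ex_RInt_cont. intros t.
      apply (continuous_scal_r (V := R_NormedModule)), Cx.
    - apply ex_RInt_cont. intros t.
      apply (continuous_RInt_param (fun t s => h s t)); [lra | |].
      + intros s _ e. destruct (Hh s t e) as [dd D]. exists dd. intros; apply D; assumption.
      + apply filter_forall. intros y. apply ex_RInt_cont. intros s.
        apply continuity_2d_pt_continuous_l, Hh.
    - intros t Ht. eapply Rle_trans; [apply (Hs rho t); lra|].
      apply Req_le.
      rewrite <- (RInt_periodic (fun s => u (RtoC x * expi t + RtoC rho * expi s)%C) t).
      + apply RInt_ext. intros s _. unfold h. rewrite expi_plus. f_equal. ring.
      + intros s. apply continuous_circle, Hu. unfold unit_disc.
        eapply Rle_lt_trans; [apply Cmod_triangle|].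
        rewrite !Cmod_scal_expi, !Rabs_pos_eq; lra.
      + intros s. now rewrite expi_period. }
  rewrite <- (RInt_swap h) in B1 by (lra || assumption).
  assert (Hmod : forall s, Cmod (RtoC x + RtoC rho * expi s)%C ^ 2 =
                   x ^ 2 + rho ^ 2 + 2 * x * rho * cos s).
  { intros s. rewrite expi_scal. unfold Cmod, RtoC. simpl fst; simpl snd.
    rewrite pow2_sqrt by (apply Rplus_le_le_0_compat; apply pow2_ge_0).
    assert (T := sin2_cos2 s). unfold Rsqr in T.
    transitivity (x ^ 2 + rho ^ 2 * (sin s * sin s + cos s * cos s) + 2 * x * rho * cos s);
      [ring | rewrite T; ring]. }
  (* For fixed [s] the inner integral is a circle integral of radius at most [R'], to which the
     maximality of [x] applies. The mean of [|x + rho e^(is)|^2] is [x^2 + rho^2], so the average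
     falls short of the value at [x] by [eta * rho^2], against [B1]. *)
  assert (B2 : RInt (fun s => RInt (fun t => h s t) 0 (2 * PI)) 0 (2 * PI) <=
     RInt (fun s => (circle_integral u x - eta * rho ^ 2) +
                    (- eta * (2 * x * rho)) * cos s) 0 (2 * PI)).
  { apply RInt_le; [lra | | |].
    - apply ex_RInt_cont. intros s. apply continuous_RInt_param; [lra | intros; apply Hh |].
      apply filter_forall. intros y. apply ex_RInt_cont. intros t.
      apply continuity_2d_pt_continuous_r, Hh.
    - apply ex_RInt_cont. intros s. apply (ex_derive_continuous (V := R_NormedModule)).
      auto_derive; exact I.
    - intros s _. unfold h. rewrite circle_integral_rotate; [|assumption|].
      2:{ unfold unit_disc. specialize (Hdisc s). lra. }
      specialize (Hmax (Cmod (RtoC x + RtoC rho * expi s)%C)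
        (conj (Cmod_ge_0 _) (Hdisc s))). cbv beta in Hmax. rewrite Hmod in Hmax. lra. }
  rewrite RInt_trig_0 in B2.
  assert (0 < eta * rho ^ 2) by (apply Rmult_lt_0_compat; [lra | apply pow_lt; lra]).
  nra.
Qed.

(** * Monotonicity of the means *)

Lemma Cmod_diff (z w : C) : Rabs (Cmod z - Cmod w) <= Cmod (z - w)%C.
Proof.
  assert (H1 := Cmod_triangle (z - w)%C w). assert (H2 := Cmod_triangle (w - z)%C z).
  replace (z - w + w)%C with z in H1 by ring. replace (w - z + z)%C with w in H2 by ring.
  rewrite <- (Cmod_opp (w - z)%C) in H2. replace (- (w - z))%C with (z - w)%C in H2 by ring.
  apply Rabs_le; lra.
Qed.

Lemma continuous_C_R_modulus (f : C -> C) (g : R -> R) (z : C) :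
  ex_derive (K := C_AbsRing) (V := C_NormedModule) f z ->
  continuity_pt g (Cmod (f z)) ->
  continuous_C_R (fun z => g (Cmod (f z))) z.
Proof.
  intros Hf Hg eps He.
  destruct (Hg eps He) as (a & Ha & Hga).
  destruct (ex_derive_C_continuous f z Hf a Ha) as (d & Hd & Hw).
  exists d. split; [exact Hd|]. intros w Hlt.
  destruct (Req_dec (Cmod (f w)) (Cmod (f z))) as [->|Hne].
  - now rewrite Rminus_diag, Rabs_R0.
  - apply Hga. split; [split; [exact I | now apply not_eq_sym]|].
    unfold dist; simpl; unfold Rdist. eapply Rle_lt_trans; [apply Cmod_diff | apply Hw, Hlt].
Qed.

Lemma circle_mean_integral q f r :
  analytic_in_disc f -> 0 < q -> Rabs r < 1 ->
  circle_mean q f r = circle_integral (fun z => rpow (Cmod (f z)) q) r / (2 * PI).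
Proof.
  intros Hf Hq Hr. unfold circle_mean, circle_integral, Rdiv.
  rewrite (Rmult_comm (RInt _ _ _)). rewrite <- (RInt_scal (V := R_CompleteNormedModule)).
  - apply RInt_ext. intros t _. unfold scal; simpl; unfold mult; simpl. apply Rmult_comm.
  - apply ex_RInt_cont. intros t.
    apply (continuous_circle0 (fun z => rpow (Cmod (f z)) q)).
    apply (continuous_C_R_modulus f (fun x => rpow x q)).
    + apply Hf, unit_disc_scal_expi, Hr.
    + apply continuity_pt_rpow, Hq.
Qed.

(** The product and chain rules use [C] as a module over its own ring structure. The norms and
    operations of the two structures agree by conversion, so only the linearity component of the
    derivative is reproved. *)
Lemma is_derive_C_ring (f : C -> C) (z l : C) :
  is_derive (K := C_AbsRing) (V := AbsRing_NormedModule C_AbsRing) f z l <->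
  is_derive (K := C_AbsRing) (V := C_NormedModule) f z l.
Proof.
  split; intros [_ H]; (split; [apply is_linear_scal_l | exact H]).
Qed.

Lemma ex_derive_C_mult (f g : C -> C) (z : C) :
  ex_derive (K := C_AbsRing) (V := C_NormedModule) f z ->
  ex_derive (K := C_AbsRing) (V := C_NormedModule) g z ->
  ex_derive (K := C_AbsRing) (V := C_NormedModule) (fun w => f w * g w)%C z.
Proof.
  intros [l Hl] [m Hm]. eexists. apply is_derive_C_ring.
  apply (is_derive_mult (K := C_AbsRing) f g z l m);
    [apply is_derive_C_ring, Hl | apply is_derive_C_ring, Hm | apply Cmult_comm].
Qed.

Lemma ex_derive_C_plus (f g : C -> C) (z : C) :
  ex_derive (K := C_AbsRing) (V := C_NormedModule) f z ->
  ex_derive (K := C_AbsRing) (V := C_NormedModule) g z ->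
  ex_derive (K := C_AbsRing) (V := C_NormedModule) (fun w => f w + g w)%C z.
Proof. apply (ex_derive_plus (K := C_AbsRing) (V := C_NormedModule)). Qed.

Lemma ex_derive_C_minus (f g : C -> C) (z : C) :
  ex_derive (K := C_AbsRing) (V := C_NormedModule) f z ->
  ex_derive (K := C_AbsRing) (V := C_NormedModule) g z ->
  ex_derive (K := C_AbsRing) (V := C_NormedModule) (fun w => f w - g w)%C z.
Proof. apply (ex_derive_minus (K := C_AbsRing) (V := C_NormedModule)). Qed.

Lemma ex_derive_C_const (c z : C) :
  ex_derive (K := C_AbsRing) (V := C_NormedModule) (fun _ => c) z.
Proof. apply (ex_derive_const (K := C_AbsRing) (V := C_NormedModule)). Qed.

Lemma ex_derive_C_id (z : C) :
  ex_derive (K := C_AbsRing) (V := C_NormedModule) (fun w => w) z.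
Proof. eexists. apply is_derive_C_ring, is_derive_id. Qed.

Lemma ex_derive_C_comp (f g : C -> C) (z : C) :
  ex_derive (K := C_AbsRing) (V := C_NormedModule) f (g z) ->
  ex_derive (K := C_AbsRing) (V := C_NormedModule) g z ->
  ex_derive (K := C_AbsRing) (V := C_NormedModule) (fun w => f (g w)) z.
Proof.
  intros [l Hl] [m Hm]. eexists.
  apply (is_derive_comp (K := C_AbsRing) (V := C_NormedModule) f g z l m Hl).
  apply is_derive_C_ring, Hm.
Qed.

(** The lower bound for [|1 + g|^q] is affine in the real parts of [g] and [g^2], to which the mean
    value property applies. That [eps] depends on [q] alone is what later allows one radius for a
    whole circle of centres. *)
Lemma mean_value_ge (f : C -> C) (q : R) :
  0 < q -> exists eps, 0 < eps /\
  forall z rho, 0 < rho -> 0 < Cmod (f z) ->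
    (forall w, Cmod (w - z)%C <= rho ->
       ex_derive (K := C_AbsRing) (V := C_NormedModule) f w /\
       Cmod (f w - f z)%C <= eps * Cmod (f z)) ->
    2 * PI * rpow (Cmod (f z)) q <=
      RInt (fun t => rpow (Cmod (f (z + RtoC rho * expi t)%C)) q) 0 (2 * PI).
Proof.
  intros Hq. destruct (Cmod_one_plus_pow_ge q Hq) as (eps & lam & He & Hineq).
  exists eps. split; [lra|]. intros z rho Hrho Hfz Hf.
  assert (Hpi := PI_RGT_0).
  assert (Hfz0 : f z <> RtoC 0) by (apply Cmod_gt_0; exact Hfz).
  set (g := fun w => ((f w - f z) * / f z)%C).
  assert (Dg : forall w, Cmod (w - z)%C <= rho ->
     ex_derive (K := C_AbsRing) (V := C_NormedModule) g w).
  { intros w Hw. apply ex_derive_C_mult; [apply ex_derive_C_minus|].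
    - apply Hf, Hw.
    - apply ex_derive_C_const.
    - apply ex_derive_C_const. }
  assert (Dg2 : forall w, Cmod (w - z)%C <= rho ->
     ex_derive (K := C_AbsRing) (V := C_NormedModule) (fun w => g w * g w)%C w)
    by (intros w Hw; apply ex_derive_C_mult; apply Dg, Hw).
  destruct (mean_value_Re g z rho Hrho Dg) as [I1 M1].
  destruct (mean_value_Re _ z rho Hrho Dg2) as [I2 M2].
  assert (Hgz : g z = RtoC 0) by (unfold g; ring).
  rewrite Hgz in M1. rewrite Hgz in M2.
  replace (fst (RtoC 0)) with 0 in M1 by reflexivity.
  replace (fst (RtoC 0 * RtoC 0)%C) with 0 in M2 by (simpl; ring).
  set (w := fun t => (z + RtoC rho * expi t)%C) in *.
  assert (Hw : forall t, Cmod (w t - z)%C <= rho).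
  { intros t. unfold w. replace (z + RtoC rho * expi t - z)%C with (RtoC rho * expi t)%C by ring.
    rewrite Cmod_scal_expi, Rabs_pos_eq; lra. }
  assert (Hlow : forall t, rpow (Cmod (f z)) q *
     (1 + q * fst (g (w t)) + lam * fst (g (w t) * g (w t))%C) <=
     rpow (Cmod (f (w t))) q).
  { intros t. set (v := g (w t)).
    assert (Ef : f (w t) = (f z * (1 + v))%C) by (unfold v, g; field; exact Hfz0).
    assert (Hv : Cmod v <= eps).
    { destruct (Hf (w t) (Hw t)) as [_ B].
      unfold v, g. rewrite Cmod_mult, Cmod_inv by exact Hfz0.
      apply (Rmult_le_reg_r (Cmod (f z))); [exact Hfz|].
      rewrite Rmult_assoc, Rinv_l by lra. lra. }
    rewrite Ef, Cmod_mult, rpow_mult by apply Cmod_ge_0.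
    apply Rmult_le_compat_l; [apply rpow_ge_0|].
    destruct v as [x y].
    assert (Hxy : x ^ 2 + y ^ 2 <= eps ^ 2).
    { replace (x ^ 2 + y ^ 2) with (Cmod (x, y) ^ 2).
      - apply pow_incr. split; [apply Cmod_ge_0 | exact Hv].
      - unfold Cmod. simpl fst; simpl snd. rewrite pow2_sqrt; [ring|].
        apply Rplus_le_le_0_compat; apply pow2_ge_0. }
    specialize (Hineq x y Hxy).
    replace (fst ((x, y) * (x, y))%C) with (x ^ 2 - y ^ 2) by (simpl; ring).
    simpl (fst (x, y)).
    eapply Rle_trans; [exact Hineq|].
    assert (Hpos : 0 < (1 + x) ^ 2 + y ^ 2).
    { assert (Hx := Rabs_fst_le_Cmod (x, y)). simpl fst in Hx.
      assert (Rabs x <= / 4) by lra. apply Rabs_le_between in H.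
      assert (h := pow2_ge_0 y). nra. }
    assert (Em : Cmod (1 + (x, y))%C = Rpower ((1 + x) ^ 2 + y ^ 2) (/ 2)).
    { rewrite Rpower_sqrt by exact Hpos. unfold Cmod. f_equal. simpl. ring. }
    rewrite Em, rpow_Rpower, Rpower_mult by apply exp_pos.
    apply Req_le. f_equal. field. }
  set (c := rpow (Cmod (f z)) q) in *.
  assert (I3 : ex_RInt (fun t => 1 + q * fst (g (w t)) + lam * fst (g (w t) * g (w t))%C) 0 (2 * PI)).
  { apply (ex_RInt_plus (V := R_NormedModule)).
    - apply (ex_RInt_plus (V := R_NormedModule)); [apply ex_RInt_const|].
      apply (ex_RInt_scal (V := R_NormedModule)), I1.
    - apply (ex_RInt_scal (V := R_NormedModule)), I2. }
  apply Rle_trans with (RInt (fun t => c *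
     (1 + q * fst (g (w t)) + lam * fst (g (w t) * g (w t))%C)) 0 (2 * PI)).
  - rewrite (RInt_scal (V := R_CompleteNormedModule)) by exact I3.
    rewrite (RInt_plus (V := R_CompleteNormedModule)
      (fun t => 1 + q * fst (g (w t))) (fun t => lam * fst (g (w t) * g (w t))%C)).
    2:{ apply (ex_RInt_plus (V := R_NormedModule)); [apply ex_RInt_const|].
        apply (ex_RInt_scal (V := R_NormedModule)), I1. }
    2:{ apply (ex_RInt_scal (V := R_NormedModule)), I2. }
    rewrite (RInt_plus (V := R_CompleteNormedModule) (fun t => 1) (fun t => q * fst (g (w t)))).
    2:{ apply ex_RInt_const. }
    2:{ apply (ex_RInt_scal (V := R_NormedModule)), I1. }
    rewrite (RInt_scal (V := R_CompleteNormedModule) (fun t => fst (g (w t)))) by exact I1.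
    rewrite (RInt_scal (V := R_CompleteNormedModule) (fun t => fst (g (w t) * g (w t))%C)) by exact I2.
    rewrite RInt_const_R.
    change (fun t => fst (g (w t))) with (fun t => fst (g (z + RtoC rho * expi t)%C)).
    change (fun t => fst (g (w t) * g (w t))%C) with (fun t =>
      fst (g (z + RtoC rho * expi t) * g (z + RtoC rho * expi t))%C).
    rewrite M1, M2. unfold scal, plus; simpl; unfold mult; simpl.
    apply Req_le. ring.
  - apply RInt_le; [lra | | |].
    + apply (ex_RInt_scal (V := R_NormedModule)), I3.
    + apply ex_RInt_cont. intros t.
      apply (continuous_circle (fun z => rpow (Cmod (f z)) q)).
      apply (continuous_C_R_modulus f (fun x => rpow x q)).
      * apply Hf, Hw.
      * apply continuity_pt_rpow, Hq.
    + intros t _. apply Hlow.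
Qed.

Lemma Cmod_expi_minus (s t : R) : Cmod (expi s - expi t)%C <= 2 * Rabs (s - t).
Proof.
  eapply Rle_trans; [apply Cmod_le_2Rmax|]. simpl.
  apply Rmult_le_compat_l; [lra|].
  assert (MV : forall f df : R -> R, (forall c, derivable_pt_lim f c (df c)) ->
     (forall c, Rabs (df c) <= 1) -> Rabs (f s - f t) <= Rabs (s - t)).
  { intros f df D B.
    destruct (MVT_gen f t s df) as (c & _ & E).
    - intros; apply is_derive_Reals, D.
    - intros x _. apply derivable_continuous_pt. eexists; apply D.
    - rewrite E, Rabs_mult. rewrite <- (Rmult_1_l (Rabs (s - t))) at 2.
      apply Rmult_le_compat_r; [apply Rabs_pos | apply B]. }
  apply Rmax_lub.
  - apply (MV cos (fun c => - sin c)); [exact derivable_pt_lim_cos|].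
    intros c. apply Rabs_le. assert (h := SIN_bound c). lra.
  - apply (MV sin cos); [exact derivable_pt_lim_sin|].
    intros c. apply Rabs_le. assert (h := COS_bound c). lra.
Qed.

Lemma uniformly_continuous_circle (f : C -> C) (r eps : R) :
  analytic_in_disc f -> 0 <= r < 1 -> 0 < eps ->
  exists delta, 0 < delta /\ forall t w, 0 <= t <= 2 * PI ->
    Cmod (w - RtoC r * expi t)%C < delta ->
    Cmod (f w - f (RtoC r * expi t))%C < eps.
Proof.
  intros Hf Hr He.
  (* The factor 3 covers two displacements: [expi] is Lipschitz with constant 2, so passing from [t]
     to the tag [t0] costs less than twice the gauge, and [w] is within one more gauge of the
     circle. *)
  assert (Hex : forall t, exists d : posreal, forall w,
     Cmod (w - RtoC r * expi t)%C < 3 * d -> Cmod (f w - f (RtoC r * expi t))%C < eps / 2).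
  { intros t. destruct (ex_derive_C_continuous f (RtoC r * expi t)%C) with (eps := eps / 2)
      as (d & Hd & H).
    - apply Hf, unit_disc_scal_expi. rewrite Rabs_pos_eq; lra.
    - lra.
    - assert (Hd3 : 0 < d / 3) by lra. exists (mkposreal _ Hd3). intros w Hw. apply H.
      simpl in Hw. lra. }
  set (gauge := fun t => proj1_sig (constructive_indefinite_description _ (Hex t))).
  assert (Hg : forall t w, Cmod (w - RtoC r * expi t)%C < 3 * gauge t ->
     Cmod (f w - f (RtoC r * expi t))%C < eps / 2).
  { intros t. unfold gauge. destruct constructive_indefinite_description as [d H]. exact H. }
  destruct (compactness_value_1d 0 (2 * PI) gauge) as [d Hd].
  exists d. split; [apply cond_pos|]. intros t w Ht Hw.
  destruct (NNPP _ (Hd t Ht)) as (t0 & _ & H1 & H2).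
  assert (B : Cmod (RtoC r * expi t - RtoC r * expi t0)%C < 2 * gauge t0).
  { replace (RtoC r * expi t - RtoC r * expi t0)%C with (RtoC r * (expi t - expi t0))%C by ring.
    rewrite Cmod_mult, Cmod_R, Rabs_pos_eq by lra.
    assert (h := Cmod_expi_minus t t0). assert (h' := Cmod_ge_0 (expi t - expi t0)%C). nra. }
  assert (B1 := Hg t0 (RtoC r * expi t)%C ltac:(assert (h := cond_pos (gauge t0)); lra)).
  assert (B2 : Cmod (f w - f (RtoC r * expi t0))%C < eps / 2).
  { apply Hg. replace (w - RtoC r * expi t0)%C with
      ((w - RtoC r * expi t) + (RtoC r * expi t - RtoC r * expi t0))%C by ring.
    eapply Rle_lt_trans; [apply Cmod_triangle|]. lra. }
  replace (f w - f (RtoC r * expi t))%C with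
    ((f w - f (RtoC r * expi t0)) + - (f (RtoC r * expi t) - f (RtoC r * expi t0)))%C by ring.
  eapply Rle_lt_trans; [apply Cmod_triangle|]. rewrite Cmod_opp. lra.
Qed.

Lemma continuity_pt_rpow_Rmax q eps x :
  0 < q -> continuity_pt (fun y => rpow (Rmax y eps) q) x.
Proof.
  intros Hq. apply (continuity_pt_comp (fun y => Rmax y eps) (fun y => rpow y q)).
  - apply (continuity_pt_ext (fun y => (y + eps + Rabs (y - eps)) / 2)).
    + intros y. unfold Rmax, Rabs. destruct Rle_dec, Rcase_abs; lra.
    + reg.
  - apply continuity_pt_rpow, Hq.
Qed.

(* Truncating [|f|] from below by [eps] keeps the radius of the local submean inequality
   bounded away from zero along a circle, even if [f] has zeros on it. *)
Lemma truncated_modulus_submean (f : C -> C) (q eps r : R) :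
  analytic_in_disc f -> 0 < q -> 0 < eps -> 0 <= r < 1 ->
  exists delta, 0 < delta /\
     forall rho t, 0 < rho < delta -> r + rho < 1 -> 0 <= t <= 2 * PI ->
       2 * PI * rpow (Rmax (Cmod (f (RtoC r * expi t)%C)) eps) q <=
       RInt (fun s => rpow (Rmax (Cmod (f (RtoC r * expi t + RtoC rho * expi s)%C)) eps) q)
         0 (2 * PI).
Proof.
  intros Hf Hq He Hr. assert (Hpi := PI_RGT_0).
  destruct (mean_value_ge f q Hq) as (e & He' & Hmv).
  (* Where [|f z| > eps], an oscillation below [e * eps] is below [e * |f z|], as [mean_value_ge]
     asks. At the other centres the left-hand side is the least value that the truncated integrand
     can take. *)
  destruct (uniformly_continuous_circle f r (e * eps) Hf Hr) as (d & Hd & Huc); [nra|].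
  exists d. split; [exact Hd|]. intros rho t Hrho Hr1 Ht.
  set (z := (RtoC r * expi t)%C).
  assert (Hdisc : forall w, Cmod (w - z)%C <= rho -> unit_disc w).
  { intros w Hw. unfold unit_disc. replace w with ((w - z) + z)%C by ring.
    eapply Rle_lt_trans; [apply Cmod_triangle|]. unfold z at 2.
    rewrite Cmod_scal_expi, Rabs_pos_eq; lra. }
  assert (Hcirc : forall s, Cmod (z + RtoC rho * expi s - z)%C <= rho).
  { intros s. replace (z + RtoC rho * expi s - z)%C with (RtoC rho * expi s)%C by ring.
    rewrite Cmod_scal_expi, Rabs_pos_eq; lra. }
  assert (I1 : ex_RInt (fun s => rpow (Rmax (Cmod (f (z + RtoC rho * expi s)%C)) eps) q) 0 (2 * PI)).
  { apply ex_RInt_cont. intros s.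
    apply (continuous_circle (fun z => rpow (Rmax (Cmod (f z)) eps) q)).
    apply (continuous_C_R_modulus f (fun y => rpow (Rmax y eps) q)); [|apply continuity_pt_rpow_Rmax, Hq].
    apply Hf, (Hdisc _ (Hcirc s)). }
  destruct (Rle_lt_dec (Cmod (f z)) eps) as [Hsm|Hlg].
  - rewrite Rmax_right by exact Hsm.
    assert (E : 2 * PI * rpow eps q = RInt (fun _ => rpow eps q) 0 (2 * PI))
      by (rewrite RInt_const_R; ring).
    rewrite E.
    apply RInt_le; [lra | apply ex_RInt_const | exact I1 |].
    intros s _. apply rpow_le; [exact Hq | apply Rmax_r].
  - rewrite Rmax_left by lra.
    eapply Rle_trans; [apply (Hmv z rho); [lra | lra |]|].
    + intros w Hw. split; [apply Hf, Hdisc, Hw|].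
      apply Rlt_le, Rlt_le_trans with (e * eps); [apply Huc; [exact Ht|]; fold z; lra | nra].
    + apply RInt_le; [lra | | exact I1 |].
      * apply ex_RInt_cont. intros s.
        apply (continuous_circle (fun z => rpow (Cmod (f z)) q)).
        apply (continuous_C_R_modulus f (fun x => rpow x q)).
        -- apply Hf, (Hdisc _ (Hcirc s)).
        -- apply continuity_pt_rpow, Hq.
      * intros s _. apply rpow_le; [exact Hq | apply Rmax_l].
Qed.

Lemma circle_mean_monotone (f : C -> C) (q r R' : R) :
  analytic_in_disc f -> 0 < q -> 0 <= r <= R' -> R' < 1 ->
  circle_mean q f r <= circle_mean q f R'.
Proof.
  intros Hf Hq Hr HR. assert (Hpi := PI_RGT_0).
  rewrite !circle_mean_integral by (assumption || (rewrite Rabs_pos_eq; lra)).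
  apply Rmult_le_compat_r; [apply Rlt_le, Rinv_0_lt_compat; lra|].
  apply le_epsilon. intros eta Heta.
  (* Truncation at [eps] raises the integrand by at most [eps^q], hence the circle integral by at
     most [2 PI eps^q = eta]. *)
  set (eps := rpow (eta / (2 * PI)) (/ q)).
  assert (Heta' : 0 < eta / (2 * PI)) by (apply Rdiv_lt_0_compat; lra).
  assert (He : 0 < eps) by (apply rpow_pos, Heta').
  assert (Heq : rpow eps q = eta / (2 * PI)).
  { unfold eps. rewrite rpow_rpow. replace (/ q * q) with 1 by (field; lra).
    apply rpow_1; lra. }
  set (u := fun z => rpow (Rmax (Cmod (f z)) eps) q).
  assert (Hu : forall z, unit_disc z -> continuous_C_R u z).
  { intros z Hz. apply (continuous_C_R_modulus f (fun y => rpow (Rmax y eps) q)); [|apply continuity_pt_rpow_Rmax, Hq].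
    apply Hf, Hz. }
  assert (Hp : forall z, unit_disc z -> continuous_C_R (fun z => rpow (Cmod (f z)) q) z).
  { intros z Hz. apply (continuous_C_R_modulus f (fun x => rpow x q)); [apply Hf, Hz|].
    apply continuity_pt_rpow, Hq. }
  assert (Hex : forall v s, (forall z, unit_disc z -> continuous_C_R v z) -> 0 <= s < 1 ->
     ex_RInt (fun t => v (RtoC s * expi t)%C) 0 (2 * PI)).
  { intros v s Hv Hs. apply ex_RInt_cont. intros t.
    apply continuous_circle0, Hv, unit_disc_scal_expi. rewrite Rabs_pos_eq; lra. }
  apply Rle_trans with (circle_integral u r).
  { apply RInt_le; [lra | apply (Hex (fun z => rpow (Cmod (f z)) q)); [assumption | lra]
                        | apply Hex; [assumption | lra] |].
    intros t _. apply rpow_le; [exact Hq | apply Rmax_l]. }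
  eapply Rle_trans.
  { apply (circle_integral_monotone_of_submean u r R' Hu); [|lra | exact HR].
    intros s Hs. apply truncated_modulus_submean; assumption. }
  assert (Eeta : eta = RInt (fun _ => rpow eps q) 0 (2 * PI))
    by (rewrite RInt_const_R, Heq; field; lra).
  rewrite Eeta.
  unfold circle_integral.
  rewrite <- (RInt_plus (V := R_CompleteNormedModule)).
  2:{ apply (Hex (fun z => rpow (Cmod (f z)) q)); [assumption | lra]. }
  2:{ apply ex_RInt_const. }
  apply RInt_le; [lra | apply Hex; [assumption | lra] | |].
  - apply (ex_RInt_plus (V := R_NormedModule)); [|apply ex_RInt_const].
    apply (Hex (fun z => rpow (Cmod (f z)) q)); [assumption | lra].
  - intros t _. unfold u, plus; simpl.
    assert (h1 := rpow_ge_0 eps q). assert (h2 := rpow_ge_0 (Cmod (f (RtoC R' * expi t)%C)) q).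
    unfold Rmax; destruct Rle_dec; lra.
Qed.

(** * Zeros of analytic functions *)

Lemma continuous_circle_modulus (f : C -> C) (q r t : R) :
  analytic_in_disc f -> 0 < q -> Rabs r < 1 ->
  continuous (fun t => rpow (Cmod (f (RtoC r * expi t)%C)) q) t.
Proof.
  intros Hf Hq Hr.
  apply (continuous_circle0 (fun z => rpow (Cmod (f z)) q)).
  apply (continuous_C_R_modulus f (fun x => rpow x q)).
  - apply Hf, unit_disc_scal_expi, Hr.
  - apply continuity_pt_rpow, Hq.
Qed.

Lemma circle_mean_0 (f : C -> C) (q : R) :
  analytic_in_disc f -> 0 < q -> circle_mean q f 0 = rpow (Cmod (f (RtoC 0))) q.
Proof.
  intros Hf Hq. assert (Hpi := PI_RGT_0).
  rewrite circle_mean_integral by (assumption || rewrite Rabs_R0; lra).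
  unfold circle_integral.
  rewrite (RInt_ext _ (fun _ => rpow (Cmod (f (RtoC 0))) q))
    by (intros; now rewrite Cmult_0_l).
  rewrite RInt_const_R. field. lra.
Qed.

(* Subharmonicity of [|f|^q] bounds [|f 0|^q] by [(1 - eta / (2 PI)) B^q]; let [q] tend to 0. *)
Lemma analytic_zero_arc (f : C -> C) (r eta : R) :
  analytic_in_disc f -> 0 <= r < 1 -> 0 < eta < 2 * PI ->
  (forall t, 0 <= t <= eta -> f (RtoC r * expi t)%C = RtoC 0) -> f (RtoC 0) = RtoC 0.
Proof.
  intros Hf Hr Heta Hz. assert (Hpi := PI_RGT_0).
  apply NNPP. intros H0.
  assert (Hm : 0 < Cmod (f (RtoC 0))) by (apply Cmod_gt_0; exact H0).
  assert (Hr' : Rabs r < 1) by (rewrite Rabs_pos_eq; lra).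
  destruct (continuity_ab_maj (fun t => rpow (Cmod (f (RtoC r * expi t)%C)) 1) 0 (2 * PI))
    as (tm & Hmax & _); [lra | |].
  { intros t _. apply continuity_pt_filterlim, continuous_circle_modulus; auto; lra. }
  set (B := rpow (Cmod (f (RtoC r * expi tm)%C)) 1 + 1).
  assert (HB : 0 < B).
  { unfold B. assert (h := rpow_ge_0 (Cmod (f (RtoC r * expi tm)%C)) 1). lra. }
  assert (HfB : forall t, 0 <= t <= 2 * PI -> Cmod (f (RtoC r * expi t)%C) <= B).
  { intros t Ht. specialize (Hmax t Ht). cbv beta in Hmax.
    rewrite (rpow_1 (Cmod (f (RtoC r * expi t)%C))) in Hmax by apply Cmod_ge_0.
    unfold B. lra. }
  clearbody B.
  assert (Hq : forall q, 0 < q ->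
     Rpower (Cmod (f (RtoC 0)) / B) q <= 1 - eta / (2 * PI)).
  { intros q Hq.
    assert (M := circle_mean_monotone f q 0 r Hf Hq ltac:(lra) ltac:(lra)).
    rewrite circle_mean_0, circle_mean_integral in M by assumption.
    unfold circle_integral in M.
    set (u := fun t => rpow (Cmod (f (RtoC r * expi t)%C)) q) in M.
    assert (Cu : forall t, continuous u t) by (intros; apply continuous_circle_modulus; auto).
    rewrite <- (RInt_Chasles_R u 0 eta (2 * PI)) in M by (apply ex_RInt_cont, Cu).
    assert (E1 : RInt u 0 eta = 0).
    { rewrite (RInt_ext _ (fun _ => 0)).
      - rewrite RInt_const_R. apply Rmult_0_r.
      - rewrite Rmin_left, Rmax_right by lra. intros t Ht. unfold u.
        rewrite Hz, Cmod_0, rpow_nonpos by lra. reflexivity. }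
    assert (E2 : RInt u eta (2 * PI) <= (2 * PI - eta) * rpow B q).
    { rewrite <- (RInt_const_R (rpow B q)).
      apply RInt_le; [lra | apply ex_RInt_cont, Cu | apply ex_RInt_const |].
      intros t Ht. apply rpow_le; [exact Hq | apply HfB; lra]. }
    assert (M' : rpow (Cmod (f (RtoC 0))) q <= (1 - eta / (2 * PI)) * rpow B q).
    { eapply Rle_trans; [exact M|]. rewrite E1, Rplus_0_l.
      apply (Rmult_le_reg_r (2 * PI)); [lra|].
      unfold Rdiv at 1. rewrite Rmult_assoc, Rinv_l, Rmult_1_r by lra.
      eapply Rle_trans; [exact E2|]. apply Req_le. field. lra. }
    rewrite !rpow_Rpower in M' by assumption.
    assert (PB : 0 < Rpower B q) by apply exp_pos.
    unfold Rdiv at 1. rewrite <- Rpower_mult_distr by (auto; apply Rinv_0_lt_compat, HB).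
    replace (Rpower (/ B) q) with (/ Rpower B q).
    - apply (Rmult_le_reg_r (Rpower B q)); [exact PB|].
      rewrite Rmult_assoc, Rinv_l, Rmult_1_r by lra. exact M'.
    - apply (Rmult_eq_reg_r (Rpower B q)); [|lra].
      rewrite Rinv_l by lra. rewrite Rpower_mult_distr by (auto; apply Rinv_0_lt_compat, HB).
      rewrite Rinv_l by lra. unfold Rpower. now rewrite ln_1, Rmult_0_r, exp_0. }
  set (x := Cmod (f (RtoC 0)) / B) in *.
  set (k := eta / (2 * PI)) in *.
  assert (Hk : 0 < k) by (apply Rdiv_lt_0_compat; lra).
  assert (Hl := Rabs_pos (ln x)).
  (* For this [q], [x^q >= 1 + q ln x >= 1 - k/2], which contradicts [x^q <= 1 - k]. *)
  set (q := k / (2 * (Rabs (ln x) + 1))).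
  assert (Hq0 : 0 < q) by (apply Rdiv_lt_0_compat; lra).
  specialize (Hq q Hq0). unfold Rpower in Hq.
  assert (E := exp_ineq1_le (q * ln x)).
  assert (Hlow : - Rabs (ln x) <= ln x) by (unfold Rabs; destruct Rcase_abs; lra).
  assert (Hqk : q * (Rabs (ln x) + 1) = k / 2) by (unfold q; field; lra).
  nra.
Qed.

(** If [f] vanished near [b], it would vanish on an arc of the circle about [a] through [b]. The
    affine map [z -> a + lam e^(i phi) z] with [lam = 1 - |a|] carries the unit disc into itself, 0
    to [a] and a positive radius to [b], so [analytic_zero_arc] would give [f a = 0]. The hypothesis
    on [a] and [b] says that this circle lies in the image. *)
Lemma analytic_nonzero_near (f : C -> C) (a b : C) (delta : R) :
  analytic_in_disc f -> f a <> RtoC 0 -> Cmod a + Cmod (b - a)%C < 1 -> 0 < delta ->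
  exists w, Cmod (w - b)%C < delta /\ unit_disc w /\ f w <> RtoC 0.
Proof.
  intros Hf Ha Hab Hd. apply NNPP. intros Hno. apply Ha.
  assert (Ga := Cmod_ge_0 a). assert (Gb := Cmod_ge_0 (b - a)%C). assert (Hpi := PI_RGT_0).
  destruct (polar_form (b - a)%C) as [phi Hphi].
  set (lam := 1 - Cmod a).
  assert (Hlam : 0 < lam) by (unfold lam; lra).
  set (g := fun z => f (a + RtoC lam * expi phi * z)%C).
  assert (Hdisc : forall z, unit_disc z -> unit_disc (a + RtoC lam * expi phi * z)%C).
  { intros z Hz. unfold unit_disc in *. eapply Rle_lt_trans; [apply Cmod_triangle|].
    rewrite Cmod_mult, Cmod_scal_expi, Rabs_pos_eq by lra. unfold lam in *. nra. }
  replace (f a) with (g (RtoC 0)) by (unfold g; f_equal; ring).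
  set (eta := Rmin 1 (delta / 4)).
  assert (H1 : eta <= 1) by apply Rmin_l. assert (H2 : eta <= delta / 4) by apply Rmin_r.
  assert (H0 : 0 < eta) by (apply Rmin_pos; lra).
  assert (Hpi2 : 2 < 2 * PI) by (assert (h := PI2_1); lra).
  apply (analytic_zero_arc g (Cmod (b - a)%C / lam) eta).
  - intros z Hz. apply (ex_derive_C_comp f (fun z => a + RtoC lam * expi phi * z)%C).
    + apply Hf, Hdisc, Hz.
    + apply ex_derive_C_plus; [apply ex_derive_C_const|].
      apply ex_derive_C_mult; [apply ex_derive_C_const | apply ex_derive_C_id].
  - split; [apply Rmult_le_pos; [lra | apply Rlt_le, Rinv_0_lt_compat, Hlam]|].
    apply (Rmult_lt_reg_r lam); [exact Hlam|]. unfold Rdiv.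
    rewrite Rmult_assoc, Rinv_l by lra. unfold lam. lra.
  - lra.
  - intros t Ht. unfold g.
    replace (a + RtoC lam * expi phi * (RtoC (Cmod (b - a)%C / lam) * expi t))%C
      with (a + (b - a) * expi t)%C.
    2:{ rewrite Hphi at 1. unfold Rdiv. rewrite RtoC_mult, RtoC_inv by lra. field.
        intros E. apply RtoC_inj in E. lra. }
    apply NNPP. intros Hne. apply Hno. exists (a + (b - a) * expi t)%C.
    split; [|split; [|exact Hne]].
    + replace (a + (b - a) * expi t - b)%C with ((b - a) * (expi t - expi 0))%C
        by (unfold expi at 2; rewrite cos_0, sin_0; change (1, 0) with (RtoC 1); ring).
      rewrite Cmod_mult. assert (h := Cmod_expi_minus t 0).
      rewrite Rminus_0_r, Rabs_pos_eq in h by lra.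
      assert (h' := Cmod_ge_0 (expi t - expi 0)%C). nra.
    + unfold unit_disc. eapply Rle_lt_trans; [apply Cmod_triangle|].
      rewrite Cmod_mult, Cmod_expi. lra.
Qed.

(** From a point [a] near the boundary [analytic_nonzero_near] reaches only a short way, so the
    points where [f] is nonzero are pushed inwards: a positive infimum [n] of their moduli would be
    undercut by a further step. The infimum is taken as the supremum of negated moduli. *)
Lemma analytic_nonzero_small_modulus (f : C -> C) (a : C) (eps : R) :
  analytic_in_disc f -> unit_disc a -> f a <> RtoC 0 -> 0 < eps ->
  exists w, Cmod w < eps /\ unit_disc w /\ f w <> RtoC 0.
Proof.
  intros Hf Hda Ha He. unfold unit_disc in Hda.
  destruct (completeness (fun x => exists w, x = - Cmod w /\ unit_disc w /\ f w <> RtoC 0))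
    as (m & Hub & Hlub).
  { exists 0. intros x (w & -> & _). assert (h := Cmod_ge_0 w). lra. }
  { exists (- Cmod a), a. auto. }
  assert (Hnear : forall d, 0 < d -> exists w, Cmod w < - m + d /\ unit_disc w /\ f w <> RtoC 0).
  { intros d Hd. apply NNPP. intros Hno.
    assert (m <= m - d); [|lra]. apply Hlub. intros x (w & -> & Hw & Hfw).
    apply Rnot_lt_le. intros Hlt. apply Hno. exists w. repeat split; auto. lra. }
  assert (Hm1 : - m < 1).
  { assert (- Cmod a <= m) by (apply Hub; exists a; auto). lra. }
  destruct (Rle_lt_dec (- m) 0) as [Hm|Hm].
  { destruct (Hnear eps He) as (w & Hw & H). exists w. split; [lra | exact H]. }
  exfalso. set (n := - m) in *.
  (* The step leads from [w], of modulus below [n + d], to the point of modulus [n - d] on the same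
     ray. [d <= n / 2] keeps that modulus positive, and [d <= (1 - n) / 4] gives
     [|w| + |s w - w| < n + 3 d < 1]. An error of [d / 2] still leaves the modulus below [n]. *)
  set (d := Rmin (n / 2) ((1 - n) / 4)).
  assert (D1 : d <= n / 2) by apply Rmin_l. assert (D2 : d <= (1 - n) / 4) by apply Rmin_r.
  assert (D0 : 0 < d) by (apply Rmin_pos; lra).
  destruct (Hnear d D0) as (w & Hw & Hdw & Hfw).
  assert (Hnw : n <= Cmod w) by (assert (- Cmod w <= m) by (apply Hub; exists w; auto); unfold n; lra).
  set (s := (n - d) / Cmod w).
  assert (Hs : s * Cmod w = n - d) by (unfold s; field; lra).
  assert (Hs0 : 0 < s) by (apply Rdiv_lt_0_compat; lra).
  assert (Hs1 : s < 1) by nra.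
  destruct (analytic_nonzero_near f w (RtoC s * w)%C (d / 2) Hf Hfw) as (v & Hv & Hdv & Hfv).
  { replace (RtoC s * w - w)%C with (RtoC (s - 1) * w)%C by (rewrite RtoC_minus; ring).
    rewrite Cmod_mult, Cmod_R, Rabs_left by lra. lra. }
  { lra. }
  assert (Hcv : Cmod v < n).
  { replace v with ((v - RtoC s * w) + RtoC s * w)%C by ring.
    eapply Rle_lt_trans; [apply Cmod_triangle|].
    rewrite (Cmod_mult (RtoC s)), Cmod_R, (Rabs_pos_eq s) by lra. lra. }
  assert (- Cmod v <= m) by (apply Hub; exists v; auto). unfold n in *. lra.
Qed.

(** [f] is nonzero on a neighbourhood of some [a]. If [g] is not identically zero, it is nonzero
    somewhere in that neighbourhood too, and the product is nonzero there. The point [c] near 0 is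
    an intermediate stop that ensures [|c| + |a - c| < 1]. *)
Lemma analytic_mult_eq_0 (f g : C -> C) :
  analytic_in_disc f -> analytic_in_disc g ->
  (forall z, unit_disc z -> (f z * g z)%C = RtoC 0) ->
  (forall z, unit_disc z -> f z = RtoC 0) \/ (forall z, unit_disc z -> g z = RtoC 0).
Proof.
  intros Hf Hg Hfg.
  destruct (classic (exists a, unit_disc a /\ f a <> RtoC 0)) as [(a & Hda & Ha)|Hno].
  2:{ left. intros z Hz. apply NNPP. intros H. apply Hno. now exists z. }
  right. intros b Hb. apply NNPP. intros Hgb.
  destruct (ex_derive_C_continuous f a (Hf a Hda) (Cmod (f a))) as (d & Hd & Hw).
  { apply Cmod_gt_0, Ha. }
  unfold unit_disc in Hda.
  destruct (analytic_nonzero_small_modulus g b ((1 - Cmod a) / 2) Hg Hb Hgb)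
    as (c & Hc & Hdc & Hgc); [lra|].
  destruct (analytic_nonzero_near g c a d Hg Hgc) as (w & Hwa & Hdw & Hgw).
  { assert (h := Cmod_triangle a (- c)%C). rewrite Cmod_opp in h.
    change (a + - c)%C with (a - c)%C in h. lra. }
  { exact Hd. }
  specialize (Hw w Hwa).
  assert (Hfw : f w <> RtoC 0).
  { intros E. rewrite E in Hw. replace (RtoC 0 - f a)%C with (- f a)%C in Hw by ring.
    rewrite Cmod_opp in Hw. lra. }
  apply (Cmult_neq_0 _ _ Hfw Hgw), Hfg, Hdw.
Qed.

(** * Pointwise inequalities *)

Lemma Rpower_le_neg (x y s : R) : s <= 0 -> 0 < y <= x -> Rpower x s <= Rpower y s.
Proof.
  intros Hs Hxy. unfold Rpower. assert (H : ln y <= ln x) by (apply ln_le; lra).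
  destruct (Req_dec (s * ln x) (s * ln y)) as [->|Hne]; [lra|].
  apply Rlt_le, exp_increasing. nra.
Qed.

(** Write [x^q = x * x^(q-1)] with [x^(q-1)] nonincreasing, and use [a + b >= a] for the first
    summand and [a + b >= 2 b] for the second. For [q < 1] the factor [2^(q-1)] is below 1, which
    quantifies strict subadditivity. *)
Lemma rpow_plus_le (q a b : R) :
  0 < q <= 1 -> 0 <= b <= a ->
  rpow (a + b) q <= rpow a q + Rpower 2 (q - 1) * rpow b q.
Proof.
  intros Hq [[Hb|<-] Hab].
  2:{ rewrite Rplus_0_r, (rpow_nonpos 0) by lra. lra. }
  assert (E : forall x, 0 < x -> Rpower x q = x * Rpower x (q - 1)).
  { intros x Hx. rewrite <- (Rpower_1 x) at 2 by exact Hx. rewrite <- Rpower_plus. f_equal; ring. }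
  rewrite !rpow_Rpower by lra. rewrite (E (a + b)), (E a), (E b) by lra.
  assert (H1 : Rpower (a + b) (q - 1) <= Rpower a (q - 1)) by (apply Rpower_le_neg; lra).
  assert (H2 : Rpower (a + b) (q - 1) <= Rpower 2 (q - 1) * Rpower b (q - 1)).
  { rewrite Rpower_mult_distr by lra. apply Rpower_le_neg; lra. }
  nra.
Qed.

Lemma Rpower_2_le_1 q : q <= 1 -> Rpower 2 (q - 1) <= 1.
Proof.
  intros Hq. rewrite <- (Rpower_O 2) at 2 by lra. apply Rle_Rpower; lra.
Qed.

Lemma rpow_subadditive (q a b : R) :
  0 < q <= 1 -> 0 <= a -> 0 <= b -> rpow (a + b) q <= rpow a q + rpow b q.
Proof.
  intros Hq Ha Hb. assert (H := Rpower_2_le_1 q ltac:(lra)).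
  assert (Pa := rpow_ge_0 a q). assert (Pb := rpow_ge_0 b q).
  destruct (Rle_lt_dec b a) as [h|h].
  - assert (E := rpow_plus_le q a b Hq ltac:(lra)). nra.
  - assert (E := rpow_plus_le q b a Hq ltac:(lra)). rewrite Rplus_comm. nra.
Qed.

Definition sum_moduli (q : R) (a : nat -> C) (n : nat) : R :=
  sum_n (fun j => rpow (Cmod (a j)) q) n.

Lemma sum_moduli_S q a n :
  sum_moduli q a (S n) = sum_moduli q a n + rpow (Cmod (a (S n))) q.
Proof. unfold sum_moduli. now rewrite sum_Sn. Qed.

Lemma sum_n_C_S (a : nat -> C) n : sum_n a (S n) = (sum_n a n + a (S n))%C.
Proof. now rewrite sum_Sn. Qed.

Lemma sum_moduli_ge (q : R) (a : nat -> C) (n j : nat) :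
  (j <= n)%nat -> rpow (Cmod (a j)) q <= sum_moduli q a n.
Proof.
  intros Hj. assert (P : forall m, 0 <= sum_moduli q a m).
  { intros m; induction m.
    - unfold sum_moduli. rewrite sum_O. apply rpow_ge_0.
    - rewrite sum_moduli_S. assert (h := rpow_ge_0 (Cmod (a (S m))) q). lra. }
  induction n.
  - replace j with O by lia. unfold sum_moduli. rewrite sum_O. lra.
  - rewrite sum_moduli_S. assert (h := rpow_ge_0 (Cmod (a (S n))) q). specialize (P n).
    destruct (Nat.eq_dec j (S n)) as [->|Hne]; [lra|]. specialize (IHn ltac:(lia)). lra.
Qed.

Lemma sum_subadditive (q : R) (a : nat -> C) (n : nat) :
  0 < q <= 1 -> rpow (Cmod (sum_n a n)) q <= sum_moduli q a n.
Proof.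
  intros Hq. induction n.
  - unfold sum_moduli. rewrite !sum_O. lra.
  - rewrite sum_n_C_S, sum_moduli_S.
    eapply Rle_trans; [apply rpow_le; [lra | apply Cmod_triangle]|].
    eapply Rle_trans; [apply rpow_subadditive; auto using Cmod_ge_0|]. lra.
Qed.

(** Only the addition of the first two terms, in the application [f(z)] and [f(wz)], is estimated
    with its gain; the later ones use plain subadditivity. *)
Lemma sum_subadditive_gap (q : R) (a : nat -> C) (n : nat) :
  0 < q <= 1 -> (1 <= n)%nat ->
  (1 - Rpower 2 (q - 1)) * rpow (Rmin (Cmod (a 0%nat)) (Cmod (a 1%nat))) q <=
    sum_moduli q a n - rpow (Cmod (sum_n a n)) q.
Proof.
  intros Hq Hn. induction n as [|n IH]; [lia|].
  destruct n as [|n].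
  - rewrite sum_n_C_S, sum_moduli_S. unfold sum_moduli. rewrite !sum_O.
    assert (T : rpow (Cmod (a 0%nat + a 1%nat)%C) q <= rpow (Cmod (a 0%nat) + Cmod (a 1%nat)) q)
      by (apply rpow_le; [lra | apply Cmod_triangle]).
    assert (P0 := Cmod_ge_0 (a 0%nat)). assert (P1 := Cmod_ge_0 (a 1%nat)).
    unfold Rmin; destruct Rle_dec as [h|h].
    + assert (E := rpow_plus_le q (Cmod (a 1%nat)) (Cmod (a 0%nat)) Hq ltac:(lra)).
      rewrite Rplus_comm in E. lra.
    + assert (E := rpow_plus_le q (Cmod (a 0%nat)) (Cmod (a 1%nat)) Hq ltac:(lra)). lra.
  - rewrite sum_n_C_S, sum_moduli_S. specialize (IH ltac:(lia)).
    assert (T : rpow (Cmod (sum_n a (S n) + a (S (S n)))%C) q <=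
       rpow (Cmod (sum_n a (S n))) q + rpow (Cmod (a (S (S n)))) q).
    { eapply Rle_trans; [apply rpow_le; [lra | apply Cmod_triangle]|].
      apply rpow_subadditive; auto using Cmod_ge_0. }
    lra.
Qed.

(* A lower bound for [|a|^q] minus its first-order expansion at [m]. *)
Definition convexity_defect (q : R) (a m : C) : R :=
  if Rle_dec 2 q then q / 2 * rpow (Cmod m) (q - 2) * Cmod (a - m)%C ^ 2
  else q * (q - 1) / 2 * rpow (Cmod a + Cmod m) (q - 2) * Cmod (a - m)%C ^ 2.

Lemma convexity_defect_ge_0 q a m : 1 < q -> 0 <= convexity_defect q a m.
Proof.
  intros Hq. unfold convexity_defect.
  destruct Rle_dec; apply Rmult_le_pos; try apply pow2_ge_0;
    apply Rmult_le_pos; try apply rpow_ge_0; nra.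
Qed.

Lemma Cmod_sqr (z : C) : Cmod z ^ 2 = fst z ^ 2 + snd z ^ 2.
Proof.
  unfold Cmod. rewrite pow2_sqrt; [reflexivity|].
  apply Rplus_le_le_0_compat; apply pow2_ge_0.
Qed.

Lemma Rpower_split x p q r : r = p + q -> Rpower x r = Rpower x p * Rpower x q.
Proof. intros ->. apply Rpower_plus. Qed.

Lemma Rpower_2_sqr x : 0 < x -> Rpower x 2 = x ^ 2.
Proof. intros Hx. replace 2 with (INR 2) by reflexivity. now rewrite Rpower_pow. Qed.

(** In the Taylor remainder [xi <= x + y], and [u^(q-2)] decreases since [q < 2]. At [x = 0] the
    claim reduces to [(q - 1) (1 - q/2) >= 0]. *)
Lemma Rpower_tangent_low (q x y : R) :
  1 < q < 2 -> 0 <= x -> 0 < y ->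
  rpow y q + q * Rpower y (q - 1) * (x - y) +
    q * (q - 1) / 2 * Rpower (x + y) (q - 2) * (x - y) ^ 2 <= rpow x q.
Proof.
  intros Hq [Hx|<-] Hy.
  - destruct (Rpower_taylor_2 q y x Hy Hx) as (xi & Hxi & E).
    rewrite !rpow_Rpower, E by assumption.
    assert (Hpos : 0 < xi <= x + y).
    { revert Hxi. unfold Rmin, Rmax; destruct Rle_dec; lra. }
    assert (H := Rpower_le_neg (x + y) xi (q - 2) ltac:(lra) Hpos).
    assert (h := pow2_ge_0 (x - y)). assert (0 <= q * (q - 1) / 2) by nra.
    assert (q * (q - 1) / 2 * Rpower (x + y) (q - 2) <= q * (q - 1) / 2 * Rpower xi (q - 2))
      by (apply Rmult_le_compat_l; assumption).
    apply Rplus_le_compat_l, Rmult_le_compat_r; assumption.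
  - rewrite (rpow_nonpos 0), rpow_Rpower, Rplus_0_l by lra.
    rewrite (Rpower_split y (q - 2) 2 q), (Rpower_split y (q - 2) 1 (q - 1)),
      Rpower_1, Rpower_2_sqr by (assumption || ring).
    assert (P : 0 < Rpower y (q - 2)) by apply exp_pos.
    assert (0 <= Rpower y (q - 2) * y ^ 2 * ((q - 1) * (1 - q / 2))); [|nra].
    apply Rmult_le_pos; [|nra]. apply Rmult_le_pos; [lra | apply pow2_ge_0].
Qed.

(** The tangent of the convex function [u^(q/2)] at [u = y^2], evaluated at [u = x^2]. Squares are
    used because [|a|^2 - |m|^2] is exactly a linear term in [a - m] plus [|a - m|^2]. *)
Lemma Rpower_tangent_high (q x y : R) :
  2 <= q -> 0 <= x -> 0 < y ->
  rpow y q + q / 2 * Rpower y (q - 2) * (x ^ 2 - y ^ 2) <= rpow x q.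
Proof.
  intros Hq [Hx|<-] Hy.
  - destruct (Rpower_taylor_2 (q / 2) (y ^ 2) (x ^ 2)) as (xi & Hxi & E);
      try (apply pow_lt; assumption).
    rewrite <- !Rpower_2_sqr in E by assumption. rewrite !Rpower_mult in E.
    replace (2 * (q / 2)) with q in E by field.
    replace (2 * (q / 2 - 1)) with (q - 2) in E by field.
    rewrite !Rpower_2_sqr in E by assumption.
    rewrite !rpow_Rpower, E by assumption.
    assert (0 <= q / 2 * (q / 2 - 1) / 2 * Rpower xi (q / 2 - 2) * (x ^ 2 - y ^ 2) ^ 2); [|lra].
    apply Rmult_le_pos; [|apply pow2_ge_0].
    apply Rmult_le_pos; [|apply Rlt_le, exp_pos]. nra.
  - rewrite (rpow_nonpos 0), rpow_Rpower by lra.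
    rewrite (Rpower_split y (q - 2) 2 q), Rpower_2_sqr by (assumption || ring).
    assert (P : 0 < Rpower y (q - 2)) by apply exp_pos.
    assert (0 <= Rpower y (q - 2) * y ^ 2 * (q / 2 - 1)); [|lra].
    apply Rmult_le_pos; [|lra]. apply Rmult_le_pos; [lra | apply pow2_ge_0].
Qed.

(** The middle term is the derivative of [|.|^q] at [m] in the direction [a - m]. It is linear in
    [a - m] and hence cancels in a sum over points with mean [m]. *)
Lemma Cmod_pow_tangent (q : R) (a m : C) :
  1 < q ->
  rpow (Cmod m) q + fst (RtoC (q * rpow (Cmod m) (q - 2)) * Cconj m * (a - m))%C +
    convexity_defect q a m <= rpow (Cmod a) q.
Proof.
  intros Hq. assert (Pa := Cmod_ge_0 a). assert (Pm := Cmod_ge_0 m).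
  set (re := fst a * fst m + snd a * snd m).
  assert (Efst : fst (RtoC (q * rpow (Cmod m) (q - 2)) * Cconj m * (a - m))%C =
     q * rpow (Cmod m) (q - 2) * (re - Cmod m ^ 2)).
  { rewrite Cmod_sqr. unfold re. simpl. ring. }
  assert (Edist : Cmod (a - m)%C ^ 2 = Cmod a ^ 2 + Cmod m ^ 2 - 2 * re).
  { rewrite !Cmod_sqr. unfold re. simpl. ring. }
  rewrite Efst. unfold convexity_defect. rewrite Edist.
  destruct Pm as [Pm|Pm].
  - destruct Rle_dec as [h|h].
    + assert (T := Rpower_tangent_high q (Cmod a) (Cmod m) h Pa Pm).
      rewrite (rpow_Rpower (Cmod m) (q - 2)) by exact Pm. lra.
    + assert (T := Rpower_tangent_low q (Cmod a) (Cmod m) ltac:(lra) Pa Pm).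
      rewrite (rpow_Rpower (Cmod m) (q - 2)), (rpow_Rpower (Cmod a + Cmod m)) by lra.
      assert (Hcs : re <= Cmod a * Cmod m).
      { assert (h' := Cmod_ge_0 (a - m)%C).
        assert (T1 := Cmod_diff a m).
        assert (T2 : (Cmod a - Cmod m) ^ 2 <= Cmod (a - m)%C ^ 2).
        { rewrite <- (pow2_abs (Cmod a - Cmod m)). apply pow_incr.
          split; [apply Rabs_pos | exact T1]. }
        rewrite Edist in T2. nra. }
      rewrite (Rpower_split (Cmod m) (q - 2) 1 (q - 1)), Rpower_1 in T by (assumption || ring).
      assert (Hle := Rpower_le_neg (Cmod a + Cmod m) (Cmod m) (q - 2) ltac:(lra) ltac:(lra)).
      assert (Pp : 0 < Rpower (Cmod a + Cmod m) (q - 2)) by apply exp_pos.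
      (* [re] is the real part of [conj m * a]. Replacing [(|a| - |m|)^2] by [|a - m|^2] costs
         [2 (|a||m| - re)] in the quadratic term, while replacing [|m| (|a| - |m|)] by [re - |m|^2]
         saves [|a||m| - re] in the linear term; since [q - 1 < 1], the saving pays for the cost. *)
      assert (K : q * (q - 1) / 2 * Rpower (Cmod a + Cmod m) (q - 2) * (2 * (Cmod a * Cmod m - re)) <=
                  q * Rpower (Cmod m) (q - 2) * (Cmod a * Cmod m - re)).
      { replace (q * (q - 1) / 2 * Rpower (Cmod a + Cmod m) (q - 2) * (2 * (Cmod a * Cmod m - re)))
          with (q * ((q - 1) * Rpower (Cmod a + Cmod m) (q - 2)) * (Cmod a * Cmod m - re)) by field.
        apply Rmult_le_compat_r; [lra|]. apply Rmult_le_compat_l; [lra|]. nra. }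
      nra.
  (* At [m = 0] all powers of [|m|] are 0 by the convention of [rpow], also for exponents
     [q - 2 <= 0]. The linear term disappears, and for [q < 2] the claim becomes
     [q (q - 1) / 2 <= 1]. *)
  - assert (Em : m = RtoC 0) by (apply Cmod_eq_0; now symmetry).
    rewrite <- Pm, (rpow_nonpos 0), (rpow_nonpos 0) by lra.
    assert (re0 : re = 0) by (unfold re; rewrite Em; simpl; ring).
    rewrite re0, Rplus_0_r. assert (h0 := rpow_ge_0 (Cmod a) q).
    destruct Rle_dec as [h|h]; [lra|].
    destruct Pa as [Pa|<-].
    + rewrite !rpow_Rpower by exact Pa.
      rewrite (Rpower_split (Cmod a) (q - 2) 2 q), Rpower_2_sqr by (assumption || ring).
      assert (P : 0 < Rpower (Cmod a) (q - 2)) by apply exp_pos.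
      assert (0 <= Rpower (Cmod a) (q - 2) * Cmod a ^ 2 * (1 - q * (q - 1) / 2)); [|lra].
      apply Rmult_le_pos; [|nra]. apply Rmult_le_pos; [lra | apply pow2_ge_0].
    + rewrite !(rpow_nonpos 0) by lra. lra.
Qed.

(** The first-order terms add up to zero because [m] is the mean, and of the defects only that of
    the first point is kept. The inductive claim [G] carries the first-order terms along. *)
Lemma sum_convexity_gap (q : R) (a : nat -> C) (m : C) (n : nat) :
  1 < q -> (RtoC (INR (S n)) * m)%C = sum_n a n ->
  INR (S n) * rpow (Cmod m) q + convexity_defect q (a 0%nat) m <= sum_moduli q a n.
Proof.
  intros Hq Hm.
  set (c := (RtoC (q * rpow (Cmod m) (q - 2)) * Cconj m)%C).
  assert (G : forall n, INR (S n) * rpow (Cmod m) q +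
     fst (c * (sum_n a n - RtoC (INR (S n)) * m))%C + convexity_defect q (a 0%nat) m <=
     sum_moduli q a n).
  { clear n Hm. intros n. induction n.
    - unfold sum_moduli. rewrite !sum_O. simpl INR. rewrite Rmult_1_l, Cmult_1_l.
      apply Cmod_pow_tangent, Hq.
    - rewrite sum_moduli_S, sum_n_C_S, (S_INR (S n)).
      assert (T := Cmod_pow_tangent q (a (S n)) m Hq). fold c in T.
      assert (D := convexity_defect_ge_0 q (a (S n)) m Hq).
      replace (c * (sum_n a n + a (S n) - RtoC (INR (S n) + 1) * m))%C with
        (c * (sum_n a n - RtoC (INR (S n)) * m) + c * (a (S n) - m))%C
        by (rewrite RtoC_plus; ring).
      assert (Efst : forall x y : C, fst (x + y)%C = fst x + fst y) by reflexivity.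
      rewrite Efst. lra. }
  specialize (G n). rewrite <- Hm in G.
  replace (c * (RtoC (INR (S n)) * m - RtoC (INR (S n)) * m))%C with (RtoC 0) in G by ring.
  simpl (fst (RtoC 0)) in G. lra.
Qed.

(** Young's inequality with a small coefficient, by comparing [x] with [t y] where [t^theta = eta].
    In the applications [y] is bounded by the sum of moduli and [x] by the defect, which may carry a
    large constant because its mean tends to zero. *)
Lemma rpow_interpolation (theta eta : R) :
  0 < theta < 1 -> 0 < eta -> exists K, 0 <= K /\ forall x y, 0 <= x -> 0 <= y ->
    rpow x theta * rpow y (1 - theta) <= eta * y + K * x.
Proof.
  intros Ht He. set (t := rpow eta (/ theta)).
  assert (Pt : 0 < t) by (apply rpow_pos, He).
  assert (Et : rpow t theta = eta).
  { unfold t. rewrite rpow_rpow. replace (/ theta * theta) with 1 by (field; lra). apply rpow_1; lra. }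
  assert (Pit : 0 < / t) by (apply Rinv_0_lt_compat, Pt).
  assert (one : forall z, 0 <= z -> rpow z theta * rpow z (1 - theta) = z).
  { intros z Hz. rewrite <- rpow_plus. replace (theta + (1 - theta)) with 1 by ring. apply rpow_1, Hz. }
  exists (rpow (/ t) (1 - theta)). split; [apply rpow_ge_0|].
  intros x y Hx Hy.
  assert (P1 := rpow_ge_0 x theta). assert (P2 := rpow_ge_0 y (1 - theta)).
  assert (P3 := rpow_ge_0 (/ t) (1 - theta)).
  destruct (Rle_lt_dec x (t * y)) as [h|h].
  - assert (B : rpow x theta <= eta * rpow y theta).
    { rewrite <- Et, <- rpow_mult by lra. apply rpow_le; lra. }
    apply Rle_trans with (eta * rpow y theta * rpow y (1 - theta)).
    + apply Rmult_le_compat_r; assumption.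
    + rewrite Rmult_assoc, one by assumption. nra.
  - assert (B : rpow y (1 - theta) <= rpow (/ t) (1 - theta) * rpow x (1 - theta)).
    { rewrite <- rpow_mult by lra. apply rpow_le; [lra|].
      apply (Rmult_le_reg_l t); [exact Pt|]. rewrite <- Rmult_assoc, Rinv_r by lra. lra. }
    apply Rle_trans with (rpow x theta * (rpow (/ t) (1 - theta) * rpow x (1 - theta))).
    + apply Rmult_le_compat_l; assumption.
    + rewrite (Rmult_comm (rpow (/ t) _)), <- Rmult_assoc, one by assumption. nra.
Qed.

(** * Limits of means and the Wiener transform *)

Definition mean_limit (q : R) (f : C -> C) (l : R) : Prop :=
  filterlim (circle_mean q f) (at_left 1) (locally l).

Lemma at_left_1_interval (r : R) : r < 1 -> at_left 1 (fun s => r < s < 1).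
Proof.
  intros Hr. exists (mkposreal (1 - r) ltac:(lra)). intros s Hs Hs1.
  unfold ball in Hs; simpl in Hs. unfold AbsRing_ball, abs, minus, plus, opp in Hs; simpl in Hs.
  apply Rabs_def2 in Hs. lra.
Qed.

Lemma at_left_1_ex (P : R -> Prop) (r : R) :
  r < 1 -> at_left 1 P -> exists s, r < s < 1 /\ P s.
Proof.
  intros Hr H. apply (filter_ex (F := at_left 1)).
  exact (filter_and _ _ (at_left_1_interval r Hr) H).
Qed.

Lemma mean_limit_eps q f l :
  mean_limit q f l <-> forall eps, 0 < eps ->
    at_left 1 (fun r => Rabs (circle_mean q f r - l) < eps).
Proof.
  split.
  - intros H eps He. apply (H (fun y => Rabs (y - l) < eps)).
    exists (mkposreal eps He). intros y Hy. exact Hy.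
  - intros H. apply filterlim_locally. intros eps. exact (H eps (cond_pos eps)).
Qed.

Lemma mean_limit_ge q f l r :
  analytic_in_disc f -> 0 < q -> mean_limit q f l -> 0 <= r < 1 -> circle_mean q f r <= l.
Proof.
  intros Hf Hq Hl Hr. apply le_epsilon. intros eps He.
  destruct (at_left_1_ex _ r (proj2 Hr) (proj1 (mean_limit_eps q f l) Hl eps He))
    as (s & H2 & H1).
  assert (M := circle_mean_monotone f q r s Hf Hq ltac:(lra) ltac:(lra)).
  apply Rabs_def2 in H1. lra.
Qed.

Lemma mean_limit_le q f l B :
  mean_limit q f l -> at_left 1 (fun r => circle_mean q f r <= B) -> l <= B.
Proof.
  intros Hl HB. apply le_epsilon. intros eps He.
  destruct (at_left_1_ex _ 0 Rlt_0_1
    (filter_and _ _ (proj1 (mean_limit_eps q f l) Hl eps He) HB)) as (s & _ & H1 & H2).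
  apply Rabs_def2 in H1. lra.
Qed.

Lemma mean_limit_ex q f B :
  analytic_in_disc f -> 0 < q -> (forall r, 0 <= r < 1 -> circle_mean q f r <= B) ->
  exists l, mean_limit q f l.
Proof.
  intros Hf Hq HB.
  destruct (completeness (fun y => exists r, 0 <= r < 1 /\ y = circle_mean q f r))
    as (l & Hub & Hlub).
  - exists B. intros y (r & Hr & ->). apply HB, Hr.
  - exists (circle_mean q f 0), 0. split; [lra | reflexivity].
  - exists l. apply mean_limit_eps. intros eps He.
    assert (Hex : exists r, 0 <= r < 1 /\ l - eps < circle_mean q f r).
    { apply NNPP. intros Hno. assert (l <= l - eps); [|lra].
      apply Hlub. intros y (r & Hr & ->). apply Rnot_lt_le. intros Hlt.
      apply Hno. now exists r. }
    destruct Hex as (r & Hr & Hlt).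
    generalize (at_left_1_interval r ltac:(lra)). apply filter_imp. intros s Hs.
    assert (M := circle_mean_monotone f q r s Hf Hq ltac:(lra) ltac:(lra)).
    assert (U : circle_mean q f s <= l) by (apply Hub; exists s; split; [lra | reflexivity]).
    apply Rabs_def1; lra.
Qed.

Lemma mean_limit_unique q f l l' : mean_limit q f l -> mean_limit q f l' -> l = l'.
Proof. apply (filterlim_locally_unique (K := R_AbsRing) (V := R_NormedModule)). Qed.

Lemma Hp_norm_mean_limit q f l : mean_limit q f l -> Hp_norm (Finite q) f = rpow l (/ q).
Proof.
  intros H. simpl. f_equal.
  apply (mean_limit_unique q f); [|exact H].
  apply (iota_correct (V := R_CompleteNormedModule) (fun l => mean_limit q f l)).
  exists l. split; [exact H|]. intros l' H'. apply (mean_limit_unique q f l l' H H').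
Qed.

Lemma circle_mean_ext q f g r :
  0 <= r < 1 -> (forall z, unit_disc z -> f z = g z) -> circle_mean q f r = circle_mean q g r.
Proof.
  intros Hr H. apply RInt_ext. intros t _. rewrite H; [reflexivity|].
  apply unit_disc_scal_expi. rewrite Rabs_pos_eq; lra.
Qed.

Lemma mean_limit_ext q f g l :
  (forall z, unit_disc z -> f z = g z) -> mean_limit q f l -> mean_limit q g l.
Proof.
  intros H. apply filterlim_ext_loc.
  generalize (at_left_1_interval 0 Rlt_0_1). apply filter_imp. intros r Hr.
  apply circle_mean_ext; [lra | exact H].
Qed.

Lemma circle_mean_ge_0 q f r :
  analytic_in_disc f -> 0 < q -> 0 <= r < 1 -> 0 <= circle_mean q f r.
Proof.
  intros Hf Hq Hr. eapply Rle_trans; [|apply (circle_mean_monotone f q 0 r); auto; lra].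
  rewrite circle_mean_0 by assumption. apply rpow_ge_0.
Qed.

Lemma mean_limit_ge_0 q f l :
  analytic_in_disc f -> 0 < q -> mean_limit q f l -> 0 <= l.
Proof.
  intros Hf Hq Hl. eapply Rle_trans; [apply (circle_mean_ge_0 q f 0 Hf Hq); lra|].
  apply (mean_limit_ge q f l 0 Hf Hq Hl); lra.
Qed.

(** For a circle the left endpoint suffices: [circle_mean_eq_0] turns the given point to parameter
    0. *)
Lemma RInt_nonneg_eq_0 (g : R -> R) (a b : R) :
  a < b -> (forall t, continuous g t) -> (forall t, 0 <= g t) -> RInt g a b <= 0 -> g a = 0.
Proof.
  intros Hab Hc Hg HI.
  destruct (Hg a) as [Ha|Ha]; [exfalso|now symmetry].
  assert (C := proj2 (continuity_pt_filterlim g a) (Hc a)).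
  destruct (C (g a / 2)) as (d & Hd & H); [lra|].
  set (c := Rmin b (a + d / 2)).
  assert (Hc1 : c <= b) by apply Rmin_l. assert (Hc2 : c <= a + d / 2) by apply Rmin_r.
  assert (Hc0 : a < c) by (apply Rmin_glb_lt; lra).
  rewrite <- (RInt_Chasles_R g a c b) in HI by (apply ex_RInt_cont, Hc).
  assert (P1 : 0 <= RInt g c b)
    by (apply RInt_ge_0; [lra | apply ex_RInt_cont, Hc | intros; apply Hg]).
  assert (P2 : 0 < RInt g a c).
  { apply RInt_gt_0; [lra | | intros; apply Hc]. intros x Hx.
    assert (Hd' : Rabs (g x - g a) < g a / 2).
    { apply (H x). split; [split; [exact I | lra]|].
      unfold dist; simpl; unfold Rdist. apply Rabs_def1; lra. }
    apply Rabs_def2 in Hd'. lra. }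
  lra.
Qed.

Lemma circle_mean_eq_0 (f : C -> C) (q : R) :
  analytic_in_disc f -> 0 < q -> (forall r, 0 <= r < 1 -> circle_mean q f r <= 0) ->
  forall z, unit_disc z -> f z = RtoC 0.
Proof.
  intros Hf Hq H z Hz. assert (Hpi := PI_RGT_0).
  destruct (polar_form z) as [phi Hphi].
  assert (Hr : 0 <= Cmod z < 1) by (split; [apply Cmod_ge_0 | exact Hz]).
  assert (Hr' : Rabs (Cmod z) < 1) by (rewrite Rabs_pos_eq; lra).
  specialize (H (Cmod z) Hr). rewrite circle_mean_integral in H by assumption.
  set (g := fun t => rpow (Cmod (f (RtoC (Cmod z) * expi t)%C)) q).
  assert (Cg : forall t, continuous g t) by (intros; apply continuous_circle_modulus; assumption).
  apply Cmod_eq_0. apply (rpow_eq_0 _ q); [apply Cmod_ge_0|].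
  transitivity (g (0 + phi)); [unfold g; now rewrite Rplus_0_l, <- Hphi|].
  apply (RInt_nonneg_eq_0 (fun t => g (t + phi)) 0 (2 * PI)); [lra | | intros; apply rpow_ge_0 |].
  - intros t. apply (continuous_comp (fun t => t + phi) g); [|apply Cg].
    apply (ex_derive_continuous (V := R_NormedModule)). auto_derive; exact I.
  - rewrite (RInt_periodic g phi (2 * PI) Cg).
    2:{ intros t. unfold g. now rewrite expi_period. }
    apply (Rmult_le_reg_r (/ (2 * PI))); [apply Rinv_0_lt_compat; lra|].
    rewrite Rmult_0_l. exact H.
Qed.

(** * Rotations and integration of pointwise bounds for the Wiener transform *)

Lemma Cpow_expi a j : Cpow (expi a) j = expi (INR j * a).
Proof.
  induction j.
  - simpl. unfold expi. now rewrite Rmult_0_l, cos_0, sin_0.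
  - rewrite Cpow_S, IHj, <- expi_plus, S_INR. f_equal; ring.
Qed.

Lemma Cpow_root_of_unity k j :
  Cpow (root_of_unity k) j = expi (INR j * (2 * PI / INR k)).
Proof. apply Cpow_expi. Qed.

Lemma unit_disc_rotate a z : unit_disc z -> unit_disc (expi a * z)%C.
Proof. unfold unit_disc. now rewrite Cmod_mult, Cmod_expi, Rmult_1_l. Qed.

Lemma analytic_rotate f a : analytic_in_disc f -> analytic_in_disc (fun z => f (expi a * z)%C).
Proof.
  intros Hf z Hz. apply (ex_derive_C_comp f (fun z => expi a * z)%C).
  - apply Hf, unit_disc_rotate, Hz.
  - apply ex_derive_C_mult; [apply ex_derive_C_const | apply ex_derive_C_id].
Qed.

Lemma circle_integral_rotated (f : C -> C) (q a r : R) :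
  analytic_in_disc f -> 0 < q -> Rabs r < 1 ->
  circle_integral (fun z => rpow (Cmod (f (expi a * z)%C)) q) r =
  circle_integral (fun z => rpow (Cmod (f z)) q) r.
Proof.
  intros Hf Hq Hr. unfold circle_integral.
  rewrite <- (RInt_periodic (fun t => rpow (Cmod (f (RtoC r * expi t)%C)) q) a).
  - apply RInt_ext. intros t _. rewrite expi_plus. do 3 f_equal. ring.
  - intros t. apply continuous_circle_modulus; assumption.
  - intros t. now rewrite expi_period.
Qed.

Definition rotates (k : nat) (f : C -> C) (z : C) (j : nat) : C :=
  f (Cpow (root_of_unity k) j * z)%C.

Lemma analytic_rotates k f j : analytic_in_disc f -> analytic_in_disc (fun z => rotates k f z j).
Proof.
  intros Hf. unfold rotates. rewrite Cpow_root_of_unity. apply analytic_rotate, Hf.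
Qed.

Lemma rotates_0 k f z : rotates k f z 0 = f z.
Proof. unfold rotates. simpl Cpow. now rewrite Cmult_1_l. Qed.

Lemma wiener_rotates k f z :
  wiener k f z = (/ RtoC (INR k) * sum_n (rotates k f z) (k - 1))%C.
Proof. reflexivity. Qed.

Lemma analytic_wiener k f : analytic_in_disc f -> analytic_in_disc (wiener k f).
Proof.
  intros Hf z Hz. apply ex_derive_C_mult; [apply ex_derive_C_const|].
  generalize (k - 1)%nat. intros n. induction n.
  - apply (ex_derive_ext (K := C_AbsRing) (V := C_NormedModule) (fun z => rotates k f z 0)).
    + intros w. now rewrite sum_O.
    + apply analytic_rotates; assumption.
  - apply (ex_derive_ext (K := C_AbsRing) (V := C_NormedModule)
      (fun z => sum_n (rotates k f z) n + rotates k f z (S n))%C).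
    + intros w. now rewrite sum_n_C_S.
    + apply ex_derive_C_plus; [exact IHn | apply analytic_rotates; assumption].
Qed.

Lemma is_RInt_sum_moduli k f q r n :
  analytic_in_disc f -> 0 < q -> Rabs r < 1 ->
  is_RInt (fun t => sum_moduli q (rotates k f (RtoC r * expi t)%C) n) 0 (2 * PI)
    (INR (S n) * circle_integral (fun z => rpow (Cmod (f z)) q) r).
Proof.
  intros Hf Hq Hr.
  assert (H : forall j, is_RInt (fun t => rpow (Cmod (rotates k f (RtoC r * expi t)%C j)) q)
     0 (2 * PI) (circle_integral (fun z => rpow (Cmod (f z)) q) r)).
  { intros j. unfold rotates. rewrite Cpow_root_of_unity.
    rewrite <- (circle_integral_rotated f q (INR j * (2 * PI / INR k)) r Hf Hq Hr).
    apply (RInt_correct (V := R_CompleteNormedModule)), ex_RInt_cont. intros t.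
    apply (continuous_circle_modulus (fun z => f (expi (INR j * (2 * PI / INR k)) * z)%C));
      [apply analytic_rotate | |]; assumption. }
  induction n.
  - simpl INR. rewrite Rmult_1_l. eapply is_RInt_ext; [|apply (H O)].
    intros t _. unfold sum_moduli. now rewrite sum_O.
  - rewrite S_INR, Rmult_plus_distr_r, Rmult_1_l.
    eapply is_RInt_ext; [|apply (is_RInt_plus (V := R_NormedModule)); [exact IHn | apply (H (S n))]].
    intros t _. now rewrite sum_moduli_S.
Qed.

(** All rotations of [f] have the same mean, so the sum of moduli contributes [k] times the mean of
    [f]. Free signs of [A] and [B] let this serve for the inequality ([h = W_k f], [B = 0]), for the
    equality case, and with [h = 0], [A = -1] as a lower bound for the mean of [W_k f] in the proof
    of sharpness. *)
Lemma circle_mean_le_wiener k f h q s A B D r :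
  (2 <= k)%nat -> analytic_in_disc f -> analytic_in_disc h -> 0 < q -> 0 < s -> 0 <= r < 1 ->
  (forall z, unit_disc z ->
     rpow (Cmod (h z)) s <=
       A * sum_moduli q (rotates k f z) (k - 1) - B * rpow (Cmod (wiener k f z)) q + D) ->
  circle_mean s h r <=
    A * (INR k * circle_mean q f r) - B * circle_mean q (wiener k f) r + D.
Proof.
  intros Hk Hf Hh Hq Hs Hr H. assert (Hpi := PI_RGT_0).
  assert (Hr' : Rabs r < 1) by (rewrite Rabs_pos_eq; lra).
  assert (HW := analytic_wiener k f Hf).
  rewrite !circle_mean_integral by assumption.
  assert (I1 := is_RInt_sum_moduli k f q r (k - 1) Hf Hq Hr').
  replace (S (k - 1)) with k in I1 by lia.
  assert (I2 : is_RInt (fun t => rpow (Cmod (wiener k f (RtoC r * expi t)%C)) q) 0 (2 * PI)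
     (circle_integral (fun z => rpow (Cmod (wiener k f z)) q) r)).
  { apply (RInt_correct (V := R_CompleteNormedModule)), ex_RInt_cont. intros t.
    apply continuous_circle_modulus; assumption. }
  set (IF := circle_integral (fun z => rpow (Cmod (f z)) q) r) in *.
  set (IW := circle_integral (fun z => rpow (Cmod (wiener k f z)) q) r) in *.
  assert (I3 : is_RInt (fun t => A * sum_moduli q (rotates k f (RtoC r * expi t)%C) (k - 1) -
     B * rpow (Cmod (wiener k f (RtoC r * expi t)%C)) q + D) 0 (2 * PI)
     (A * (INR k * IF) - B * IW + (2 * PI - 0) * D)).
  { apply (is_RInt_plus (V := R_NormedModule));
      [|apply (is_RInt_const (V := R_NormedModule))].
    apply (is_RInt_minus (V := R_NormedModule));
      apply (is_RInt_scal (V := R_NormedModule)); assumption. }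
  replace (A * (INR k * (IF / (2 * PI))) - B * (IW / (2 * PI)) + D)
    with ((A * (INR k * IF) - B * IW + (2 * PI - 0) * D) / (2 * PI)) by (field; lra).
  apply Rmult_le_compat_r; [apply Rlt_le, Rinv_0_lt_compat; lra|].
  rewrite <- (is_RInt_unique _ _ _ _ I3).
  apply RInt_le; [lra | | eexists; exact I3 |].
  - apply ex_RInt_cont. intros t. apply continuous_circle_modulus; assumption.
  - intros t _. apply H, unit_disc_scal_expi, Hr'.
Qed.

(* In the limit [r -> 1] the second term on the right-hand side of the pointwise bound has
   mean zero, so the means of [|h|^s], which increase with [r], are all at most [k * l * eta]. *)
Lemma extremal_vanish k f h q s g l l' :
  (2 <= k)%nat -> analytic_in_disc f -> analytic_in_disc h -> 0 < q -> 0 < s ->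
  mean_limit q f l -> mean_limit q (wiener k f) l' -> l' = INR k * g * l ->
  (forall eta, 0 < eta -> exists K, 0 <= K /\ forall z, unit_disc z ->
     rpow (Cmod (h z)) s <= eta * sum_moduli q (rotates k f z) (k - 1) +
       K * (g * sum_moduli q (rotates k f z) (k - 1) - rpow (Cmod (wiener k f z)) q)) ->
  forall z, unit_disc z -> h z = RtoC 0.
Proof.
  intros Hk Hf Hh Hq Hs Hl Hl' E H.
  assert (HW := analytic_wiener k f Hf).
  assert (Hl0 := mean_limit_ge_0 q f l Hf Hq Hl).
  assert (Hk0 : 0 < INR k) by (apply lt_0_INR; lia).
  apply (circle_mean_eq_0 h s Hh Hs). intros r Hr.
  assert (Hle : forall eta, 0 < eta -> circle_mean s h r <= eta * (INR k * l)).
  { intros eta Heta. destruct (H eta Heta) as (K & HK & Hpt).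
    apply le_epsilon. intros eps He.
    (* [c] exceeds the sum of the coefficients with which the errors of the two means enter. By [E]
       the limits themselves combine to [(eta + K g) k l - K l' = eta k l]. *)
    set (c := Rabs ((eta + K * g) * INR k) + K + 1).
    assert (Hc : 0 < c) by (unfold c; assert (h0 := Rabs_pos ((eta + K * g) * INR k)); lra).
    assert (He' : 0 < eps / c) by (apply Rdiv_lt_0_compat; assumption).
    destruct (at_left_1_ex _ r (proj2 Hr)
      (filter_and _ _ (proj1 (mean_limit_eps _ _ _) Hl _ He')
                      (proj1 (mean_limit_eps _ _ _) Hl' _ He'))) as (s0 & Hs0 & H1 & H2).
    assert (M := circle_mean_monotone h s r s0 Hh Hs ltac:(lra) ltac:(lra)).
    assert (B := circle_mean_le_wiener k f h q s (eta + K * g) K 0 s0 Hk Hf Hh Hq Hs ltac:(lra)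
      ltac:(intros z Hz; specialize (Hpt z Hz); lra)).
    assert (T1 : (eta + K * g) * INR k * (circle_mean q f s0 - l) <=
                 Rabs ((eta + K * g) * INR k) * (eps / c)).
    { eapply Rle_trans; [apply Rle_abs|]. rewrite Rabs_mult.
      apply Rmult_le_compat_l; [apply Rabs_pos | lra]. }
    assert (T2 : K * (l' - circle_mean q (wiener k f) s0) <= K * (eps / c)).
    { apply Rmult_le_compat_l; [assumption|]. apply Rabs_def2 in H2. lra. }
    assert (T3 : (Rabs ((eta + K * g) * INR k) + K) * (eps / c) <= eps).
    { apply Rle_trans with (c * (eps / c)).
      - apply Rmult_le_compat_r; [lra|]. unfold c. lra.
      - apply Req_le. field. lra. }
    rewrite E in T2. nra. }
  apply le_epsilon. intros eps He. rewrite Rplus_0_l.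
  assert (Hkl : 0 <= INR k * l) by (apply Rmult_le_pos; lra).
  assert (He' : 0 < eps / (INR k * l + 1)) by (apply Rdiv_lt_0_compat; lra).
  eapply Rle_trans; [apply (Hle _ He')|].
  apply Rle_trans with (eps / (INR k * l + 1) * (INR k * l + 1)).
  - apply Rmult_le_compat_l; lra.
  - apply Req_le. field. lra.
Qed.

(** * The inequality and its extremal functions *)

(** The factor [g] in [|W_k f|^q <= g * sum |f(w^j z)|^q]: for [q <= 1] it comes from the [1/k] in
    [W_k] and subadditivity, for [q > 1] from Jensen's inequality. [k g] is the [q]-th power of
    [wiener_const]. *)
Definition pointwise_gain (k : nat) (q : R) : R :=
  if Rle_dec q 1 then Rpower (INR k) (- q) else / INR k.

Lemma wiener_scal k f z :
  (2 <= k)%nat -> (RtoC (INR k) * wiener k f z)%C = sum_n (rotates k f z) (k - 1).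
Proof.
  intros Hk. rewrite wiener_rotates, Cmult_assoc, Cinv_r, Cmult_1_l; [reflexivity|].
  intros E. apply RtoC_inj in E. assert (0 < INR k) by (apply lt_0_INR; lia). lra.
Qed.

Lemma rpow_sum_rotates k f z q :
  (2 <= k)%nat ->
  rpow (Cmod (sum_n (rotates k f z) (k - 1))) q =
    Rpower (INR k) q * rpow (Cmod (wiener k f z)) q.
Proof.
  intros Hk. assert (H : 0 < INR k) by (apply lt_0_INR; lia).
  rewrite <- wiener_scal, Cmod_mult, Cmod_R, Rabs_pos_eq by (assumption || lra).
  rewrite rpow_mult, (rpow_Rpower (INR k)) by (apply Cmod_ge_0 || lra). reflexivity.
Qed.

Lemma wiener_pointwise k f q z :
  (2 <= k)%nat -> 0 < q ->
  rpow (Cmod (wiener k f z)) q <=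
    pointwise_gain k q * sum_moduli q (rotates k f z) (k - 1).
Proof.
  intros Hk Hq. assert (H : 0 < INR k) by (apply lt_0_INR; lia).
  unfold pointwise_gain. destruct Rle_dec as [h|h].
  - assert (G := sum_subadditive q (rotates k f z) (k - 1) ltac:(lra)).
    rewrite rpow_sum_rotates in G by assumption.
    rewrite Rpower_Ropp. assert (P : 0 < Rpower (INR k) q) by apply exp_pos.
    apply (Rmult_le_reg_l (Rpower (INR k) q)); [exact P|].
    rewrite <- Rmult_assoc, Rinv_r, Rmult_1_l by lra. exact G.
  - assert (G := sum_convexity_gap q (rotates k f z) (wiener k f z) (k - 1) ltac:(lra)).
    replace (S (k - 1)) with k in G by lia. specialize (G (wiener_scal k f z Hk)).
    assert (D := convexity_defect_ge_0 q (rotates k f z 0) (wiener k f z) ltac:(lra)).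
    apply (Rmult_le_reg_l (INR k)); [exact H|].
    rewrite <- Rmult_assoc, Rinv_r, Rmult_1_l by lra. lra.
Qed.

Lemma wiener_const_gain k q :
  (2 <= k)%nat -> 0 < q ->
  wiener_const k (Finite q) = rpow (INR k * pointwise_gain k q) (/ q).
Proof.
  intros Hk Hq. assert (H : 2 <= INR k) by (apply (le_INR 2); exact Hk).
  assert (Hiq : 0 < / q) by (apply Rinv_0_lt_compat, Hq).
  unfold wiener_const, pointwise_gain. simpl.
  replace (INR k) with (Rpower (INR k) 1) at 2 by (apply Rpower_1; lra).
  destruct Rle_dec as [h|h].
  - rewrite <- Rpower_plus, rpow_Rpower, Rpower_mult by apply exp_pos.
    replace ((1 + - q) * / q) with (/ q - 1) by (field; lra).
    apply Rmax_left. apply Rle_trans with (Rpower (INR k) 0); [rewrite Rpower_O; lra|].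
    apply Rle_Rpower; [lra|].
    assert (/ 1 <= / q) by (apply Rinv_le_contravar; lra). lra.
  - rewrite Rpower_1, Rinv_r, rpow_one by lra.
    apply Rmax_right. apply Rle_trans with (Rpower (INR k) 0); [|rewrite Rpower_O; lra].
    apply Rle_Rpower; [lra|].
    assert (/ q <= / 1) by (apply Rinv_le_contravar; lra). lra.
Qed.

Lemma pointwise_gain_pos k q : (2 <= k)%nat -> 0 < pointwise_gain k q.
Proof.
  intros Hk. assert (H : 0 < INR k) by (apply lt_0_INR; lia). unfold pointwise_gain.
  destruct Rle_dec; [apply exp_pos | apply Rinv_0_lt_compat, H].
Qed.

Lemma wiener_mean_limit k f q l :
  (2 <= k)%nat -> 0 < q -> analytic_in_disc f -> mean_limit q f l ->
  exists l', mean_limit q (wiener k f) l' /\ 0 <= l' <= INR k * pointwise_gain k q * l.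
Proof.
  intros Hk Hq Hf Hl. assert (HW := analytic_wiener k f Hf).
  assert (H : 0 < INR k) by (apply lt_0_INR; lia).
  assert (Hg := pointwise_gain_pos k q Hk).
  assert (B : forall r, 0 <= r < 1 ->
     circle_mean q (wiener k f) r <= INR k * pointwise_gain k q * l).
  { intros r Hr.
    assert (M := circle_mean_le_wiener k f (wiener k f) q q (pointwise_gain k q) 0 0 r
      Hk Hf HW Hq Hq Hr
      ltac:(intros z _; assert (P := wiener_pointwise k f q z Hk Hq); lra)).
    assert (L := mean_limit_ge q f l r Hf Hq Hl Hr).
    assert (0 < INR k * pointwise_gain k q) by (apply Rmult_lt_0_compat; assumption).
    nra. }
  destruct (mean_limit_ex q (wiener k f) _ HW Hq B) as [l' Hl'].
  exists l'. split; [exact Hl'|]. split; [exact (mean_limit_ge_0 q _ l' HW Hq Hl')|].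
  apply (mean_limit_le q _ l' _ Hl').
  generalize (at_left_1_interval 0 Rlt_0_1). apply filter_imp. intros r Hr. apply B; lra.
Qed.

(** * Cases of equality *)

Lemma rpow_inv_inj q x y : 0 < q -> 0 <= x -> 0 <= y -> rpow x (/ q) = rpow y (/ q) -> x = y.
Proof.
  intros Hq Hx Hy E. apply (f_equal (fun v => rpow v q)) in E.
  rewrite !rpow_rpow in E. replace (/ q * q) with 1 in E by (field; lra).
  rewrite !rpow_1 in E by assumption. exact E.
Qed.

Lemma norm_equality_iff k f q l l' :
  (2 <= k)%nat -> 0 < q -> analytic_in_disc f ->
  mean_limit q f l -> mean_limit q (wiener k f) l' ->
  Hp_norm (Finite q) (wiener k f) = wiener_const k (Finite q) * Hp_norm (Finite q) f <->
  l' = INR k * pointwise_gain k q * l.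
Proof.
  intros Hk Hq Hf Hl Hl'.
  assert (Hg := pointwise_gain_pos k q Hk).
  assert (H : 0 < INR k) by (apply lt_0_INR; lia).
  assert (Hkg : 0 < INR k * pointwise_gain k q) by (apply Rmult_lt_0_compat; assumption).
  assert (L := mean_limit_ge_0 q f l Hf Hq Hl).
  assert (L' := mean_limit_ge_0 q _ l' (analytic_wiener k f Hf) Hq Hl').
  rewrite (Hp_norm_mean_limit q f l Hl), (Hp_norm_mean_limit q _ l' Hl').
  rewrite wiener_const_gain, <- rpow_mult by (assumption || lra).
  split; [|now intros ->].
  apply rpow_inv_inj; [assumption | assumption | apply Rmult_le_pos; lra].
Qed.

(** The gap controls [min(|f(z)|, |f(wz)|)^q], which is not a power of the modulus of an analytic
    function. The product with the larger modulus is one, and its power [q / 2] is the geometric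
    mean of [min^q] and [max^q], where [max^q] is bounded by the sum of moduli. *)
Lemma extremal_lt_1 k f q l l' :
  (2 <= k)%nat -> 0 < q < 1 -> analytic_in_disc f ->
  mean_limit q f l -> mean_limit q (wiener k f) l' ->
  l' = INR k * pointwise_gain k q * l -> forall z, unit_disc z -> f z = RtoC 0.
Proof.
  intros Hk Hq Hf Hl Hl' E. assert (HW := analytic_wiener k f Hf).
  assert (Hprod : forall z, unit_disc z -> (rotates k f z 0 * rotates k f z 1)%C = RtoC 0).
  { apply (extremal_vanish k f (fun z => rotates k f z 0 * rotates k f z 1)%C q (q / 2)
      (pointwise_gain k q) l l' Hk Hf); try assumption; try lra.
    { intros z Hz. apply ex_derive_C_mult; apply analytic_rotates; assumption. }
    intros eta Heta.
    destruct (rpow_interpolation (/ 2) eta ltac:(lra) Heta) as (K & HK & Hint).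
    set (c := 1 - Rpower 2 (q - 1)).
    assert (Hc : 0 < c).
    { unfold c. assert (Rpower 2 (q - 1) < Rpower 2 0) by (apply Rpower_lt; lra).
      rewrite Rpower_O in H by lra. lra. }
    (* The gap estimate reads [c * min^q <= sum - k^q |W_k f|^q], and the right-hand side is
       [k^q (g * sum - |W_k f|^q)] because [g = k^(-q)]. *)
    exists (K * (Rpower (INR k) q / c)).
    assert (Pk : 0 < Rpower (INR k) q) by apply exp_pos.
    assert (PK : 0 < Rpower (INR k) q / c) by (apply Rdiv_lt_0_compat; assumption).
    split; [apply Rmult_le_pos; lra|].
    intros z Hz. set (a := rotates k f z).
    assert (G := sum_subadditive_gap q a (k - 1) ltac:(lra) ltac:(lia)). fold c in G.
    unfold a in G at 4. rewrite rpow_sum_rotates in G by assumption.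
    set (mx := Rmax (Cmod (a 0%nat)) (Cmod (a 1%nat))).
    set (mn := Rmin (Cmod (a 0%nat)) (Cmod (a 1%nat))) in *.
    assert (P0 := Cmod_ge_0 (a 0%nat)). assert (P1 := Cmod_ge_0 (a 1%nat)).
    assert (Pmn : 0 <= mn) by (apply Rmin_glb; assumption).
    assert (Pmx : 0 <= mx) by (eapply Rle_trans; [exact P0 | apply Rmax_l]).
    assert (Emm : Cmod (a 0%nat * a 1%nat)%C = mn * mx).
    { rewrite Cmod_mult. unfold mn, mx, Rmin, Rmax. destruct Rle_dec; ring. }
    assert (Vmx : rpow mx q <= sum_moduli q a (k - 1)).
    { unfold mx, Rmax. destruct Rle_dec; apply sum_moduli_ge; lia. }
    specialize (Hint (rpow mn q) (rpow mx q) (rpow_ge_0 _ _) (rpow_ge_0 _ _)).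
    replace (1 - / 2) with (/ 2) in Hint by field.
    rewrite !rpow_rpow, <- rpow_mult, <- Emm in Hint by assumption.
    change (q * / 2) with (q / 2) in Hint.
    eapply Rle_trans; [exact Hint|].
    apply Rplus_le_compat; [apply Rmult_le_compat_l; lra|].
    rewrite Rmult_assoc. apply Rmult_le_compat_l; [exact HK|].
    unfold pointwise_gain. destruct Rle_dec as [h|h]; [|lra].
    rewrite Rpower_Ropp.
    apply (Rmult_le_reg_l c); [exact Hc|]. eapply Rle_trans; [exact G|].
    apply Req_le. field. lra. }
  destruct (analytic_mult_eq_0 (fun z => rotates k f z 0) (fun z => rotates k f z 1)) as [Z|Z];
    try (apply analytic_rotates; assumption); try assumption.
  - intros z Hz. rewrite <- (rotates_0 k f z). apply Z, Hz.
  - intros z Hz. unfold rotates in Z. rewrite Cpow_root_of_unity in Z.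
    set (al := INR 1 * (2 * PI / INR k)) in Z.
    replace z with (expi al * (expi (- al) * z))%C.
    + apply Z, unit_disc_rotate, Hz.
    + rewrite Cmult_assoc, <- expi_plus, Rplus_opp_r.
      unfold expi. rewrite cos_0, sin_0. change (1, 0) with (RtoC 1). apply Cmult_1_l.
Qed.

Lemma analytic_Cpow f n : analytic_in_disc f -> analytic_in_disc (fun z => Cpow (f z) n).
Proof.
  intros Hf z Hz. induction n.
  - exact (ex_derive_C_const (RtoC 1) z).
  - apply (ex_derive_C_mult f (fun z => Cpow (f z) n)); [apply Hf, Hz | exact IHn].
Qed.

Lemma rpow_pow x n q : 0 <= x -> rpow (x ^ n) q = rpow x q ^ n.
Proof.
  intros Hx. induction n; simpl; [apply rpow_one|].
  rewrite rpow_mult, IHn by (assumption || apply pow_le, Hx). reflexivity.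
Qed.

Lemma wiener_defect_le k f q z :
  (2 <= k)%nat -> 1 < q ->
  convexity_defect q (f z) (wiener k f z) <= INR k *
    (pointwise_gain k q * sum_moduli q (rotates k f z) (k - 1) - rpow (Cmod (wiener k f z)) q).
Proof.
  intros Hk Hq. assert (H : 0 < INR k) by (apply lt_0_INR; lia).
  assert (G := sum_convexity_gap q (rotates k f z) (wiener k f z) (k - 1) Hq).
  replace (S (k - 1)) with k in G by lia. specialize (G (wiener_scal k f z Hk)).
  rewrite rotates_0 in G.
  unfold pointwise_gain. destruct Rle_dec; [lra|].
  rewrite Rmult_minus_distr_l, <- Rmult_assoc, Rinv_r by lra. lra.
Qed.

Lemma pointwise_gain_le_1 k q : (2 <= k)%nat -> 0 < q -> pointwise_gain k q <= 1.
Proof.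
  intros Hk Hq. assert (H : 2 <= INR k) by (apply (le_INR 2); exact Hk).
  unfold pointwise_gain. destruct Rle_dec.
  - rewrite <- (Rpower_O (INR k)) by lra. apply Rle_Rpower; lra.
  - rewrite <- Rinv_1. apply Rinv_le_contravar; lra.
Qed.

Lemma wiener_le_sum_moduli k f q z :
  (2 <= k)%nat -> 0 < q ->
  rpow (Cmod (wiener k f z)) q <= sum_moduli q (rotates k f z) (k - 1).
Proof.
  intros Hk Hq. eapply Rle_trans; [apply wiener_pointwise; assumption|].
  assert (G := pointwise_gain_le_1 k q Hk Hq).
  assert (V := sum_moduli_ge q (rotates k f z) (k - 1) 0 ltac:(lia)).
  assert (V0 := rpow_ge_0 (Cmod (rotates k f z 0)) q). nra.
Qed.

(** The defect is a multiple of [x = (|a| + |m|)^(q-2) |a - m|^2]. With [y = (|a| + |m|)^q] the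
    powers of [|a| + |m|] cancel in [x^(q/2) y^(1 - q/2)] and leave [|a - m|^q]. *)
Lemma extremal_in_1_2 k f q l l' :
  (2 <= k)%nat -> 1 < q < 2 -> analytic_in_disc f ->
  mean_limit q f l -> mean_limit q (wiener k f) l' ->
  l' = INR k * pointwise_gain k q * l ->
  forall z, unit_disc z -> (f z - wiener k f z)%C = RtoC 0.
Proof.
  intros Hk Hq Hf Hl Hl' E. assert (HW := analytic_wiener k f Hf).
  assert (H : 0 < INR k) by (apply lt_0_INR; lia).
  apply (extremal_vanish k f (fun z => f z - wiener k f z)%C q q
      (pointwise_gain k q) l l' Hk Hf); try assumption; try lra.
  { intros z Hz. apply ex_derive_C_minus; [apply Hf, Hz | apply HW, Hz]. }
  intros eta Heta.
  (* [A] bounds [y] by the sum of moduli: [y <= 2^q max(|a|, |m|)^q], and both [|a|^q] and [|m|^q]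
     are at most that sum. *)
  set (A := 2 * Rpower 2 q).
  assert (PA : 0 < A) by (assert (0 < Rpower 2 q) by apply exp_pos; unfold A; lra).
  destruct (rpow_interpolation (q / 2) (eta / A) ltac:(lra)) as (K & HK & Hint).
  { apply Rdiv_lt_0_compat; assumption. }
  set (c := q * (q - 1) / 2). assert (Hc : 0 < c) by (unfold c; nra).
  exists (K * (INR k / c)).
  assert (PK : 0 < INR k / c) by (apply Rdiv_lt_0_compat; assumption).
  split; [apply Rmult_le_pos; lra|].
  intros z Hz. set (a := f z). set (m := wiener k f z).
  assert (D := wiener_defect_le k f q z Hk ltac:(lra)). fold a m in D.
  unfold convexity_defect in D. destruct Rle_dec as [h|_]; [lra|]. fold c in D.
  assert (Pa := Cmod_ge_0 a). assert (Pm := Cmod_ge_0 m). assert (Pg := Cmod_ge_0 (a - m)%C).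
  set (x := rpow (Cmod a + Cmod m) (q - 2) * Cmod (a - m)%C ^ 2).
  set (y := rpow (Cmod a + Cmod m) q).
  assert (Px : 0 <= x) by (apply Rmult_le_pos; [apply rpow_ge_0 | apply pow2_ge_0]).
  assert (Py : 0 <= y) by apply rpow_ge_0.
  assert (Hy : y <= A * sum_moduli q (rotates k f z) (k - 1)).
  { assert (Va : rpow (Cmod a) q <= sum_moduli q (rotates k f z) (k - 1)).
    { unfold a. rewrite <- (rotates_0 k f z). apply sum_moduli_ge; lia. }
    assert (Vm := wiener_le_sum_moduli k f q z Hk ltac:(lra)). fold m in Vm.
    assert (P2 : 0 < Rpower 2 q) by apply exp_pos.
    assert (V0 := rpow_ge_0 (Cmod a) q).
    apply Rle_trans with (Rpower 2 q * sum_moduli q (rotates k f z) (k - 1));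
      [|unfold A; nra].
    rewrite <- (rpow_Rpower 2) in * by lra.
    destruct (Rle_lt_dec (Cmod a) (Cmod m)) as [h|h].
    - apply Rle_trans with (rpow (2 * Cmod m) q).
      + apply rpow_le; lra.
      + rewrite rpow_mult by lra. apply Rmult_le_compat_l; lra.
    - apply Rle_trans with (rpow (2 * Cmod a) q).
      + apply rpow_le; lra.
      + rewrite rpow_mult by lra. apply Rmult_le_compat_l; lra. }
  assert (Hh : rpow (Cmod (a - m)%C) q <= rpow x (q / 2) * rpow y (1 - q / 2)).
  { destruct Pg as [Pg|<-].
    2:{ rewrite (rpow_nonpos 0) by lra. apply Rmult_le_pos; apply rpow_ge_0. }
    assert (Pam : 0 < Cmod a + Cmod m).
    { eapply Rlt_le_trans; [exact Pg|]. unfold Cminus.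
      eapply Rle_trans; [apply Cmod_triangle|]. rewrite Cmod_opp. lra. }
    unfold x, y. rewrite rpow_mult by (apply rpow_ge_0 || apply pow2_ge_0).
    rewrite !rpow_rpow, !(rpow_Rpower (Cmod a + Cmod m)) by exact Pam.
    rewrite <- (rpow_INR (Cmod (a - m)%C) 2), rpow_rpow by (lia || lra).
    rewrite (Rmult_comm (Rpower _ _) (rpow _ _)), Rmult_assoc, <- Rpower_plus.
    replace ((q - 2) * (q / 2) + q * (1 - q / 2)) with 0 by field.
    rewrite Rpower_O, Rmult_1_r by exact Pam.
    apply Req_le. f_equal. simpl. field. }
  eapply Rle_trans; [exact Hh|]. eapply Rle_trans; [apply Hint; assumption|].
  apply Rplus_le_compat.
  - apply Rle_trans with (eta / A * (A * sum_moduli q (rotates k f z) (k - 1))).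
    + apply Rmult_le_compat_l; [|exact Hy]. apply Rlt_le, Rdiv_lt_0_compat; assumption.
    + apply Req_le. field. lra.
  - rewrite Rmult_assoc. apply Rmult_le_compat_l; [exact HK|].
    apply (Rmult_le_reg_l c); [exact Hc|].
    unfold x. rewrite <- Rmult_assoc. eapply Rle_trans; [exact D|].
    apply Req_le. fold m. field. lra.
Qed.

(** The defect is a multiple of [x = |m|^(q-2) |a - m|^2], and [y = |m|^q]. In [x^(s/2) y^(1 - s/2)]
    the exponent of [|a - m|] is [s] and that of [|m|] is [q - s]. This is [(|m|^n |a - m|)^s]
    exactly when [s (n + 1) = q], and [n > q] makes the weight [s / 2] less than 1. *)
Lemma extremal_ge_2 k f q n l l' :
  (2 <= k)%nat -> 2 <= q -> (1 <= n)%nat -> q < INR n -> analytic_in_disc f ->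
  mean_limit q f l -> mean_limit q (wiener k f) l' ->
  l' = INR k * pointwise_gain k q * l ->
  forall z, unit_disc z -> (Cpow (wiener k f z) n * (f z - wiener k f z))%C = RtoC 0.
Proof.
  intros Hk Hq Hn Hqn Hf Hl Hl' E. assert (HW := analytic_wiener k f Hf).
  assert (H : 0 < INR k) by (apply lt_0_INR; lia).
  set (s := q / (INR n + 1)).
  assert (Hs : 0 < s) by (apply Rdiv_lt_0_compat; lra).
  assert (Es : s * (INR n + 1) = q) by (unfold s; field; lra).
  assert (Hs1 : s < 1) by nra.
  apply (extremal_vanish k f (fun z => Cpow (wiener k f z) n * (f z - wiener k f z))%C q s
      (pointwise_gain k q) l l' Hk Hf); try assumption; try lra.
  { intros z Hz. apply ex_derive_C_mult; [apply (analytic_Cpow _ n HW z Hz)|].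
    apply ex_derive_C_minus; [apply Hf, Hz | apply HW, Hz]. }
  intros eta Heta.
  destruct (rpow_interpolation (s / 2) eta ltac:(lra) Heta) as (K & HK & Hint).
  set (c := q / 2). assert (Hc : 0 < c) by (unfold c; lra).
  exists (K * (INR k / c)).
  assert (PK : 0 < INR k / c) by (apply Rdiv_lt_0_compat; assumption).
  split; [apply Rmult_le_pos; lra|].
  intros z Hz. set (a := f z). set (m := wiener k f z).
  assert (D := wiener_defect_le k f q z Hk ltac:(lra)). fold a m in D.
  unfold convexity_defect in D. destruct Rle_dec as [_|h]; [|lra]. fold c in D.
  assert (Pm := Cmod_ge_0 m). assert (Pg := Cmod_ge_0 (a - m)%C).
  set (x := rpow (Cmod m) (q - 2) * Cmod (a - m)%C ^ 2).
  set (y := rpow (Cmod m) q).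
  assert (Px : 0 <= x) by (apply Rmult_le_pos; [apply rpow_ge_0 | apply pow2_ge_0]).
  assert (Py : 0 <= y) by apply rpow_ge_0.
  assert (Hy : y <= sum_moduli q (rotates k f z) (k - 1))
    by (apply wiener_le_sum_moduli; [exact Hk | lra]).
  assert (Hh : rpow (Cmod (Cpow m n * (a - m))%C) s <= rpow x (s / 2) * rpow y (1 - s / 2)).
  { rewrite Cmod_mult, Cmod_pow, rpow_mult by (try apply pow_le; assumption).
    destruct Pm as [Pm|Pm].
    2:{ rewrite <- Pm, pow_i, (rpow_nonpos 0), Rmult_0_l by (lia || lra).
        apply Rmult_le_pos; apply rpow_ge_0. }
    rewrite <- (rpow_INR (Cmod m) n), rpow_rpow by (lia || lra).
    unfold x, y. rewrite (rpow_mult (rpow _ _)) by (apply rpow_ge_0 || apply pow2_ge_0).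
    rewrite !rpow_rpow, !(rpow_Rpower (Cmod m)) by exact Pm.
    rewrite <- (rpow_INR (Cmod (a - m)%C) 2), rpow_rpow by (lia || lra).
    replace (INR 2 * (s / 2)) with s by (simpl; field).
    rewrite (Rmult_comm (Rpower _ ((q - 2) * _))), Rmult_assoc, <- Rpower_plus.
    replace ((q - 2) * (s / 2) + q * (1 - s / 2)) with (INR n * s) by lra.
    apply Req_le. apply Rmult_comm. }
  eapply Rle_trans; [exact Hh|]. eapply Rle_trans; [apply Hint; assumption|].
  apply Rplus_le_compat; [apply Rmult_le_compat_l; lra|].
  rewrite Rmult_assoc. apply Rmult_le_compat_l; [exact HK|].
  apply (Rmult_le_reg_l c); [exact Hc|].
  unfold x. rewrite <- Rmult_assoc. eapply Rle_trans; [exact D|].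
  apply Req_le. unfold y. field. lra.
Qed.

Lemma wiener_zero k f z :
  (forall z, unit_disc z -> f z = RtoC 0) -> unit_disc z -> wiener k f z = RtoC 0.
Proof.
  intros Hf Hz. rewrite wiener_rotates.
  assert (S0 : forall n, sum_n (rotates k f z) n = RtoC 0).
  { assert (R0 : forall j, rotates k f z j = RtoC 0).
    { intros j. unfold rotates. rewrite Cpow_root_of_unity. apply Hf, unit_disc_rotate, Hz. }
    intros n; induction n; [now rewrite sum_O, R0|].
    rewrite sum_n_C_S, IHn, R0. apply Cplus_0_l. }
  rewrite S0. ring.
Qed.

Lemma mean_limit_0 q f :
  (forall z, unit_disc z -> f z = RtoC 0) -> mean_limit q f 0.
Proof.
  intros Hf. apply mean_limit_eps. intros eps He.
  generalize (at_left_1_interval 0 Rlt_0_1). apply filter_imp. intros r Hr.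
  replace (circle_mean q f r) with 0; [now rewrite Rminus_diag, Rabs_R0|].
  unfold circle_mean. rewrite (RInt_ext _ (fun _ => 0)); [rewrite RInt_const_R; ring|].
  intros t _. rewrite Hf, Cmod_0, rpow_nonpos by
    (lra || (apply unit_disc_scal_expi; rewrite Rabs_pos_eq; lra)).
  apply Rmult_0_l.
Qed.

Lemma extremal_gt_1 k f q l l' :
  (2 <= k)%nat -> 1 < q -> analytic_in_disc f ->
  mean_limit q f l -> mean_limit q (wiener k f) l' ->
  l' = INR k * pointwise_gain k q * l ->
  forall z, unit_disc z -> wiener k f z = f z.
Proof.
  intros Hk Hq Hf Hl Hl' E.
  assert (HW := analytic_wiener k f Hf).
  assert (Hsub : (forall z, unit_disc z -> (f z - wiener k f z)%C = RtoC 0) ->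
     forall z, unit_disc z -> wiener k f z = f z).
  { intros Hd z Hz. specialize (Hd z Hz).
    replace (f z) with ((f z - wiener k f z) + wiener k f z)%C by ring. rewrite Hd. ring. }
  destruct (Rlt_le_dec q 2) as [Hq2|Hq2].
  { apply Hsub. apply (extremal_in_1_2 k f q l l'); auto. }
  destruct (INR_unbounded q) as [n Hn].
  assert (Hn1 : (1 <= n)%nat) by (apply INR_le; simpl; lra).
  assert (Hp := extremal_ge_2 k f q n l l' Hk Hq2 Hn1 Hn Hf Hl Hl' E).
  destruct (analytic_mult_eq_0 (fun z => Cpow (wiener k f z) n) (fun z => f z - wiener k f z)%C)
    as [Z|Z].
  - apply analytic_Cpow, HW.
  - intros z Hz. apply ex_derive_C_minus; [apply Hf, Hz | apply HW, Hz].
  - exact Hp.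
  (* If [W_k f] vanishes identically, the assumed equality of means forces [l = 0], so [f] vanishes
     as well. *)
  - assert (ZW : forall z, unit_disc z -> wiener k f z = RtoC 0).
    { intros z Hz. apply NNPP. intros Hne. exact (Cpow_nz _ n Hne (Z z Hz)). }
    assert (Hl0 : l' = 0) by (apply (mean_limit_unique q _ _ _ Hl'), mean_limit_0, ZW).
    assert (Hg := pointwise_gain_pos k q Hk).
    assert (H : 0 < INR k) by (apply lt_0_INR; lia).
    assert (Hkg : 0 < INR k * pointwise_gain k q) by (apply Rmult_lt_0_compat; assumption).
    assert (l0 : l = 0) by nra.
    intros z Hz. rewrite (ZW z Hz). symmetry.
    apply (circle_mean_eq_0 f q Hf ltac:(lra)); [|exact Hz].
    intros r Hr. rewrite <- l0. apply mean_limit_ge; auto; lra.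
  - exact (Hsub Z).
Qed.

(** * Sharpness *)

Lemma Cmod_argmax (a : nat -> C) (n : nat) :
  exists i, (i <= n)%nat /\ forall j, (j <= n)%nat -> Cmod (a j) <= Cmod (a i).
Proof.
  induction n as [|n (i & Hi & H)].
  - exists O. split; [lia|]. intros j Hj. replace j with O by lia. lra.
  - destruct (Rle_lt_dec (Cmod (a (S n))) (Cmod (a i))) as [h|h].
    + exists i. split; [lia|]. intros j Hj.
      destruct (Nat.eq_dec j (S n)) as [->|Hne]; [exact h | apply H; lia].
    + exists (S n). split; [lia|]. intros j Hj.
      destruct (Nat.eq_dec j (S n)) as [->|Hne]; [lra|]. specialize (H j ltac:(lia)). lra.
Qed.

Lemma sum_moduli_le (q mu : R) (a : nat -> C) (n : nat) :
  (forall j, (j <= n)%nat -> rpow (Cmod (a j)) q <= mu) ->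
  sum_moduli q a n <= INR (S n) * mu.
Proof.
  intros H. induction n.
  - unfold sum_moduli. rewrite sum_O. simpl INR. specialize (H O ltac:(lia)). lra.
  - rewrite sum_moduli_S, (S_INR (S n)). specialize (IHn ltac:(intros; apply H; lia)).
    specialize (H (S n) ltac:(lia)). lra.
Qed.

(** A converse to subadditivity when all terms but the [i]-th are small. Each small term is paid for
    twice: in the sum of moduli and when it is removed from the modulus of the sum. *)
Lemma sum_moduli_dominant (q mu : R) (a : nat -> C) (i n : nat) :
  0 < q <= 1 -> (i <= n)%nat ->
  (forall j, (j <= n)%nat -> j <> i -> rpow (Cmod (a j)) q <= mu) -> 0 <= mu ->
  sum_moduli q a n <= rpow (Cmod (sum_n a n)) q + 2 * INR (S n) * mu.
Proof.
  intros Hq Hi H Hmu. induction n.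
  - unfold sum_moduli. rewrite !sum_O. simpl INR. lra.
  - rewrite sum_moduli_S, sum_n_C_S, (S_INR (S n)).
    assert (T : forall x y : C, rpow (Cmod x) q <= rpow (Cmod (x + y)%C) q + rpow (Cmod y) q).
    { intros x y. replace x with ((x + y) + - y)%C at 1 by ring.
      eapply Rle_trans; [apply rpow_le; [lra | apply Cmod_triangle]|].
      rewrite Cmod_opp. apply rpow_subadditive; auto using Cmod_ge_0. }
    assert (T1 := T (sum_n a n) (a (S n))). assert (T2 := T (a (S n)) (sum_n a n)).
    rewrite Cplus_comm in T2.
    destruct (Nat.eq_dec i (S n)) as [->|Hne].
    + assert (B := sum_moduli_le q mu a n ltac:(intros; apply H; lia)).
      assert (B' := sum_subadditive q a n Hq). lra.
    + specialize (IHn ltac:(lia) ltac:(intros; apply H; lia)).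
      specialize (H (S n) ltac:(lia) ltac:(lia)). lra.
Qed.

(** If [a i] has the largest modulus, then [|a j|^2 <= |a i| |a j| <= M] for every other [j]. *)
Lemma sum_moduli_separated (q M : R) (a : nat -> C) (n : nat) :
  0 < q <= 1 -> 0 <= M ->
  (forall i j, (i <= n)%nat -> (j <= n)%nat -> i <> j -> Cmod (a i) * Cmod (a j) <= M) ->
  sum_moduli q a n <= rpow (Cmod (sum_n a n)) q + 2 * INR (S n) * rpow M (q / 2).
Proof.
  intros Hq HM H. destruct (Cmod_argmax a n) as (i & Hi & Hmax).
  apply (sum_moduli_dominant q _ a i n Hq Hi); [|apply rpow_ge_0].
  intros j Hj Hji. specialize (H i j Hi Hj ltac:(auto)). specialize (Hmax j Hj).
  assert (P := Cmod_ge_0 (a j)).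
  replace q with (INR 2 * (q / 2)) at 1 by (simpl; field).
  rewrite <- rpow_rpow, rpow_INR by (lia || assumption).
  apply rpow_le; [lra|]. nra.
Qed.

Lemma cos_le_cos_first (y x : R) : 0 <= y <= PI -> y <= x <= 2 * PI - y -> cos x <= cos y.
Proof.
  intros Hy Hx. destruct (Rle_lt_dec x PI) as [h|h].
  - apply cos_decr_1; lra.
  - replace (cos x) with (cos (2 * PI - x)).
    + apply cos_decr_1; lra.
    + rewrite cos_minus, cos_2PI, sin_2PI. ring.
Qed.

Lemma Cmod_expi_plus (s t : R) : Cmod (expi s + expi t)%C ^ 2 = 2 + 2 * cos (s - t).
Proof.
  rewrite Cmod_sqr, cos_minus. unfold expi; simpl.
  assert (A := sin2_cos2 s). assert (B := sin2_cos2 t). unfold Rsqr in *. lra.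
Qed.

(** The squared modulus of a sum of two unit vectors is [2 + 2 cos] of their angle. For distinct
    roots the angle is between [2 PI / k] and [2 PI - 2 PI / k], so the half-angle formula gives
    [c = cos (PI / k)]. *)
Lemma roots_of_unity_separated (k : nat) :
  (2 <= k)%nat -> exists c, 0 <= c < 1 /\ forall i j, (i < k)%nat -> (j < k)%nat -> i <> j ->
    Cmod (Cpow (root_of_unity k) i + Cpow (root_of_unity k) j)%C <= 2 * c.
Proof.
  intros Hk. assert (Hpi := PI_RGT_0). assert (HK : 2 <= INR k) by (apply (le_INR 2), Hk).
  set (y := 2 * PI / INR k).
  assert (Hyk : INR k * y = 2 * PI) by (unfold y; field; lra).
  assert (Hy0 : 0 < y) by (apply Rdiv_lt_0_compat; lra).
  assert (Hy1 : y <= PI) by nra.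
  assert (Hc1 : cos y < 1) by (rewrite <- cos_0; apply cos_decreasing_1; lra).
  assert (Hc0 := COS_bound y).
  exists (sqrt ((1 + cos y) / 2)). split.
  { split; [apply sqrt_pos|]. apply Rlt_le_trans with (sqrt 1); [apply sqrt_lt_1; lra | rewrite sqrt_1; lra]. }
  assert (W : forall i j, (i < k)%nat -> (j < i)%nat ->
    Cmod (Cpow (root_of_unity k) i + Cpow (root_of_unity k) j)%C <= 2 * sqrt ((1 + cos y) / 2)).
  { intros i j Hi Hj. rewrite !Cpow_root_of_unity. fold y.
    assert (Hsq := Cmod_expi_plus (INR i * y) (INR j * y)).
    replace (INR i * y - INR j * y) with (INR (i - j) * y) in Hsq
      by (rewrite minus_INR by lia; ring).
    assert (D1 : 1 <= INR (i - j)) by (apply (le_INR 1); lia).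
    assert (D2 : INR (i - j) <= INR k - 1).
    { replace (INR k - 1) with (INR (k - 1)) by (rewrite minus_INR by lia; reflexivity).
      apply le_INR; lia. }
    assert (Hcos := cos_le_cos_first y (INR (i - j) * y) ltac:(lra) ltac:(split; nra)).
    apply Rsqr_incr_0_var; [|assert (h := sqrt_pos ((1 + cos y) / 2)); lra].
    unfold Rsqr.
    assert (S2 := sqrt_sqrt ((1 + cos y) / 2) ltac:(lra)). simpl in Hsq. nra. }
  intros i j Hi Hj Hij. destruct (Nat.lt_ge_cases j i) as [h|h].
  - apply W; lia.
  - rewrite Cplus_comm. apply W; lia.
Qed.

(** The product is at most half the sum of the squares, and [|1 + u|^2 <= 2 + 2 Re u] for
    [|u| <= 1]. *)
Lemma Cmod_one_plus_mult_le (u v : C) :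
  Cmod u <= 1 -> Cmod v <= 1 -> Cmod (1 + u)%C * Cmod (1 + v)%C <= 2 + Cmod (u + v)%C.
Proof.
  intros Hu Hv.
  assert (E : forall w : C, Cmod (1 + w)%C ^ 2 = 1 + 2 * fst w + Cmod w ^ 2).
  { intros w. rewrite !Cmod_sqr. simpl. ring. }
  assert (Eu := E u). assert (Ev := E v).
  assert (B : fst (u + v)%C <= Cmod (u + v)%C)
    by (eapply Rle_trans; [apply Rle_abs | apply Rabs_fst_le_Cmod]).
  simpl in B.
  assert (Pu := Cmod_ge_0 u). assert (Pv := Cmod_ge_0 v).
  assert (Cmod u ^ 2 <= 1) by nra. assert (Cmod v ^ 2 <= 1) by nra.
  assert (Q := pow2_ge_0 (Cmod (1 + u)%C - Cmod (1 + v)%C)).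
  nra.
Qed.

Definition one_plus_pow (N : nat) (z : C) : C := Cpow (1 + z)%C N.

Lemma analytic_one_plus_pow N : analytic_in_disc (one_plus_pow N).
Proof.
  apply analytic_Cpow. intros z _.
  apply ex_derive_C_plus; [apply ex_derive_C_const | apply ex_derive_C_id].
Qed.

(** The moduli of two distinct rotations of [(1 + z)^N] have a product of at most [(2 + 2c)^N], of
    smaller growth than [4^N]. The error term thus grows like the [q]-th power of [sqrt (2 + 2c)^N],
    with base below 2. *)
Lemma one_plus_pow_separated (k N : nat) (q c : R) (z : C) :
  (2 <= k)%nat -> 0 < q <= 1 -> 0 <= c ->
  (forall i j, (i < k)%nat -> (j < k)%nat -> i <> j ->
    Cmod (Cpow (root_of_unity k) i + Cpow (root_of_unity k) j)%C <= 2 * c) ->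
  unit_disc z ->
  sum_moduli q (rotates k (one_plus_pow N) z) (k - 1) <=
    Rpower (INR k) q * rpow (Cmod (wiener k (one_plus_pow N) z)) q +
    2 * INR k * rpow (2 + 2 * c) (q / 2) ^ N.
Proof.
  intros Hk Hq Hc Hsep Hz.
  rewrite <- rpow_sum_rotates by exact Hk. rewrite <- rpow_pow by lra.
  replace (INR k) with (INR (S (k - 1))) by (f_equal; lia).
  apply sum_moduli_separated; [exact Hq | apply pow_le; lra |].
  intros i j Hi Hj Hij. unfold rotates, one_plus_pow.
  rewrite !Cmod_pow, <- Rpow_mult_distr. apply pow_incr.
  split; [apply Rmult_le_pos; apply Cmod_ge_0|].
  assert (U : forall j, Cmod (Cpow (root_of_unity k) j * z)%C <= 1).
  { intros m. rewrite Cpow_root_of_unity. apply Rlt_le, unit_disc_rotate, Hz. }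
  eapply Rle_trans; [apply Cmod_one_plus_mult_le; apply U|].
  rewrite <- Cmult_plus_distr_r, Cmod_mult.
  specialize (Hsep i j ltac:(lia) ltac:(lia) Hij).
  assert (h := Cmod_ge_0 (Cpow (root_of_unity k) i + Cpow (root_of_unity k) j)%C).
  unfold unit_disc in Hz. assert (h' := Cmod_ge_0 z). nra.
Qed.

Lemma circle_mean_bounded (f : C -> C) (q M r : R) :
  analytic_in_disc f -> 0 < q -> 0 <= r < 1 ->
  (forall z, unit_disc z -> Cmod (f z) <= M) -> circle_mean q f r <= rpow M q.
Proof.
  intros Hf Hq Hr H. assert (Hpi := PI_RGT_0).
  assert (Hr' : Rabs r < 1) by (rewrite Rabs_pos_eq; lra).
  rewrite circle_mean_integral by assumption.
  apply (Rmult_le_reg_r (2 * PI)); [lra|]. unfold Rdiv.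
  rewrite Rmult_assoc, Rinv_l, Rmult_1_r by lra.
  apply Rle_trans with (RInt (fun _ => rpow M q) 0 (2 * PI)).
  - apply RInt_le; [lra | | apply ex_RInt_const |].
    + apply ex_RInt_cont. intros t. apply continuous_circle_modulus; assumption.
    + intros t _. apply rpow_le; [exact Hq|]. apply H, unit_disc_scal_expi, Hr'.
  - rewrite RInt_const_R. apply Req_le. ring.
Qed.

(** On the circle of radius [r = sqrt (L - 1)], [|1 + z| >= 1 + r cos t >= 1 + r^2 = L] as long as
    [cos t >= r]. The arc from 0 to [acos r] has a share [mu] of the circle that does not depend on
    [N]. *)
Lemma circle_mean_one_plus_pow_ge (q L : R) :
  0 < q -> 1 < L < 2 -> exists mu r, 0 < mu /\ 0 <= r < 1 /\
    forall N, mu * rpow L q ^ N <= circle_mean q (one_plus_pow N) r.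
Proof.
  intros Hq HL. assert (Hpi := PI_RGT_0).
  set (r := sqrt (L - 1)).
  assert (Hr : r * r = L - 1) by (apply sqrt_sqrt; lra).
  assert (Hr0 : 0 < r) by (apply sqrt_lt_R0; lra).
  assert (Hr1 : r < 1) by nra.
  assert (Hr' : Rabs r < 1) by (rewrite Rabs_pos_eq; lra).
  set (tau := acos r).
  assert (Hct : cos tau = r) by (apply cos_acos; lra).
  assert (Ht := acos_bound r). fold tau in Ht.
  assert (Ht0 : 0 < tau).
  { destruct (Req_dec tau 0) as [E|]; [|lra]. rewrite E, cos_0 in Hct. lra. }
  exists (tau / (2 * PI)), r.
  split; [apply Rdiv_lt_0_compat; lra|]. split; [lra|]. intros N.
  assert (Ha := analytic_one_plus_pow N).
  rewrite circle_mean_integral by assumption.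
  unfold circle_integral.
  set (u := fun t => rpow (Cmod (one_plus_pow N (RtoC r * expi t)%C)) q).
  assert (Cu : forall t, continuous u t) by (intros; apply continuous_circle_modulus; assumption).
  replace (tau / (2 * PI) * rpow L q ^ N) with ((tau - 0) * rpow L q ^ N / (2 * PI)) by (field; lra).
  apply Rmult_le_compat_r; [apply Rlt_le, Rinv_0_lt_compat; lra|].
  rewrite <- (RInt_Chasles_R u 0 tau (2 * PI)) by (apply ex_RInt_cont, Cu).
  assert (P : 0 <= RInt u tau (2 * PI))
    by (apply RInt_ge_0; [lra | apply ex_RInt_cont, Cu | intros; apply rpow_ge_0]).
  assert (B : RInt (fun _ => rpow L q ^ N) 0 tau <= RInt u 0 tau).
  { apply RInt_le; [lra | apply ex_RInt_const | apply ex_RInt_cont, Cu |].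
    intros t Ht'. unfold u, one_plus_pow. rewrite Cmod_pow, rpow_pow by apply Cmod_ge_0.
    apply pow_incr. split; [apply rpow_ge_0|]. apply rpow_le; [exact Hq|].
    eapply Rle_trans; [|apply Rabs_fst_le_Cmod]. eapply Rle_trans; [|apply Rle_abs].
    assert (Hcos : cos tau <= cos t) by (apply cos_decr_1; lra).
    simpl. rewrite Hct in Hcos. nra. }
  rewrite RInt_const_R in B. lra.
Qed.

Lemma sharp_lt_1 (k : nat) (q c : R) :
  (2 <= k)%nat -> 0 < q < 1 ->
  (forall f, in_Hp (Finite q) f ->
     Hp_norm (Finite q) (wiener k f) <= c * Hp_norm (Finite q) f) ->
  wiener_const k (Finite q) <= c.
Proof.
  intros Hk Hq Hc.
  assert (HK : 2 <= INR k) by (apply (le_INR 2), Hk).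
  destruct (roots_of_unity_separated k Hk) as (d & Hd & Hsep).
  set (T := 2 + 2 * d).
  assert (HT : 2 <= T < 4) by (unfold T; lra).
  set (sT := sqrt T).
  assert (HsT : sT * sT = T) by (apply sqrt_sqrt; lra).
  assert (HsT0 : 0 <= sT) by apply sqrt_pos.
  (* [L] is placed between [sqrt T], the growth rate of the error term, and 2, below which every
     rate is attained by the means of [one_plus_pow N]. The ratio [x] below is therefore less than
     1. *)
  set (L := (sT + 2) / 2).
  assert (HL : 1 < L < 2) by (unfold L; nra).
  assert (HsL : sT < L) by (unfold L; nra).
  destruct (circle_mean_one_plus_pow_ge q L ltac:(lra) HL) as (mu & r0 & Hmu & Hr0 & Hlow).
  assert (HTq : rpow T (q / 2) = rpow sT q).
  { rewrite <- HsT, rpow_mult, <- rpow_plus by assumption. f_equal. field. }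
  assert (PLq : 0 < rpow L q) by (apply rpow_pos; lra).
  set (x := rpow sT q / rpow L q).
  assert (Hx : 0 <= x < 1).
  { split.
    - apply Rmult_le_pos; [apply rpow_ge_0 | apply Rlt_le, Rinv_0_lt_compat, PLq].
    - apply (Rmult_lt_reg_r (rpow L q)); [exact PLq|]. unfold x, Rdiv.
      rewrite Rmult_assoc, Rinv_l by lra. rewrite Rmult_1_l, Rmult_1_r. apply rpow_lt; lra. }
  assert (Pk : 0 < Rpower (INR k) q) by apply exp_pos.
  (* The separated lower bound for the mean of [W_k f] is combined with the assumed bound by [c] and
     divided by [l], which is at least [mu * L^(q N)]. Letting [N] tend to infinity then leaves
     [k <= k^q c^q]. *)
  assert (Key : forall N, 0 <= c /\
     INR k <= Rpower (INR k) q * rpow c q + 2 * INR k / mu * x ^ N).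
  { intros N. assert (Ha := analytic_one_plus_pow N).
    assert (HaW := analytic_wiener k _ Ha).
    destruct (mean_limit_ex q (one_plus_pow N) (rpow (2 ^ N) q) Ha ltac:(lra)) as [l Hl].
    { intros r Hr. apply circle_mean_bounded; [exact Ha | lra | exact Hr |].
      intros z Hz. unfold one_plus_pow. rewrite Cmod_pow. apply pow_incr.
      split; [apply Cmod_ge_0|]. eapply Rle_trans; [apply Cmod_triangle|].
      rewrite Cmod_1. unfold unit_disc in Hz. lra. }
    destruct (wiener_mean_limit k _ q l Hk ltac:(lra) Ha Hl) as (l' & Hl' & Hl'0 & _).
    assert (PN : 0 < rpow L q ^ N) by (apply pow_lt, PLq).
    assert (Hl0 : mu * rpow L q ^ N <= l).
    { eapply Rle_trans; [apply Hlow|]. apply (mean_limit_ge q _ l r0 Ha); auto; lra. }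
    assert (Hlpos : 0 < l) by (assert (0 < mu * rpow L q ^ N) by (apply Rmult_lt_0_compat; assumption); lra).
    assert (Hnorm := Hc (one_plus_pow N) (conj Ha (ex_intro _ l Hl))).
    rewrite (Hp_norm_mean_limit q _ l Hl), (Hp_norm_mean_limit q _ l' Hl') in Hnorm.
    assert (Pl : 0 < rpow l (/ q)) by (apply rpow_pos, Hlpos).
    assert (Pl' := rpow_ge_0 l' (/ q)).
    assert (Hc0 : 0 <= c) by nra.
    split; [exact Hc0|].
    assert (Hll : l' <= rpow c q * l).
    { apply (rpow_le _ _ q ltac:(lra)) in Hnorm.
      rewrite rpow_mult in Hnorm by lra. rewrite !rpow_rpow in Hnorm.
      replace (/ q * q) with 1 in Hnorm by (field; lra).
      rewrite !rpow_1 in Hnorm by lra. exact Hnorm. }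
    assert (Hmain : INR k * l <= Rpower (INR k) q * l' + 2 * INR k * rpow T (q / 2) ^ N).
    { apply (Rmult_le_reg_l (/ INR k)); [apply Rinv_0_lt_compat; lra|].
      rewrite <- Rmult_assoc, Rinv_l, Rmult_1_l by lra.
      apply (mean_limit_le q _ l _ Hl).
      generalize (at_left_1_interval 0 Rlt_0_1). apply filter_imp. intros r Hr.
      assert (M := circle_mean_le_wiener k (one_plus_pow N) (fun _ => RtoC 0) q q (-1)
        (- Rpower (INR k) q) (2 * INR k * rpow T (q / 2) ^ N) r Hk Ha
        (fun z _ => ex_derive_C_const (RtoC 0) z) ltac:(lra) ltac:(lra) ltac:(lra)).
      assert (M0 := circle_mean_ge_0 q (fun _ => RtoC 0) r
         (fun z _ => ex_derive_C_const (RtoC 0) z) ltac:(lra) ltac:(lra)).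
      assert (ML := mean_limit_ge q _ l' r HaW ltac:(lra) Hl' ltac:(lra)).
      apply (Rmult_le_reg_l (INR k)); [lra|].
      rewrite <- Rmult_assoc, Rinv_r, Rmult_1_l by lra.
      eapply Rle_trans in M; [|exact M0|]. 
      - nra.
      - intros z Hz. rewrite Cmod_0, rpow_nonpos by lra.
        assert (S := one_plus_pow_separated k N q d z Hk ltac:(lra) ltac:(lra) Hsep Hz).
        fold T in S. lra. }
    rewrite HTq in Hmain.
    assert (Ex : rpow sT q ^ N = x ^ N * rpow L q ^ N).
    { rewrite <- Rpow_mult_distr. f_equal. unfold x. field. lra. }
    rewrite Ex in Hmain.
    assert (Px : 0 <= x ^ N) by (apply pow_le; lra).
    assert (Bx : x ^ N * rpow L q ^ N <= x ^ N * (l / mu)).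
    { apply Rmult_le_compat_l; [exact Px|]. apply (Rmult_le_reg_l mu); [exact Hmu|].
      replace (mu * (l / mu)) with l by (field; lra). exact Hl0. }
    apply (Rmult_le_reg_r l); [exact Hlpos|].
    replace ((Rpower (INR k) q * rpow c q + 2 * INR k / mu * x ^ N) * l) with
      (Rpower (INR k) q * (rpow c q * l) + 2 * INR k * (x ^ N * (l / mu))) by (field; lra).
    assert (Rpower (INR k) q * l' <= Rpower (INR k) q * (rpow c q * l))
      by (apply Rmult_le_compat_l; lra).
    assert (2 * INR k * (x ^ N * rpow L q ^ N) <= 2 * INR k * (x ^ N * (l / mu)))
      by (apply Rmult_le_compat_l; lra).
    lra. }
  assert (Hc0 : 0 <= c) by apply (Key O).
  assert (Hkc : INR k <= Rpower (INR k) q * rpow c q).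
  { apply le_epsilon. intros eps He.
    set (A := 2 * INR k / mu).
    assert (PA : 0 < A) by (apply Rdiv_lt_0_compat; lra).
    destruct (pow_lt_1_zero x) with (y := eps / A) as [N HN].
    - rewrite Rabs_pos_eq; lra.
    - apply Rdiv_lt_0_compat; assumption.
    - specialize (HN N (le_n _)). rewrite Rabs_pos_eq in HN by (apply pow_le; lra).
      destruct (Key N) as [_ K]. fold A in K.
      apply (Rmult_lt_compat_l A) in HN; [|exact PA].
      replace (A * (eps / A)) with eps in HN by (field; lra). lra. }
  rewrite wiener_const_gain by (assumption || lra).
  apply Rle_trans with (rpow (rpow c q) (/ q)).
  - apply rpow_le; [apply Rinv_0_lt_compat; lra|].
    unfold pointwise_gain. destruct Rle_dec; [|lra].
    rewrite Rpower_Ropp. apply (Rmult_le_reg_l (Rpower (INR k) q)); [exact Pk|].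
    eapply Rle_trans; [|exact Hkc]. apply Req_le. field. lra.
  - rewrite rpow_rpow, Rinv_r, rpow_1 by lra. lra.
Qed.

Lemma wiener_one k z : (2 <= k)%nat -> wiener k (fun _ => RtoC 1) z = RtoC 1.
Proof.
  intros Hk. rewrite wiener_rotates.
  assert (E : forall n, sum_n (rotates k (fun _ => RtoC 1) z) n = RtoC (INR (S n))).
  { intros n. induction n; [now rewrite sum_O|].
    rewrite sum_n_C_S, IHn, (S_INR (S n)), RtoC_plus. reflexivity. }
  rewrite E. replace (S (k - 1)) with k by lia. apply Cinv_l.
  intros h. apply RtoC_inj in h. assert (0 < INR k) by (apply lt_0_INR; lia). lra.
Qed.

Lemma mean_limit_one q : 0 < q -> mean_limit q (fun _ => RtoC 1) 1.
Proof.
  intros Hq. assert (Hpi := PI_RGT_0). apply mean_limit_eps. intros eps He.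
  generalize (at_left_1_interval 0 Rlt_0_1). apply filter_imp. intros r Hr.
  replace (circle_mean q (fun _ => RtoC 1) r) with 1; [now rewrite Rminus_diag, Rabs_R0|].
  unfold circle_mean. rewrite RInt_const_R, Cmod_1, rpow_one. field. lra.
Qed.

(** Constants are fixed by [W_k], and [k g = 1] here: at [q = 1] the subadditive value [k^(-q)] of
    the gain agrees with [1/k]. *)
Lemma sharp_ge_1 (k : nat) (q c : R) :
  (2 <= k)%nat -> 1 <= q ->
  (forall f, in_Hp (Finite q) f ->
     Hp_norm (Finite q) (wiener k f) <= c * Hp_norm (Finite q) f) ->
  wiener_const k (Finite q) <= c.
Proof.
  intros Hk Hq Hc. assert (HK : 2 <= INR k) by (apply (le_INR 2), Hk).
  assert (L := mean_limit_one q ltac:(lra)).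
  assert (L' : mean_limit q (wiener k (fun _ => RtoC 1)) 1).
  { apply (mean_limit_ext q (fun _ => RtoC 1)); [|exact L].
    intros z _. symmetry. apply wiener_one, Hk. }
  assert (N := Hc (fun _ => RtoC 1)
    (conj (fun z _ => ex_derive_C_const (RtoC 1) z) (ex_intro _ 1 L))).
  rewrite (Hp_norm_mean_limit q _ 1 L), (Hp_norm_mean_limit q _ 1 L'), rpow_one in N.
  rewrite wiener_const_gain by (assumption || lra).
  replace (INR k * pointwise_gain k q) with 1; [rewrite rpow_one; lra|].
  unfold pointwise_gain. destruct Rle_dec as [h|h]; [|field; lra].
  replace q with 1 by lra. rewrite Rpower_Ropp, Rpower_1 by lra. field; lra.
Qed.

(** * Bounded functions *)

Lemma Hp_norm_infty_lub f M :
  (forall z, unit_disc z -> Cmod (f z) <= M) ->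
  (forall z, unit_disc z -> Cmod (f z) <= Hp_norm p_infty f) /\ Hp_norm p_infty f <= M.
Proof.
  intros H. simpl.
  set (E := fun x => exists z, unit_disc z /\ x = Cmod (f z)).
  destruct (Lub_Rbar_correct E) as [Hub Hlub].
  assert (H0 : unit_disc (RtoC 0)) by (unfold unit_disc; rewrite Cmod_0; lra).
  assert (HM : Rbar_le (Lub_Rbar E) M).
  { apply Hlub. intros x (z & Hz & ->). apply H, Hz. }
  assert (Hf : forall z, unit_disc z -> Rbar_le (Cmod (f z)) (Lub_Rbar E)).
  { intros z Hz. apply Hub. now exists z. }
  (* The value at 0 excludes [m_infty] and the bound [M] excludes [p_infty], so [real] returns the
     true supremum and not a default. *)
  assert (h := Hf _ H0).
  destruct (Lub_Rbar E) as [x| |]; simpl in *; try contradiction.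
  split; [exact Hf | exact HM].
Qed.

(** The triangle inequality, taken from [wiener_pointwise] at exponent 1. *)
Lemma wiener_bounded k f M z :
  (2 <= k)%nat -> (forall z, unit_disc z -> Cmod (f z) <= M) -> unit_disc z ->
  Cmod (wiener k f z) <= M.
Proof.
  intros Hk H Hz.
  assert (P := wiener_pointwise k f 1 z Hk ltac:(lra)).
  assert (S := sum_moduli_le 1 M (rotates k f z) (k - 1)).
  replace (Datatypes.S (k - 1)) with k in S by lia.
  rewrite rpow_1 in P by apply Cmod_ge_0.
  assert (HK : 0 < INR k) by (apply lt_0_INR; lia).
  assert (G : pointwise_gain k 1 = / INR k).
  { unfold pointwise_gain. destruct Rle_dec; [|lra]. now rewrite Rpower_Ropp, Rpower_1. }
  rewrite G in P.
  eapply Rle_trans; [exact P|]. apply (Rmult_le_reg_l (INR k)); [exact HK|].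
  rewrite <- Rmult_assoc, Rinv_r, Rmult_1_l by lra. apply S.
  intros j _. rewrite rpow_1 by apply Cmod_ge_0. unfold rotates.
  apply H. rewrite Cpow_root_of_unity. apply unit_disc_rotate, Hz.
Qed.

Lemma wiener_const_infty k : (2 <= k)%nat -> wiener_const k p_infty = 1.
Proof.
  intros Hk. assert (HK : 2 <= INR k) by (apply (le_INR 2), Hk).
  unfold wiener_const. simpl. apply Rmax_right.
  apply Rle_trans with (Rpower (INR k) 0); [apply Rle_Rpower; lra | rewrite Rpower_O; lra].
Qed.

Theorem theorem1 :
  forall (k : nat) (p : Rbar), (2 <= k)%nat -> Rbar_lt (Finite 0) p ->
    (forall f : C -> C, in_Hp p f ->
       in_Hp p (wiener k f) /\
       Hp_norm p (wiener k f) <= wiener_const k p * Hp_norm p f) /\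
    (forall c : R,
       (forall f : C -> C, in_Hp p f ->
          Hp_norm p (wiener k f) <= c * Hp_norm p f) ->
       wiener_const k p <= c) /\
    (Rbar_lt p (Finite 1) ->
     forall f : C -> C, in_Hp p f ->
       (Hp_norm p (wiener k f) = wiener_const k p * Hp_norm p f <->
        forall z : C, unit_disc z -> f z = RtoC 0)) /\
    (Rbar_lt (Finite 1) p -> Rbar_lt p p_infty ->
     forall f : C -> C, in_Hp p f ->
       (Hp_norm p (wiener k f) = wiener_const k p * Hp_norm p f <->
        forall z : C, unit_disc z -> wiener k f z = f z)).
Proof.
  intros k p Hk Hp. assert (HK : 0 < INR k) by (apply lt_0_INR; lia).
  destruct p as [q| |]; [| |contradiction].
  - simpl in Hp. assert (Hg := pointwise_gain_pos k q Hk).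
    assert (Hkg : 0 < INR k * pointwise_gain k q) by (apply Rmult_lt_0_compat; assumption).
    split; [|split; [|split]].
    + intros f [Hf [l Hl]].
      destruct (wiener_mean_limit k f q l Hk Hp Hf Hl) as (l' & Hl' & Hle).
      split; [split; [apply analytic_wiener, Hf | now exists l']|].
      rewrite (Hp_norm_mean_limit q f l Hl), (Hp_norm_mean_limit q _ l' Hl').
      assert (L := mean_limit_ge_0 q f l Hf Hp Hl).
      rewrite wiener_const_gain, <- rpow_mult by (assumption || lra).
      apply rpow_le; [apply Rinv_0_lt_compat, Hp | apply Hle].
    + intros c Hc. destruct (Rlt_le_dec q 1).
      * apply sharp_lt_1; auto.
      * apply sharp_ge_1; auto.
    + intros Hq f [Hf [l Hl]]. simpl in Hq.
      destruct (wiener_mean_limit k f q l Hk Hp Hf Hl) as (l' & Hl' & _).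
      rewrite (norm_equality_iff k f q l l') by assumption. split.
      * intros E. apply (extremal_lt_1 k f q l l'); auto.
      * intros Z.
        rewrite (mean_limit_unique q f l 0 Hl (mean_limit_0 q f Z)).
        rewrite (mean_limit_unique q _ l' 0 Hl' (mean_limit_0 q _
          (fun z Hz => wiener_zero k f z Z Hz))). ring.
    + intros Hq _ f [Hf [l Hl]]. simpl in Hq.
      destruct (wiener_mean_limit k f q l Hk Hp Hf Hl) as (l' & Hl' & _).
      rewrite (norm_equality_iff k f q l l') by assumption. split.
      * intros E. apply (extremal_gt_1 k f q l l'); auto.
      * intros Z.
        rewrite (mean_limit_unique q f l l' Hl (mean_limit_ext q _ _ l' Z Hl')).
        unfold pointwise_gain. destruct Rle_dec; [lra|]. field. lra.
  - rewrite wiener_const_infty by exact Hk. split; [|split; [|split]].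
    + intros f [Hf [M HM]].
      destruct (Hp_norm_infty_lub f M HM) as [Hle _].
      split.
      * split; [apply analytic_wiener, Hf|].
        exists M. intros z Hz. apply wiener_bounded; assumption.
      * rewrite Rmult_1_l.
        apply (Hp_norm_infty_lub (wiener k f) (Hp_norm p_infty f)).
        intros z Hz. apply wiener_bounded; assumption.
    + intros c Hc.
      assert (B : forall z, unit_disc z -> Cmod (RtoC 1) <= 1) by (intros; rewrite Cmod_1; lra).
      assert (B' : forall z, unit_disc z -> Cmod (wiener k (fun _ => RtoC 1) z) <= 1)
        by (intros; rewrite wiener_one, Cmod_1 by exact Hk; lra).
      assert (H0 : unit_disc (RtoC 0)) by (unfold unit_disc; rewrite Cmod_0; lra).
      assert (N := Hc (fun _ => RtoC 1)
        (conj (fun z _ => ex_derive_C_const (RtoC 1) z) (ex_intro _ 1 B))).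
      destruct (Hp_norm_infty_lub (fun _ => RtoC 1) 1 B) as [U1 U2].
      destruct (Hp_norm_infty_lub _ 1 B') as [V1 V2].
      specialize (U1 _ H0). specialize (V1 _ H0). rewrite wiener_one in V1 by exact Hk.
      rewrite Cmod_1 in U1, V1.
      replace (Hp_norm p_infty (fun _ => RtoC 1)) with 1 in N by lra. lra.
    + intros h; contradiction.
    + intros _ h; contradiction.
Qed.
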